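(* Let the parameters $p,q,r,\tilde r,\rho$ satisfy one of the following: (A) $1<p\le q<\infty$, $1<r,\tilde r<\infty$, $\rho=\infty$; (B) $1<q<p<\infty$, $1<r,\tilde r<\infty$, $0<\rho<\infty$ and $\frac1q=\frac1p+\frac1\rho$; (C) $0<q\le1<p<\infty$, $1<r<\infty$, $\tilde r=1$, $0<\rho<\infty$ and $\frac1q=\frac1p+\frac1\rho$. Then there is a constant $C>0$, depending only on $n,p,q,r,\tilde r,\rho$, such that for every $(w,v)\in\mathcal{A}^{r,\tilde r}_{p,q,\rho}(\mathbb{R}^n)$ and every $f\in Lip_{\rm c}(\mathbb{R}^n)$, $$\|v\cdot f\|_{L^q(\mathbb{R}^n)}\le C\,[w,v]_{\mathcal{A}^{r,\tilde r}_{p,q,\rho}(\mathbb{R}^n)}\,\bigl\|w|\nabla f|\bigr\|_{L^p(\mathbb{R}^n)}.$$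
   Context: $\mathcal{D}(\mathbb{R}^n)$ is the family of dyadic cubes $2^{-j}(m+[0,1)^n)$, $j\in\mathbb{Z}$, $m\in\mathbb{Z}^n$; $\ell_Q$ is the side length of $Q$. $Lip_{\rm c}(\mathbb{R}^n)$ is the family of all compactly supported Lipschitz functions on $\mathbb{R}^n$. A weight on $\mathbb{R}^n$ is a function $w\in L^1_{\rm loc}(\mathbb{R}^n)$ with $w(x)>0$ and $w(x)^{-1}>0$ for a.e. $x$. $p'=p/(p-1)$. For $1<p<\infty$, $0<q<\infty$, $1\le r,\tilde r<\infty$, $0<\rho\le\infty$, $\mathcal{A}^{r,\tilde r}_{p,q,\rho}(\mathbb{R}^n)$ is the family of all pairs $(w,v)$ of weights on $\mathbb{R}^n$ with $$[w,v]_{\mathcal{A}^{r,\tilde r}_{p,q,\rho}(\mathbb{R}^n)}:=\left(\sum_{Q\in\mathcal{D}(\mathbb{R}^n)}\left[\frac{\ell_Q}{|Q|^{\frac1p-\frac1q}}\left(\frac1{|Q|}\int_Q w(x)^{-p'r}\,dx\right)^{\frac1{p'r}}\left(\frac1{|Q|}\int_Q v(x)^{q\tilde r}\,dx\right)^{\frac1{q\tilde r}}\right]^\rho\right)^{\frac1\rho}<\infty,$$ with the $\ell^\rho$-sum replaced by the supremum over $Q\in\mathcal{D}(\mathbb{R}^n)$ when $\rho=\infty$. *)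

(* Defs.v *)
From HB Require Import structures.
From mathcomp Require Import all_boot all_order all_algebra.
From mathcomp Require Import all_classical all_reals all_analysis.

Set Implicit Arguments.
Unset Strict Implicit.
Unset Printing Implicit Defensive.

Import Order.TTheory GRing.Theory Num.Theory.
Import numFieldNormedType.Exports.

Local Open Scope classical_set_scope.
Local Open Scope ring_scope.

Definition rV_display : measure_display. Proof. exact: default_measure_display. Qed.

Section measurable_rV.
Context (R : realType) (n : nat).

Let coord (i : 'I_n) (x : 'rV[R]_n) : measurableTypeR R := x ord0 i.

Let rV_set0 : g_sigma_preimage coord set0.
Proof. exact: sigma_algebra0. Qed.

Let rV_setC A : g_sigma_preimage coord A -> g_sigma_preimage coord (~` A).
Proof. exact: sigma_algebraC. Qed.

Let rV_bigcup (F : (set 'rV[R]_n)^nat) :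
  (forall i, g_sigma_preimage coord (F i)) ->
  g_sigma_preimage coord (\bigcup_i (F i)).
Proof. exact: sigma_algebra_bigcup. Qed.

(* The sigma-algebra generated by the coordinates, i.e. the Borel sets. *)
HB.instance Definition _ := @isMeasurable.Build rV_display 'rV[R]_n
  (g_sigma_preimage coord) rV_set0 rV_setC rV_bigcup.

End measurable_rV.

Section measurable_rV_coord.
Context (R : realType).

Lemma measurable_coord n (i : 'I_n) :
  measurable_fun setT (fun x : 'rV[R]_n => x ord0 i : measurableTypeR R).
Proof.
move=> _ Y mY; rewrite setTI; apply: sub_sigma_algebra => /=.
rewrite -bigcup_seq/=; exists i => /=; first by rewrite mem_index_enum.
by exists Y => //; rewrite setTI.
Qed.

Lemma measurable_rVP d (T : measurableType d) n (f : T -> 'rV[R]_n) :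
  (forall i, measurable_fun setT (fun x => f x ord0 i : measurableTypeR R)) ->
  measurable_fun setT f.
Proof.
move=> mf _ A mA; rewrite setTI.
suff : measurable `<=` image_set_system setT f measurable.
  by move=> /(_ _ mA); rewrite /image_set_system/= setTI.
apply: smallest_sub; first exact/sigma_algebra_image/sigma_algebra_measurable.
rewrite -bigcup_seq => B [i _ [C mC <-]].
by rewrite /image_set_system/= !setTI; have := mf i measurableT C mC; rewrite setTI.
Qed.

Definition consrV n (z : R * 'rV[R]_n) : 'rV[R]_n.+1 :=
  row_mx (\row_(_ < 1) z.1) z.2.

Lemma consrV0 n (z : R * 'rV[R]_n) : consrV z ord0 ord0 = z.1.
Proof.
rewrite /consrV.
have -> : (ord0 : 'I_n.+1) = lshift n (ord0 : 'I_1) by exact/val_inj.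
by rewrite (@row_mxEl _ 1 1 n) mxE.
Qed.

Lemma consrV_lift n (z : R * 'rV[R]_n) i :
  consrV z ord0 (lift ord0 i) = z.2 ord0 i.
Proof.
rewrite /consrV.
have -> : lift ord0 i = rshift 1 i by exact/val_inj.
by rewrite (@row_mxEr _ 1 1 n).
Qed.

Lemma measurable_consrV n :
  measurable_fun setT (@consrV n : measurableTypeR R * 'rV[R]_n -> 'rV[R]_n.+1).
Proof.
apply: measurable_rVP => i; have [j ->|->] := unliftP ord0 i.
  rewrite (_ : (fun x => _) = (fun x : 'rV[R]_n => x ord0 j : measurableTypeR R) \o snd).
    by apply: measurableT_comp => //; exact: measurable_coord.
  by apply/funext => x /=; rewrite consrV_lift.
rewrite (_ : (fun x => _) = fst) //.
by apply/funext => x /=; rewrite consrV0.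
Qed.

End measurable_rV_coord.

Lemma prod_sigma_finite d1 d2 (T1 : measurableType d1) (T2 : measurableType d2)
    (R : realType) (m1 : {sigma_finite_measure set T1 -> \bar R})
    (m2 : {sigma_finite_measure set T2 -> \bar R}) :
  sigma_finite setT (m1 \x m2)%E.
Proof.
have /sigma_finiteP[F [TF ndF Foo]] := sigma_finiteT m1.
have /sigma_finiteP[G [TG ndG Goo]] := sigma_finiteT m2.
exists (fun n => F n `*` G n).
  rewrite -setXTT TF TG predeqE => -[x y]; split.
    move=> [/= [n _ Fnx] [k _ Gky]]; exists (maxn n k) => //; split.
    - by move: x Fnx; exact/subsetPset/ndF/leq_maxl.
    - by move: y Gky; exact/subsetPset/ndG/leq_maxr.
  by move=> [n _ []/= ? ?]; split; exists n.
move=> k; have [? ?] := Foo k; have [? ?] := Goo k.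
split; first exact: measurableX.
by rewrite product_measure1E// lte_mul_pinfty// ge0_fin_numE.
Qed.

Section lebesgue_rV_step.
Context (R : realType) (n : nat) (mu : {sigma_finite_measure set 'rV[R]_n -> \bar R}).
Local Open Scope ereal_scope.

Definition lebesgue_rVS : set 'rV[R]_n.+1 -> \bar R :=
  pushforward (@lebesgue_measure R \x mu) (@consrV R n).

Let pf : {measure set 'rV[R]_n.+1 -> \bar R} :=
  measure_function_pushforward__canonical__measure_function_Measure
    (@lebesgue_measure R \x mu) (@measurable_consrV R n).

HB.instance Definition _ := isMeasure.Build _ _ _ lebesgue_rVS
  (measure0 pf) (measure_ge0 pf) (@measure_semi_sigma_additive _ _ _ pf).

Let lebesgue_rVS_sigma_finite : sigma_finite setT lebesgue_rVS.
Proof.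
have mpair : measurable_fun setT
    (fun x : 'rV[R]_n.+1 => (x ord0 ord0 : measurableTypeR R, \row_i x ord0 (lift ord0 i))).
  apply: measurable_fun_pair; first exact: measurable_coord.
  apply: measurable_rVP => i.
  rewrite (_ : (fun x => _) = fun x : 'rV[R]_n.+1 => x ord0 (lift ord0 i)).
    exact: measurable_coord.
  by apply/funext => x; rewrite mxE.
have [F TF Foo] := prod_sigma_finite (@lebesgue_measure R) mu.
pose g (x : 'rV[R]_n.+1) := (x ord0 ord0, \row_i x ord0 (lift ord0 i)).
have gK : cancel (@consrV R n) g.
  case=> a v; rewrite /g consrV0; congr pair.
  by apply/rowP => i; rewrite mxE consrV_lift.
exists (fun k => g @^-1` F k).
  by rewrite -preimage_bigcup -TF preimage_setT.
move=> k; have [mF Fk] := Foo k; split.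
  by have := mpair measurableT _ mF; rewrite setTI.
rewrite /lebesgue_rVS /pushforward -comp_preimage.
by rewrite (_ : g \o _ = id)//; apply/funext => z; exact: gK.
Qed.

HB.instance Definition _ := Measure_isSigmaFinite.Build _ _ _ lebesgue_rVS
  lebesgue_rVS_sigma_finite.

End lebesgue_rV_step.

Fixpoint lebesgue_rV (R : realType) (n : nat) :
    {sigma_finite_measure set 'rV[R]_n -> \bar R} :=
  match n with
  | 0 => [the {sigma_finite_measure set 'rV[R]_0 -> \bar R} of
            dirac (0 : 'rV[R]_0)]
  | m.+1 => [the {sigma_finite_measure set 'rV[R]_m.+1 -> \bar R} of
            lebesgue_rVS (lebesgue_rV R m)]
  end.

Section lebesgue_rV_box.
Context (R : realType).
Local Open Scope ereal_scope.

Definition box n (a b : 'rV[R]_n) : set 'rV[R]_n :=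
  [set x | forall i, (a ord0 i <= x ord0 i < b ord0 i)%R].

Lemma measurable_box n (a b : 'rV[R]_n) : measurable (box a b).
Proof.
rewrite (_ : box a b = \big[setI/setT]_(i < n)
    ((fun x : 'rV[R]_n => x ord0 i : measurableTypeR R) @^-1`
       `[a ord0 i, b ord0 i[%classic)).
  apply: bigsetI_measurable => i _; rewrite -[X in measurable X]setTI.
  exact: measurable_coord.
rewrite -bigcap_seq; apply/seteqP; split=> x /= bx.
  by move=> i _ /=; rewrite in_itv/=; exact: bx.
by move=> i; have := bx i (mem_index_enum _); rewrite /= in_itv.
Qed.

Lemma lebesgue_rV_box n (a b : 'rV[R]_n) :
  (forall i, a ord0 i <= b ord0 i)%R ->
  lebesgue_rV R n (box a b) = (\prod_(i < n) (b ord0 i - a ord0 i))%:E.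
Proof.
elim: n => [|n IHn] in a b *.
  move=> _; rewrite big_ord0 /= diracE.
  by rewrite mem_set// => -[].
move=> ab; rewrite /= /lebesgue_rVS /pushforward big_ord_recl.
pose tl (x : 'rV[R]_n.+1) : 'rV[R]_n := \row_i x ord0 (lift ord0 i).
have -> : @consrV R n @^-1` box a b =
    `[a ord0 ord0, b ord0 ord0[%classic `*` box (tl a) (tl b).
  apply/seteqP; split=> -[y z] /=.
    move=> xab; split; first by have := xab ord0; rewrite consrV0 /= in_itv.
    by move=> i; have := xab (lift ord0 i); rewrite consrV_lift !mxE.
  rewrite in_itv/= => -[y0 zi] i; have [j ->|->] := unliftP ord0 i.
    by rewrite consrV_lift; have := zi j; rewrite !mxE.
  by rewrite consrV0.
rewrite product_measure1E//; last exact: measurable_box.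
rewrite EFinM; congr *%E.
  rewrite [LHS](lebesgue_measure_itv `[a ord0 ord0, b ord0 ord0[)/= lte_fin.
  case: ltP => [_|h]; first by rewrite EFinB.
  by apply/esym/eqP; rewrite eqe subr_eq0 eq_le h ab.
rewrite IHn; last by move=> i; rewrite !mxE.
by congr EFin; apply: eq_bigr => i _; rewrite !mxE.
Qed.

End lebesgue_rV_box.

Section dyadic.
Context (R : realType).

Definition dyadic_side (j : int) : R := 2 ^ (- j).

Definition dyadic_cube n (j : int) (m : 'rV[int]_n) : set 'rV[R]_n :=
  box (\row_i (dyadic_side j * (m ord0 i)%:~R))
      (\row_i (dyadic_side j * ((m ord0 i)%:~R + 1))).

(* Hence a sum over the pairs (j, m) is a sum over the dyadic cubes. *)
Lemma dyadic_cube_inj n : (0 < n)%N ->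
  injective (fun jm : int * 'rV[int]_n => dyadic_cube jm.1 jm.2).
Proof.
case: n => // n _ [j m] [k l] /= E.
have side0 i : 0 < dyadic_side i by rewrite /dyadic_side exprz_gt0.
have corner (j' k' : int) (m' l' : 'rV[int]_n.+1) i :
    dyadic_cube j' m' = dyadic_cube k' l' ->
    dyadic_side k' * (l' ord0 i)%:~R <= dyadic_side j' * (m' ord0 i)%:~R.
  move=> E'.
  have : dyadic_cube j' m' (\row_i (dyadic_side j' * (m' ord0 i)%:~R)).
    by move=> i0; rewrite !mxE lexx/= ltr_pM2l// ltrDl.
  by rewrite E' => /(_ i); rewrite !mxE => /andP[].
have cE i : dyadic_side j * (m ord0 i)%:~R = dyadic_side k * (l ord0 i)%:~R.
  by apply/eqP; rewrite eq_le !corner.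
have side (j' k' : int) (m' l' : 'rV[int]_n.+1) :
    (forall i, dyadic_side j' * (m' ord0 i)%:~R = dyadic_side k' * (l' ord0 i)%:~R) ->
    dyadic_cube j' m' = dyadic_cube k' l' -> dyadic_side k' <= dyadic_side j'.
  move=> cE' E'; rewrite leNgt; apply/negP => jk.
  have : dyadic_cube k' l' (\row_i (dyadic_side k' * (l' ord0 i)%:~R + dyadic_side j')).
    move=> i; rewrite !mxE lerDl ltW ?side0//= mulrDr mulr1.
    by rewrite ltrD2l.
  by rewrite -E' => /(_ ord0); rewrite !mxE -cE' mulrDr mulr1 ltxx andbF.
have sE : dyadic_side j = dyadic_side k.
  by apply/eqP; rewrite eq_le (side j k m l)// (side k j l m).
have jk : j = k.
  apply/oppr_inj/eqP; move: sE; rewrite /dyadic_side => /eqP.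
  by rewrite !eq_le !ler_eXz2l ?ltr1n.
rewrite -jk; congr pair; apply/rowP => i.
move: (cE i); rewrite -sE => /mulfI; rewrite gt_eqF// => /(_ isT)/eqP.
by rewrite eqr_int => /eqP; rewrite (ord1 _).
Qed.

End dyadic.

Section two_weight.
Context (R : realType) (n : nat).
Local Notation mu := (lebesgue_rV R n).
Local Open Scope ereal_scope.

(* Almost everywhere equality with a Borel function is measurability with
   respect to the completed (Lebesgue) sigma-algebra; the integral below is a
   supremum over Borel simple functions, which takes the same value on a
   nonnegative function of this kind as on its Borel representative. *)
Definition lebesgue_measurable (w : 'rV[R]_n -> R) : Prop :=
  exists2 g : 'rV[R]_n -> R, measurable_fun setT g &
    {ae mu, forall x, w x = g x}.

Definition weight (w : 'rV[R]_n -> R) : Prop :=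
  [/\ lebesgue_measurable w,
      forall K, compact K -> \int[mu]_(x in K) `|w x|%:E < +oo,
      {ae mu, forall x, (0 < w x)%R} &
      {ae mu, forall x, (0 < (w x)^-1)%R}].

Definition average (Q : set 'rV[R]_n) (h : 'rV[R]_n -> R) : \bar R :=
  (fine (mu Q))^-1%:E * \int[mu]_(x in Q) (h x)%:E.

Definition A_term (p q r rt : R) (w v : 'rV[R]_n -> R)
    (jm : int * 'rV[int]_n) : \bar R :=
  let Q := dyadic_cube (R:=R) jm.1 jm.2 in
  let p' := (p / (p - 1))%R in
  (dyadic_side R jm.1 / fine (mu Q) `^ (p^-1 - q^-1))%R%:E
  * (average Q (fun x => w x `^ (- (p' * r)))%R) `^ (p' * r)^-1
  * (average Q (fun x => v x `^ (q * rt))%R) `^ (q * rt)^-1.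

(* Only 0 < rho <= +oo is meaningful. *)
Definition A_const (p q r rt : R) (rho : \bar R) (w v : 'rV[R]_n -> R) : \bar R :=
  if rho is s%:E then
    (\esum_(jm in [set: int * 'rV[int]_n]) A_term p q r rt w v jm `^ s) `^ s^-1
  else ereal_sup (range (A_term p q r rt w v)).

Definition A_class (p q r rt : R) (rho : \bar R) (w v : 'rV[R]_n -> R) : Prop :=
  [/\ weight w, weight v & A_const p q r rt rho w v < +oo].

(* The library norm on 'rV[R]_n is the maximum norm, which gives the same
   Lipschitz functions as the Euclidean one. *)
Definition Lip_c (f : 'rV[R]_n -> R) : Prop :=
  lipschitz f /\ compact (closure [set x | f x != 0%R]).

(* The partial derivatives of a Lipschitz function exist almost everywhere;
   elsewhere 'D takes a default value. *)
Definition gradient (f : 'rV[R]_n -> R) (x : 'rV[R]_n) : 'rV[R]_n :=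
  \row_i 'D_(delta_mx ord0 i) f x.

Definition euclidean_norm (u : 'rV[R]_n) : R :=
  Num.sqrt (\sum_(i < n) u ord0 i ^+ 2).

End two_weight.

(* Main.v *)
Require Import Defs.
From HB Require Import structures.
From mathcomp Require Import all_boot all_order all_algebra.
From mathcomp Require Import all_classical all_reals all_analysis.
From mathcomp Require Import measurable_realfun ring lra zify.

Set Implicit Arguments.
Unset Strict Implicit.
Unset Printing Implicit Defensive.

Import Order.TTheory GRing.Theory Num.Theory.
Import numFieldNormedType.Exports.

Local Open Scope classical_set_scope.
Local Open Scope ring_scope.

(** Let [Q0] be a dyadic cube on one child of which [f] vanishes, and write [<h>_Q]
for the average of [h] over [Q].  Along the dyadic subcubes of [Q0] that shrink to
a point [x], the averages of [f] telescope to [f x], and one step from a cube to a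
child changes the average by at most a constant times [l_Q <G>_Q], where [G] bounds
the partial derivatives ([child_average]).  Since [f] vanishes on a child of [Q0],
the first average is of the same size.  For [0 < b <= 1] the triangle inequality for
[t ^ b] therefore bounds the integral of [|f| ^ b] against a density [rho] by the sum
over all subcubes [Q] of [(l_Q <G>_Q) ^ b] times the [rho]-mass of [Q]
([chain_estimate]); what is left at depth [N] is an oscillation of a Lipschitz
function and decays geometrically.

This sum is dominated by its part over the stopping cubes, those whose average of
[G] has doubled since the previous stopping cube: in between the averages are
comparable while the side lengths halve, so that the terms form a geometric series
([sparse_domination]).  The stopping cubes satisfy a packing condition
([carleson_stop]), hence a Carleson embedding: the sum of [|Q| <h ^ s>_Q ^ (e / s)]
over them is at most a constant times the integral of [h ^ e] whenever [s < e]
([carleson_embedding], [stop_mass_embedding]).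

The exponents [r] and [rt] create the room [s < e].  Hoelder's inequality gives
[<G>_Q <= <(w G) ^ sg>_Q ^ (1 / sg) <w ^ (- p' r)>_Q ^ (1 / (p' r))] where [sg] is
conjugate to [p' r], so that [sg < p].  If [q <= 1], taking [b = q] and
[rho = v ^ q] bounds each term by the [q]-th power of a term of the class constant
times a power of a summand of the embedding for [w G].  If [1 < q], taking [b = 1]
and [rho = v (v |f|) ^ (q - 1)] makes the left side equal to the integral [K] of
[(v |f|) ^ q]; Hoelder's inequality with the exponent [q rt] on [v] leaves a second
embedding, for [(v |f|) ^ (q - 1)] in [L ^ q'].  Hoelder's inequality for sums, with
a supremum of the coefficients when [p <= q] (then [1 / p + 1 / q' >= 1]) and the
exponent that makes up the missing [1 / q - 1 / p] otherwise, bounds [K] by a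
multiple of [K ^ (1 / q')], and [K] is finite, so it can be absorbed
([local_bound_le1], [local_bound_gt1]).

For a compactly supported [f] it remains to cover the support by one such cube in
each orthant, twice as large as the support requires ([global_bound]).  The weights
are replaced by positive Borel representatives, and the gradient by the vector whose
components are set to zero where the corresponding partial derivative does not
exist; this vector is Borel and nowhere longer than the gradient. *)

(** * Integrals, powers and almost everywhere relations *)

Import HBNNSimple.

(** The integral is a supremum over simple functions: one below [f1], set to zero on
the exceptional null set, is below [f2] and has the same integral.  The functions
need not be Borel, since a weight is only almost everywhere equal to a Borel
function. *)
Lemma ae_le_ge0_integral d (T : measurableType d) (R : realType)
    (mu : {measure set T -> \bar R}) (D : set T) (f1 f2 : T -> \bar R) :
  (forall x, D x -> (0 <= f1 x)%E) -> (forall x, D x -> (0 <= f2 x)%E) ->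
  {ae mu, forall x, D x -> (f1 x <= f2 x)%E} ->
  (\int[mu]_(x in D) f1 x <= \int[mu]_(x in D) f2 x)%E.
Proof.
move=> f10 f20 [N [mN N0 sN]].
rewrite (ge0_integralE _ f10) (ge0_integralE _ f20).
apply: ge_ereal_sup => _ [h /= hf1 <-].
apply: ereal_sup_ubound.
exists (mul_nnsfun h (indic_nnsfun R (measurableC mN))) => /=.
  move=> x; rewrite /= /mindic indicE; have [xN|xN] := boolP (x \in ~` N); last first.
    rewrite mulr0; apply: erestrict_ge0 => // y; exact: f20.
  rewrite mulr1 (le_trans (hf1 x))// /patch; case: ifPn => // xD.
  apply: contrapT => H; move: xN; rewrite inE; apply; apply: sN => /=.
  by move=> K; apply: H; apply: K; rewrite inE in xD.
have S (k : {nnsfun T >-> R}) : sintegral mu k = (\int[mu]_x (k x)%:E)%E.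
  by rewrite integral_nnsfun// patch_setT.
have mk (k : {nnsfun T >-> R}) : measurable_fun setT (fun x => (k x)%:E).
  by apply/measurable_EFinP.
have k0 (k : {nnsfun T >-> R}) x : setT x -> (0 <= (k x)%:E)%E.
  by move=> _; rewrite lee_fin.
rewrite !S (ge0_negligible_integral mN measurableT (mk _) (k0 _) N0).
rewrite [RHS](ge0_negligible_integral mN measurableT (mk _) (k0 _) N0).
apply: eq_integral => x; rewrite inE => -[_ xN] /=.
by rewrite /mindic indicE mem_set// mulr1.
Qed.

Lemma ae_imply d (T : measurableType d) (R : realType)
    (mu : {measure set T -> \bar R}) (P Q : T -> Prop) :
  {ae mu, forall x, P x} -> (forall x, P x -> Q x) -> {ae mu, forall x, Q x}.
Proof. by move=> [N [mN N0 sN]] PQ; exists N; split => // x nQ; apply: sN => /PQ. Qed.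

Lemma ae_eq_ge0_integral d (T : measurableType d) (R : realType)
    (mu : {measure set T -> \bar R}) (D : set T) (f1 f2 : T -> \bar R) :
  (forall x, D x -> (0 <= f1 x)%E) -> (forall x, D x -> (0 <= f2 x)%E) ->
  {ae mu, forall x, f1 x = f2 x} ->
  (\int[mu]_(x in D) f1 x = \int[mu]_(x in D) f2 x)%E.
Proof.
move=> f10 f20 f12; apply/eqP; rewrite eq_le; apply/andP; split;
  apply: ae_le_ge0_integral => //; apply: (ae_imply f12) => x -> //.
Qed.

Lemma measurable_power d (T : measurableType d) (R : realType) (u : T -> R) (th : R) :
  measurable_fun setT u -> measurable_fun setT (fun x => u x `^ th).
Proof. by move=> mu; apply: (@measurableT_comp _ _ _ _ _ _ (@powR R ^~ th)). Qed.

Lemma powR_le2r (R : realType) (a x y : R) : 0 <= a -> 0 <= x -> x <= y ->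
  x `^ a <= y `^ a.
Proof.
by move=> a0 x0 xy; apply: ge0_ler_powR => //; rewrite nnegrE// (le_trans x0).
Qed.

Lemma le_poweR2r (R : realType) (x y : \bar R) (th : R) :
  0 <= th -> (0 <= x)%E -> (x <= y)%E -> (x `^ th <= y `^ th)%E.
Proof.
move=> th0 x0 xy; apply: gt0_ler_poweR => //; rewrite in_itv/= leey andbT//.
exact: le_trans xy.
Qed.

Lemma powR2_gt1 (R : realType) (b : R) : 0 < b -> 1 < 2 `^ b :> R.
Proof.
move=> b0; have : 1 `^ b < 2 `^ b :> R by apply: gt0_ltr_powR; rewrite ?nnegrE ?ltr1n.
by rewrite powR1.
Qed.

Lemma stieltjes_itv (R : realType) (g : cumulative R R) (a b : R) : a <= b ->
  lebesgue_stieltjes_measure g `]a, b]%classic = (g b - g a)%:E.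
Proof.
move=> ab; rewrite /lebesgue_stieltjes_measure /measure_extension.
by rewrite measurable_mu_extE/= ?wlength_itv_bnd//; exact: is_ocitv.
Qed.

(** Both [g] and [t - g t] are nondecreasing and continuous, and their Stieltjes
measures add up to the Lebesgue measure by uniqueness.  The Stieltjes measure of [g]
is thus below the Lebesgue measure, and the density is its Radon-Nikodym
derivative. *)
Lemma cumulative_le1_density (R : realType) (g : R -> R) (a b : R) : a < b ->
  (forall s t, s <= t -> 0 <= g t - g s <= t - s) ->
  exists h : R -> R, lebesgue_measure.-integrable setT (EFin \o h) /\
   forall x, a <= x <= b ->
    (g x - g a)%:E = (\int[lebesgue_measure]_(t in `]a, x]) (h t)%:E)%E.
Proof.
move=> ab glip.
have gnd : nondecreasing g.
  by move=> s t st; rewrite -subr_ge0; have /andP[] := glip _ _ st.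
have gdist s t : `|g s - g t| <= `|s - t|.
  wlog st : s t / s <= t.
    move=> H; have [/H//|/ltW/H] := leP s t.
    by rewrite distrC [leRHS]distrC.
  have /andP[? ?] := glip _ _ st.
  by rewrite distrC [leRHS]distrC !ger0_norm// subr_ge0.
have cont_lip1 (u : R -> R) : (forall s t, `|u s - u t| <= `|s - t|) ->
    continuous u.
  move=> ulip x; apply/cvgrPdist_lt => e e0; near=> t.
  apply: le_lt_trans (ulip _ _) _.
  near: t.
  by apply: (@cvgr_dist_lt _ _ _ (nbhs x) _ id x) => //; exact: cvg_id.
pose k t := t - g t.
have knd : nondecreasing k.
  move=> s t st; rewrite /k -subr_ge0.
  have /andP[_ ?] := glip _ _ st; lra.
have kdist s t : `|k s - k t| <= `|s - t|.
  wlog st : s t / s <= t.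
    move=> H; have [/H//|/ltW/H] := leP s t.
    by rewrite distrC [leRHS]distrC.
  have /andP[? ?] := glip _ _ st; have := knd _ _ st => ?.
  rewrite distrC [leRHS]distrC !ger0_norm ?subr_ge0// /k; lra.
pose hG := isCumulative.Build R _ R g gnd (right_continuousW (cont_lip1 _ gdist)).
pose G : cumulative R R := HB.pack g hG.
pose hK := isCumulative.Build R _ R k knd (right_continuousW (cont_lip1 _ kdist)).
pose K : cumulative R R := HB.pack k hK.
pose nu := lebesgue_stieltjes_measure G.
pose sig := measure_add (lebesgue_stieltjes_measure G) (lebesgue_stieltjes_measure K).
have sigX A : sig A = (lebesgue_stieltjes_measure G A +
    lebesgue_stieltjes_measure K A)%E := measure_addE _ _ _.
have sigE A : measurable A -> lebesgue_measure A = sig A.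
  apply: lebesgue_measure_unique => X /ocitvP[->|[[c d]] /= cd ->].
    by rewrite !measure0.
  rewrite [LHS](stieltjes_itv _ (ltW cd)) -[RHS]/(sig _) sigX.
  rewrite !(stieltjes_itv _ (ltW cd))/= -EFinD /k; congr EFin; ring.
have nu_le A : measurable A -> (nu A <= lebesgue_measure A)%E.
  by move=> mA; rewrite sigE// sigX leeDl.
pose D : set (measurableTypeR R) := `]a, b]%classic.
have mD : measurable D := measurable_itv `]a, b].
have Doo : (nu D < +oo)%E.
  by rewrite /nu /D stieltjes_itv ?(ltW ab)// ltry.
pose nuD : {finite_measure set (measurableTypeR R) -> \bar R} := mfrestr mD Doo.
have nuDE A : nuD A = nu (A `&` D) by [].
have dom : nuD `<< (@lebesgue_measure R).
  apply/null_content_dominatesP => A mA A0; rewrite nuDE.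
  apply/eqP; rewrite eq_le measure_ge0 andbT.
  rewrite (le_trans (nu_le _ _))//; first exact: measurableI.
  by rewrite -A0; apply: le_measure; rewrite ?inE//; exact: measurableI.
have [h [h0 hfin hint hE]] := radon_nikodym_sigma_finite dom.
exists (fine \o h).
have hh : EFin \o (fine \o h) = h.
  by apply/funext => x /=; rewrite fineK.
rewrite hh; split => // x /andP[ax xb].
under eq_integral do rewrite -[(_)%:E]/((EFin \o (fine \o h)) _) hh.
rewrite -hE// nuDE /nu -(stieltjes_itv G ax); congr (_ _).
apply/seteqP; split => t /=; rewrite /D /= !in_itv/=.
  by move=> /andP[-> tx]; rewrite tx (le_trans tx xb).
by move=> [/andP[-> ->]].
Unshelve. all: by end_near. Qed.

(** The function [(phi t / L + t) / 2] is nondecreasing with slope at most [1]. *)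
Lemma lipschitz_density (R : realType) (phi : R -> R) (L a b : R) :
  0 < L -> a < b -> (forall s t, `|phi s - phi t| <= L * `|s - t|) ->
  exists h : R -> R, lebesgue_measure.-integrable setT (EFin \o h) /\
   forall x, a <= x <= b ->
    phi x - phi a = \int[lebesgue_measure]_(t in `]a, x]) h t.
Proof.
move=> L0 ab philip.
pose g t := (phi t / L + t) / 2.
have glip s t : s <= t -> 0 <= g t - g s <= t - s.
  move=> st; have := philip t s; rewrite (ger0_norm (_ : 0 <= t - s)) ?subr_ge0//.
  rewrite ler_norml => /andP[h1 h2].
  have e : g t - g s = ((phi t - phi s) / L + (t - s)) / 2.
    by rewrite /g; field; rewrite gt_eqF.
  have h3 : (phi t - phi s) / L <= t - s by rewrite ler_pdivrMr// mulrC.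
  have h4 : - (t - s) <= (phi t - phi s) / L.
    by rewrite ler_pdivlMr// mulNr mulrC.
  by rewrite e; apply/andP; split; lra.
have [h [hint hE]] := cumulative_le1_density ab glip.
pose D : set (measurableTypeR R) := `]a, b]%classic.
have mD : measurable D := measurable_itv `]a, b].
have Dint : lebesgue_measure.-integrable setT (EFin \o (\1_D : R -> R)).
  exact: integrable_indic_itv.
pose h' t := L * (2 * h t - \1_D t).
have h'E : EFin \o h' = (fun t => L%:E * (2%:E * (EFin \o h) t - (EFin \o \1_D) t))%E.
  by apply/funext => t.
exists h'; split.
  rewrite h'E; apply: integrableZl => //; apply: integrableB => //.
  exact: integrableZl.
move=> x axb; have /andP[ax xb] := axb.
pose E : set (measurableTypeR R) := `]a, x]%classic.
have mE : measurable E := measurable_itv `]a, x].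
have hintE : lebesgue_measure.-integrable E (EFin \o h).
  exact: integrableS hint.
have DintE : lebesgue_measure.-integrable E (EFin \o (\1_D : R -> R)).
  exact: integrableS Dint.
rewrite /h' RintegralZl//; last first.
  rewrite (_ : _ \o _ = (fun t => (2%:E * (EFin \o h) t - (EFin \o \1_D) t)))%E//.
  by apply: integrableB => //; exact: integrableZl.
rewrite RintegralB//; last first.
  by rewrite (_ : _ \o _ = (fun t => (2%:E * (EFin \o h) t)))%E//; exact: integrableZl.
rewrite RintegralZl//.
have -> : \int[lebesgue_measure]_(t in E) h t = g x - g a.
  by rewrite /Rintegral -hE.
have -> : \int[lebesgue_measure]_(t in E) \1_D t = x - a.
  rewrite /Rintegral.
  rewrite integral_indic// (_ : D `&` E = E); last first.
    apply/setIidPr => t; rewrite /E /D /= !in_itv/= => /andP[-> tx] /=.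
    exact: le_trans tx xb.
  have muE : lebesgue_measure E = (x - a)%:E.
    rewrite [LHS](lebesgue_measure_itv `]a, x])/= lte_fin.
    by move: ax; rewrite le_eqVlt => /predU1P[->|->//]; rewrite ltxx subrr.
  exact: (congr1 fine muE).
by rewrite /g; field; rewrite gt_eqF.
Qed.

(** By the Lebesgue differentiation theorem the primitive of the density of [phi]
has the density as its derivative almost everywhere. *)
Lemma lipschitz_ae_derivable (R : realType) (phi : R -> R) (L a b : R)
    (mu := @lebesgue_measure R) :
  0 < L -> a < b -> (forall s t, `|phi s - phi t| <= L * `|s - t|) ->
  {ae mu, forall x, x \in `]a, b[ -> derivable phi x 1} /\
  (`|phi b - phi a|%:E <= \int[mu]_(t in `]a, b]) `|'D_1 phi t|%:E)%E.
Proof.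
move=> L0 ab philip.
have [h [hint hE]] := lipschitz_density L0 ab philip.
have mh : measurable_fun setT h.
  by move/integrableP : hint => [/measurable_EFinP].
have hS (E : set (measurableTypeR R)) : measurable E -> mu.-integrable E (EFin \o h).
  by move=> mE; exact: integrableS hint.
have loc : locally_integrable setT h.
  split => //; first exact: openT.
  move=> K _ cK; have mK : measurable (K : set (measurableTypeR R)).
    exact: (@closed_measurable R _ (compact_closed (@Rhausdorff R) cK)).
  by have /integrableP[_] := hS _ mK.
have := @FTC1 R h (BRight a) (fun y => hS _ (measurable_itv _)) loc.
set F := fun x => _ => aeF.
have aeD : {ae mu, forall x, x \in `]a, b[ -> derivable phi x 1 /\ 'D_1 phi x = h x}.
  move: aeF; apply: filterS; first exact: (ae_filter_ringOfSetsType mu).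
  move=> x Fx xab.
  have nr : \forall y \near x, F y + phi a = phi y.
    have : \forall y \near x, y \in `]a, b[ by exact: near_in_itvoo.
    apply: filterS => y; rewrite in_itv/= => /andP[ay yb].
    by rewrite /F -hE ?(ltW ay) ?(ltW yb)// subrK.
  move: (xab); rewrite in_itv/= => /andP[ax xb].
  have [//|dF FE] := Fx.
  have dF' : is_derive x 1 (F \+ cst (phi a)) (h x).
    rewrite -[h x]addr0 -FE derive1E.
    by apply: is_deriveD; exact: derivableP.
  have dphi := near_eq_is_derive nr dF'.
  by split; [exact: ex_derive|exact: derive_val].
split.
  move: aeD; apply: filterS; first exact: (ae_filter_ringOfSetsType mu).
  by move=> x H /H[].
have mI : measurable (`]a, b]%classic : set (measurableTypeR R)) := measurable_itv `]a, b].
rewrite hE ?lexx ?(ltW ab)//.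
rewrite (le_trans (y := \int[mu]_(t in `]a, b]) `|h t|%:E))%E//.
  rewrite EFin_normr_Rintegral//; last exact: hS.
  apply: le_abse_integral => //.
  by apply/measurable_EFinP; exact: measurable_funTS.
apply: ae_le_ge0_integral => //.
have : {ae mu, forall x, x != b}.
  exists [set b]; split => //; first exact: lebesgue_measure_set1.
  by move=> x /= /negP; rewrite negbK => /eqP.
move: aeD; apply: filterS2; first exact: (ae_filter_ringOfSetsType mu).
move=> x H xb; rewrite /= in_itv/= => /andP[ax bx].
by rewrite (H _).2 // in_itv/= ax lt_neqAle xb.
Qed.

(** * Integration along coordinate lines *)

Section lines.
Context (R : realType).
Local Open Scope ereal_scope.

Lemma integral_consrV n (u : 'rV[R]_n.+1 -> \bar R) :
  measurable_fun setT u -> (forall x, 0 <= u x) ->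
  \int[lebesgue_rV R n.+1]_x u x =
  \int[@lebesgue_measure R \x lebesgue_rV R n]_z u (consrV z).
Proof.
move=> mu u0.
have H := @ge0_integral_pushforward _ _ (measurableTypeR R * 'rV[R]_n)%type _ R (@consrV R n)
  (@measurable_consrV R n) (@lebesgue_measure R \x lebesgue_rV R n) setT u
  measurableT mu (fun y _ => u0 y).
by rewrite preimage_setT in H; rewrite -H.
Qed.

Lemma measurable_consrVT n (u : 'rV[R]_n.+1 -> \bar R) : measurable_fun setT u ->
  measurable_fun setT (fun z : measurableTypeR R * 'rV[R]_n => u (consrV z)).
Proof.
by move=> mu; apply: measurableT_comp => //; exact: measurable_consrV.
Qed.

(** The point [subst_coord i x t] runs through the line of direction [i] through
[x] as [t] varies. *)
Definition subst_coord n (i : 'I_n) (x : 'rV[R]_n) (t : R) : 'rV[R]_n :=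
  \row_j (if j == i then t else x ord0 j).

Lemma subst_coord0 n (s t : R) (z : 'rV[R]_n) :
  subst_coord ord0 (consrV (s, z)) t = consrV (t, z).
Proof.
apply/rowP => j; rewrite mxE; have [k ->|->] := unliftP ord0 j.
  by rewrite !consrV_lift.
by rewrite eqxx consrV0.
Qed.

Lemma subst_coord_lift n (i : 'I_n) (s t : R) (z : 'rV[R]_n) :
  subst_coord (lift ord0 i) (consrV (s, z)) t = consrV (s, subst_coord i z t).
Proof.
apply/rowP => j; rewrite mxE; have [k ->|->] := unliftP ord0 j.
  by rewrite !consrV_lift /= (inj_eq lift_inj) mxE.
by rewrite !consrV0.
Qed.

(** Tonelli's theorem for an arbitrary coordinate: the measure splits off only the
coordinate [0], and induction on the dimension moves the split to [i]. *)
Lemma integral_le_lines n (i : 'I_n) (u k : 'rV[R]_n -> \bar R) :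
  measurable_fun setT u -> measurable_fun setT k ->
  (forall x, 0 <= u x) -> (forall x, 0 <= k x) ->
  (forall x, \int[lebesgue_measure]_t u (subst_coord i x t)
             <= \int[lebesgue_measure]_t k (subst_coord i x t)) ->
  \int[lebesgue_rV R n]_x u x <= \int[lebesgue_rV R n]_x k x.
Proof.
elim: n => [[]//|n IHn] in i u k *.
move=> mu mk u0 k0 H.
have mcu := measurable_consrVT mu; have mck := measurable_consrVT mk.
rewrite !integral_consrV//; have [j ij|i0] := unliftP ord0 i.
  rewrite !fubini_tonelli1//=; apply: ge0_le_integral => //.
  - by move=> x _; exact: integral_ge0.
  - exact: measurable_fun_fubini_tonelli_F.
  - exact: measurable_fun_fubini_tonelli_F.
  move=> t _; apply: (IHn j) => //.
  - exact: measurableT_comp mcu (measurable_pair1 _).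
  - exact: measurableT_comp mck (measurable_pair1 _).
  move=> z; have := H (consrV (t, z)); rewrite ij.
  by under eq_integral do rewrite subst_coord_lift;
     under [leRHS]eq_integral do rewrite subst_coord_lift.
rewrite !fubini_tonelli2//=; apply: ge0_le_integral => //.
- by move=> x _; exact: integral_ge0.
- exact: measurable_fun_fubini_tonelli_G.
- exact: measurable_fun_fubini_tonelli_G.
move=> z _; have := H (consrV (0%R, z)).
have E (w : 'rV[R]_n.+1 -> \bar R) :
    \int[lebesgue_measure]_t w (subst_coord i (consrV (0%R, z)) t) =
    \int[lebesgue_measure]_t w (consrV (t, z)).
  by apply: eq_integral => t _; rewrite i0 subst_coord0.
by rewrite !E.
Qed.

End lines.

(** * Partial derivatives of Lipschitz functions *)

(** A Cauchy criterion that only tests rational increments.  It turns the existence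
of a derivative into a countable combination of measurable conditions. *)
Lemma cvg_dnbhs0_ratP (R : realType) (q : R -> R) :
  (forall h, h != 0 -> {for h, continuous q}) ->
  cvg (q h @[h --> 0^']) <->
  forall m : nat, exists l : nat, forall a b : rat,
    0 < `|ratr a : R| < l.+1%:R^-1 -> 0 < `|ratr b : R| < l.+1%:R^-1 ->
    `|q (ratr a) - q (ratr b)| <= m.+1%:R^-1.
Proof.
move=> cq; split.
  move=> /cvg_ex[y /cvgrPdist_lt cy] m.
  have e0 : 0 < (m.+1%:R^-1 / 2 : R) by rewrite divr_gt0.
  have [d /= d0 H] := cy _ e0.
  have [l ld] : exists l : nat, l.+1%:R^-1 < d.
    exists (Num.truncn d^-1).
    by rewrite invf_plt ?posrE// truncnS_gt.
  exists l => a b /andP[a0 al] /andP[b0 bl].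
  have Ha : `|y - q (ratr a)| < m.+1%:R^-1 / 2.
    apply: H; last by rewrite -normr_gt0.
    by rewrite /= sub0r normrN (lt_trans al).
  have Hb : `|y - q (ratr b)| < m.+1%:R^-1 / 2.
    apply: H; last by rewrite -normr_gt0.
    by rewrite /= sub0r normrN (lt_trans bl).
  rewrite (_ : _ - _ = (y - q (ratr b)) - (y - q (ratr a))); last by ring.
  apply: (le_trans (ler_normB _ _)); rewrite [leRHS]splitr.
  by apply: lerD; apply: ltW.
move=> H; apply: cauchy_cvg; apply: cauchy_exP => e e0.
have [m me] : exists m : nat, m.+1%:R^-1 < e / 2.
  exists (Num.truncn (e / 2)^-1).
  by rewrite invf_plt ?posrE ?truncnS_gt// divr_gt0.
have [l Hl] := H m.
have l0 : 0 < (l.+1%:R^-1 : R) by rewrite invr_gt0.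
have [b] := @rat_in_itvoo R _ _ l0; rewrite in_itv/= => bl.
have bl' : 0 < `|ratr b : R| < l.+1%:R^-1.
  by case/andP: bl => b0 bl; rewrite gtr0_norm// b0.
exists (q (ratr b)); rewrite /dnbhs /within /=.
exists l.+1%:R^-1 => //= h; rewrite /ball_ /= sub0r normrN => hl h0.
have h1 : \forall x \near h, `|q h - q x| < e / 2.
  by have /cvgrPdist_lt := cq h h0; apply; rewrite divr_gt0.
have nh : `|x| @[x --> h] --> `|h| by exact: cvg_norm cvg_id.
have h2 : \forall x \near h, 0 < `|x| < l.+1%:R^-1.
  near=> x; apply/andP; split; near: x.
    by apply: (cvgr_gt `|h|) => //; rewrite normr_gt0.
  exact: (cvgr_lt `|h|).
have [d /= d0 hd] : \forall x \near h, `|q h - q x| < e / 2 /\ 0 < `|x| < l.+1%:R^-1.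
  by near=> x; split; near: x.
have [a] := @rat_in_itvoo R h (h + d) (ltac:(by rewrite ltrDl)).
rewrite in_itv/= => /andP[ha1 ha2].
have [|ha al] := hd (ratr a).
  by rewrite /= distrC gtr0_norm ?subr_gt0// ltrBlDl.
rewrite /ball /=.
rewrite (_ : _ - _ = (q (ratr b) - q (ratr a)) - (q h - q (ratr a))); last by ring.
apply: (le_lt_trans (ler_normB _ _)); rewrite [ltRHS]splitr.
apply: ler_ltD => //; apply: le_trans (ltW me); exact: Hl.
Unshelve. all: by end_near. Qed.

(** The Lipschitz condition for the sum norm, which is by construction a measurable
function of the coordinates. *)
Definition lip1 (R : realType) n (L : R) (f : 'rV[R]_n -> R) :=
  forall x y, `|f x - f y| <= L * \sum_i `|x ord0 i - y ord0 i|.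

Section lip1.
Context (R : realType) (n : nat).
Implicit Types (f : 'rV[R]_n -> R) (L : R).

Lemma lipschitz_lip1 f : lipschitz f -> exists2 L, 0 < L & lip1 L f.
Proof.
move=> /pinfty_ex_gt0[L L0 fL]; exists L => // x y.
have := fL (x, y) (conj I I) => /= /le_trans; apply; rewrite ler_pM2l//.
rewrite [leLHS]mx_normrE; apply/bigmax_leP; split; first exact: sumr_ge0.
by move=> [i j] _ /=; rewrite (ord1 i) (bigD1 j)//= !mxE lerDl; exact: sumr_ge0.
Qed.

Lemma lip1_shift L f v : lip1 L f -> lip1 L (fun x => f (v + x)).
Proof.
move=> fL x y; rewrite (le_trans (fL _ _))//.
by under eq_bigr do rewrite !mxE opprD addrACA subrr add0r.
Qed.

(** The Borel sets are generated by the coordinates, so continuity has to be turned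
into measurability by hand: [f] is the infimum over the rational points [r] of the
cones [f r + L |x - r|_1], and each cone is measurable. *)
Lemma measurable_lip1 L f : 0 < L -> lip1 L f -> measurable_fun setT f.
Proof.
move=> L0 fL; apply: (measurability _ (RGenInftyO.measurableE R)) => //.
move=> _ [_ [c ->] <-]; rewrite setTI.
pose q (r : 'rV[rat]_n) : 'rV[R]_n := \row_i ratr (r ord0 i).
pose d (r : 'rV[rat]_n) (x : 'rV[R]_n) := f (q r) + L * \sum_i `|x ord0 i - q r ord0 i|.
have md r : measurable_fun setT (d r).
  apply: measurable_funD => //; apply: measurable_funM => //.
  apply: measurable_sum => i; apply: measurableT_comp => //.
  by apply: measurable_funB => //; exact: measurable_coord.
rewrite (_ : _ @^-1` _ = \bigcup_r (d r @^-1` `]-oo, c[)).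
  apply: countable_bigcupT_measurable; first exact: countableP.
  move=> r; rewrite -[X in measurable X]setTI.
  exact: md.
apply/seteqP; split=> x /=; rewrite in_itv/=; last first.
  move=> [r _] /=; rewrite in_itv/=; apply: le_lt_trans; rewrite /d.
  by rewrite -lerBlDl (le_trans _ (fL _ _))// ler_norm.
move=> fxc; pose e := (c - f x) / (2 * L * n.+1%:R).
have e0 : 0 < e by rewrite divr_gt0 ?subr_gt0// !mulr_gt0.
have /choice[r rE] : forall i, exists a : rat, x ord0 i < ratr a < x ord0 i + e.
  by move=> i; have [|a] := @rat_in_itvoo R (x ord0 i) (x ord0 i + e); rewrite ?ltrDl//; exists a.
exists (\row_i r i) => //=; rewrite in_itv/= /d.
set s := \sum_i _.
have se : s <= n%:R * e.
  rewrite mulr_natl -[n in leRHS]card_ord -sumr_const; apply: ler_sum => i _.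
  have /andP[h1 h2] := rE i.
  by rewrite !mxE distrC gtr0_norm ?subr_gt0// lerBlDl ltW.
have : f (q (\row_i r i)) - f x <= L * s.
  rewrite (le_trans (ler_norm _))// (le_trans (fL _ _))// ler_pM2l//.
  by rewrite le_eqVlt; apply/orP; left; apply/eqP/eq_bigr => i _; rewrite distrC.
have : L * s <= L * (n%:R * e) by rewrite ler_pM2l.
have : 2 * L * n.+1%:R * e = c - f x.
  by rewrite /e mulrC divfK// gt_eqF// !mulr_gt0.
rewrite -[n.+1%:R]natr1.
have : 0 < L * e by rewrite mulr_gt0.
set A := L * s; set B := f (q _).
have -> : 2 * L * (n%:R + 1) * e = 2 * (L * (n%:R * e)) + 2 * (L * e) by ring.
set D := L * (_ * _) => ? ? ? ?; lra.
Qed.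

End lip1.

Lemma countable_bigcap_measurable d (T : measurableType d) (I : countType)
    (P : set I) (F : I -> set T) :
  (forall a, P a -> measurable (F a)) -> measurable (\bigcap_(a in P) F a).
Proof.
move=> mF; rewrite -[X in measurable X]setCK setC_bigcap; apply: measurableC.
rewrite bigcup_mkcond; apply: countable_bigcupT_measurable; first exact: countableP.
by move=> a; case: ifPn => // /set_mem Pa; apply: measurableC; exact: mF.
Qed.

Section partial.
Context (R : realType) (n : nat) (f : 'rV[R]_n -> R) (L : R) (i : 'I_n).
Hypotheses (L0 : 0 < L) (fL : lip1 L f).
Let e := delta_mx ord0 i : 'rV[R]_n.

Definition quot_dir (h : R) (x : 'rV[R]_n) : R := h^-1 * (f (h *: e + x) - f x).

Definition deriv_set := [set x | derivable f x e].

Lemma measurable_quot_dir h : measurable_fun setT (quot_dir h).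
Proof.
apply: measurable_funM => //; apply: measurable_funB; last exact: (measurable_lip1 L0 fL).
exact: (measurable_lip1 L0 (lip1_shift _ fL)).
Qed.

Lemma lip1_line x s t : `|f (s *: e + x) - f (t *: e + x)| <= L * `|s - t|.
Proof.
rewrite (le_trans (fL _ _))// ler_pM2l// (bigD1 i)//= big1 ?addr0.
  by rewrite !mxE !eqxx !mulr1 opprD addrACA subrr addr0.
move=> j ji; rewrite !mxE eqxx /= (negbTE ji) !mulr0 !add0r subrr normr0//.
Qed.

Lemma continuous_line x : continuous (fun s : R => f (s *: e + x)).
Proof.
move=> s; apply/cvgrPdist_lt => d d0; near=> t.
apply: (le_lt_trans (lip1_line _ _ _)); rewrite mulrC -ltr_pdivlMr//.
near: t; apply: (@cvgr_dist_lt _ _ _ (nbhs s) _ id s); first exact: cvg_id.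
by rewrite divr_gt0.
Unshelve. all: by end_near. Qed.

(** The Cauchy criterion for the difference quotients, over rational increments. *)
Lemma deriv_setE : deriv_set =
  \bigcap_m \bigcup_l \bigcap_(a in [set a : rat | 0 < `|ratr a : R| < l.+1%:R^-1])
    \bigcap_(b in [set b : rat | 0 < `|ratr b : R| < l.+1%:R^-1])
    [set x | `|quot_dir (ratr a) x - quot_dir (ratr b) x| <= m.+1%:R^-1].
Proof.
have cq x h : h != 0 -> {for h, continuous (quot_dir ^~ x)}.
  move=> h0; apply: cvgM; first by apply: cvgV => //; exact: cvg_id.
  by apply: cvgB; [exact: continuous_line|exact: cvg_cst].
have H x : derivable f x e <-> _ := @cvg_dnbhs0_ratP R (fun h => quot_dir h x) (cq x).
apply/seteqP; split=> x /=.
  by move=> /H K m _; have [l Kl] := K m; exists l => // a al b bl; exact: Kl.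
by move=> K; apply/H => m; have [l _ Kl] := K m I; exists l => a b al bl; exact: Kl.
Qed.

Lemma measurable_deriv_set : measurable deriv_set.
Proof.
rewrite deriv_setE; apply: bigcap_measurable => [|m _]; first by exists 0%N.
apply: bigcup_measurable => l _.
apply: countable_bigcap_measurable => a _.
apply: countable_bigcap_measurable => b _.
rewrite -[X in measurable X]setTI.
have : measurable_fun setT (fun x => `|quot_dir (ratr a) x - quot_dir (ratr b) x|).
  apply: measurableT_comp => //; apply: measurable_funB; exact: measurable_quot_dir.
move=> /(_ measurableT `]-oo, m.+1%:R^-1]%classic (measurable_itv _)).
by rewrite (_ : _ @^-1` _ = [set x | `|quot_dir (ratr a) x - quot_dir (ratr b) x| <= m.+1%:R^-1]).
Qed.

(** The partial derivative, set to zero where it does not exist.  Unlike the derive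
operator, whose value there is arbitrary, it is Borel. *)
Definition partial (x : 'rV[R]_n) : R := \1_deriv_set x * 'D_e f x.

Lemma measurable_partial : measurable_fun setT partial.
Proof.
have mS := measurable_deriv_set.
rewrite (_ : partial = (fun x => 'D_e f x) \_ deriv_set); last first.
  apply/funext => x; rewrite /partial patchE indicE.
  by case: ifPn => _; rewrite ?mul1r ?mul0r.
apply/(measurable_restrictT _ mS).
apply: (@measurable_fun_cvg _ _ _ _ (fun k => quot_dir k.+1%:R^-1)) => //.
  by move=> k; apply: measurable_funTS; exact: measurable_quot_dir.
move=> x /= dx; rewrite /derive.
have := dx; rewrite /derivable => /cvg_ex [l lx].
rewrite (cvg_lim _ lx)//.
apply: (@cvg_comp _ _ _ (fun k : nat => k.+1%:R^-1)
  (fun h => h^-1 *: ((f \o shift x) (h *: e) - f x)) _ _ _ _ lx).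
move=> A [d /= d0 HA]; near=> k; apply: HA => /=; last by rewrite invr_eq0 pnatr_eq0.
rewrite sub0r normrN ger0_norm//; near: k.
exact: (near_infty_natSinv_lt (PosNum d0)).
Unshelve. all: by end_near. Qed.

Let subst_coordE (x : 'rV[R]_n) s : subst_coord i x s = s *: e + subst_coord i x 0.
Proof.
apply/rowP => j; rewrite !mxE eqxx /=; case: eqP => _; rewrite ?mulr1 ?addr0//.
by rewrite mulr0 add0r.
Qed.

Let quot_subst (x : 'rV[R]_n) t (phi := fun s => f (subst_coord i x s)) :
  (fun h => h^-1 *: ((phi \o shift t) (h *: 1) - phi t)) =
  (fun h => h^-1 *: ((f \o shift (subst_coord i x t)) (h *: e) - f (subst_coord i x t))).
Proof.
apply/funext => h; rewrite /phi /= subst_coordE [subst_coord i x t]subst_coordE.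
by rewrite [h *: 1]mulr1 scalerDl addrA.
Qed.

Let derivable_substP (x : 'rV[R]_n) t :
  derivable (fun s => f (subst_coord i x s)) t 1 <-> deriv_set (subst_coord i x t).
Proof. by rewrite /deriv_set/= /derivable quot_subst. Qed.

Let derive_subst (x : 'rV[R]_n) t :
  'D_1 (fun s => f (subst_coord i x s)) t = 'D_e f (subst_coord i x t).
Proof. by rewrite /derive quot_subst. Qed.

Let lip1_subst (x : 'rV[R]_n) s t :
  `|f (subst_coord i x s) - f (subst_coord i x t)| <= L * `|s - t|.
Proof. by rewrite subst_coordE [subst_coord i x t]subst_coordE; exact: lip1_line. Qed.

Lemma deriv_set_ae_line (x : 'rV[R]_n) (mu := @lebesgue_measure R) :
  {ae mu, forall t, deriv_set (subst_coord i x t)}.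
Proof.
have H (k : nat) : {ae mu, forall t, t \in `](- k.+1%:R), k.+1%:R[ ->
    derivable (fun s => f (subst_coord i x s)) t 1}.
  apply: (@lipschitz_ae_derivable R _ L _ _ L0 _ (lip1_subst x)).1.
  by have := ltr0Sn R k; lra.
have := ae_foralln H.
apply: filterS => t Ht.
have D : derivable (fun s => f (subst_coord i x s)) t 1.
  by apply: (Ht (Num.truncn `|t|)); rewrite in_itv/= -ltr_norml truncnS_gt.
by have [+ _] := derivable_substP x t; apply.
Qed.

(** On a line, [partial] agrees almost everywhere with the derivative of the
restriction of [f] to that line. *)
Lemma lip1_line_le_integral (x : 'rV[R]_n) a b (mu := @lebesgue_measure R) : a <= b ->
  (`|f (subst_coord i x b) - f (subst_coord i x a)|%:E <=
   \int[mu]_(t in `]a, b]) `|partial (subst_coord i x t)|%:E)%E.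
Proof.
rewrite le_eqVlt => /predU1P[->|ab].
  by rewrite subrr normr0; apply: integral_ge0 => t _; rewrite lee_fin.
apply: le_trans (@lipschitz_ae_derivable R _ L _ _ L0 ab (lip1_subst x)).2 _.
apply: ae_le_ge0_integral => //.
apply: (ae_imply (deriv_set_ae_line x)) => t St _.
by rewrite derive_subst /partial indicE mem_set// mul1r.
Qed.

End partial.

(** * Carleson embedding on a tree *)

(** The convex power lies above its tangent at [y]; this is Young's inequality for
[x] and [y ^ (a - 1)]. *)
Lemma powR_tangent (R : realType) (a x y : R) : 1 < a -> 0 <= x -> 0 <= y ->
  y `^ a + a * y `^ (a - 1) * (x - y) <= x `^ a.
Proof.
move=> a1 x0 y0; have a0 : 0 < a by apply: lt_trans a1.
have am0 : 0 < a - 1 by rewrite subr_gt0.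
have := @conjugate_powR R x (y `^ (a - 1)) a (a / (a - 1)) x0 (powR_ge0 _ _).
move=> /(_ a0 (divr_gt0 a0 am0)) H.
have {H} : x * y `^ (a - 1) <= x `^ a / a + y `^ a * ((a - 1) / a).
  have e : (a - 1) * (a / (a - 1)) = a by rewrite mulrC divfK// gt_eqF.
  rewrite -powRrM e invf_div in H; apply: H.
  by rewrite -[X in X + _]mul1r -mulrDl addrC subrK divff// gt_eqF.
have yE : y `^ (a - 1) * y = y `^ a.
  by rewrite mulrC mulr_powRB1.
rewrite -(ler_pM2l a0) mulrDr.
have -> : a * (x `^ a / a) = x `^ a by rewrite mulrC divfK// gt_eqF.
have -> : a * (y `^ a * ((a - 1) / a)) = (a - 1) * y `^ a.
  by rewrite mulrCA [a * (_ / _)]mulrC divfK ?gt_eqF// mulrC.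
move: yE; set Y := y `^ (a - 1) => yE H.
have -> : a * Y * (x - y) = a * (x * Y) - a * (Y * y) by ring.
by rewrite yE; lra.
Qed.

Section tree.
Context (R : realType) (E : finType).
Implicit Types (s u : seq E) (phi : seq E -> R).

(** A node is the word of the choices made from the root [[::]], the latest choice
first, and [nodes N s] lists the descendants of [s] of relative depth less than
[N]. *)
Fixpoint nodes (N : nat) s : seq (seq E) :=
  if N is M.+1 then s :: flatten [seq nodes M (e :: s) | e <- enum E] else [::].

Definition tsum N phi s := \sum_(u <- nodes N s) phi u.

Lemma tsum0 phi s : tsum 0 phi s = 0. Proof. by rewrite /tsum big_nil. Qed.

Lemma tsumS N phi s : tsum N.+1 phi s = phi s + \sum_e tsum N phi (e :: s).
Proof. by rewrite /tsum /= big_cons big_flatten /= big_map big_enum. Qed.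

Lemma tsum_ge0 N phi s : (forall u, 0 <= phi u) -> 0 <= tsum N phi s.
Proof. by move=> h; apply: sumr_ge0. Qed.

Section carleson_embedding.
Variables (mu F Y al : seq E -> R) (a La : R).
Hypotheses (a1 : 1 < a) (mu0 : forall s, 0 < mu s)
  (muE : forall s, mu s = \sum_e mu (e :: s))
  (F0 : forall s, 0 <= F s) (FE : forall s, F s = \sum_e F (e :: s))
  (al0 : forall s, 0 <= al s)
  (alLa : forall N s, tsum N al s <= La * mu s)
  (FY : forall s, mu s * (F s / mu s) `^ a <= Y s)
  (YE : forall s, \sum_e Y (e :: s) <= Y s).

(** If the coefficients [al] satisfy the packing condition [alLa], the sum of
[al u] times the [a]-th power of the average [F u / mu u] is bounded by the root
value of [Y], a supersolution that dominates the power of the average.  The proof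
is by a Bellman function: with [T M u], the measure of [u] plus the packing mass of
its subtree of depth [M], the sum of [T (F / T) ^ a] over the children of a node
exceeds its value at the node by at least a constant times the summand there, and
it never exceeds [Y]. *)
Lemma carleson_embedding N s :
  tsum N (fun u => al u * (F u / mu u) `^ a) s <= (1 + La) `^ a / (a - 1) * Y s.
Proof.
have a0 : 0 < a by apply: lt_trans a1.
have am0 : 0 < a - 1 by rewrite subr_gt0.
have La0 : 0 <= La.
  have := alLa 0 s; rewrite tsum0 pmulr_lge0//.
have La1 : 0 < 1 + La by rewrite ltr_pwDl.
pose T N s := mu s + tsum N al s.
have T0 M u : 0 < T M u by rewrite /T ltr_pwDl// tsum_ge0.
have TLa M u : T M u <= (1 + La) * mu u.
  by rewrite /T mulrDl mul1r lerD2l.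
pose c := (a - 1) / (1 + La) `^ a.
have c0 : 0 < c by rewrite divr_gt0// powR_gt0.
suff H M u : c * tsum M (fun u => al u * (F u / mu u) `^ a) u
    + T M u * (F u / T M u) `^ a <= Y u.
  have := H N s; have : 0 <= T N s * (F s / T N s) `^ a.
    by rewrite mulr_ge0 ?powR_ge0// ltW.
  move=> h1 h2; have {h1 h2} : c * tsum N (fun u => al u * (F u / mu u) `^ a) s <= Y s by lra.
  rewrite mulrC -ler_pdivlMr// => /le_trans; apply.
  by rewrite /c invf_div mulrC.
elim: M u => [|M IH] u; first by rewrite /T !tsum0 mulr0 add0r addr0.
(* [la] is the average of [F] with respect to the augmented mass [T]; tangents of
   the power are taken at this point. *)
rewrite tsumS; set la := F u / T M.+1 u.
have la0 : 0 <= la by rewrite divr_ge0// ltW.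
have step1 : c * (al u * (F u / mu u) `^ a) <= (a - 1) * (al u * la `^ a).
  rewrite /c -mulrA ler_pM2l// mulrCA ler_wpM2l// mulrC ler_pdivrMr ?powR_gt0//.
  rewrite -powRM// ?(ltW La1)//; apply: ge0_ler_powR; rewrite ?nnegrE ?(ltW a0)//.
  - by rewrite divr_ge0// ltW.
  - by rewrite mulr_ge0// ltW.
  rewrite ler_pdivrMr//.
  have -> : la * (1 + La) * mu u = F u * ((1 + La) * mu u / T M.+1 u).
    by rewrite /la; ring.
  by rewrite ler_peMr// ler_pdivlMr// mul1r.
have tanE e : la `^ a * T M (e :: u) + a * la `^ (a - 1) * (F (e :: u) - la * T M (e :: u))
    <= T M (e :: u) * (F (e :: u) / T M (e :: u)) `^ a.
  have h := @powR_tangent R a (F (e :: u) / T M (e :: u)) la a1.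
  have {h} h := h (divr_ge0 (F0 _) (ltW (T0 _ _))) la0.
  apply: le_trans (ler_wpM2l (ltW (T0 M (e :: u))) h).
  have -> : F (e :: u) - la * T M (e :: u) =
     T M (e :: u) * (F (e :: u) / T M (e :: u) - la).
    by rewrite mulrBr mulrCA divff ?gt_eqF// mulr1 [la * _]mulrC.
  by rewrite [leRHS]mulrDr [la `^ a * _]mulrC lerD2l mulrCA.
have laE : la `^ (a - 1) * la = la `^ a.
  by rewrite mulrC mulr_powRB1.
have TE : T M.+1 u = al u + \sum_e T M (e :: u).
  by rewrite /T tsumS muE big_split/= addrCA.
have FlT : F u = la * T M.+1 u by rewrite /la divfK// gt_eqF.
have sumtan : la `^ a * (T M.+1 u - al u) + a * la `^ (a - 1) * (F u - la * (T M.+1 u - al u))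
   <= \sum_e T M (e :: u) * (F (e :: u) / T M (e :: u)) `^ a.
  apply: le_trans (ler_sum _ (fun e _ => tanE e)).
  rewrite big_split/= -!mulr_sumr sumrB -mulr_sumr -FE.
  by have -> : \sum_e T M (e :: u) = T M.+1 u - al u by rewrite TE; ring.
have {}sumtan : T M.+1 u * la `^ a + (a - 1) * (al u * la `^ a)
   <= \sum_e T M (e :: u) * (F (e :: u) / T M (e :: u)) `^ a.
  apply: le_trans sumtan.
  rewrite FlT.
  have -> : la * T M.+1 u - la * (T M.+1 u - al u) = la * al u by ring.
  have -> : a * la `^ (a - 1) * (la * al u) = a * (la `^ (a - 1) * la) * al u by ring.
  by rewrite laE le_eqVlt; apply/orP; left; apply/eqP; ring.
have sumIH : \sum_e (c * tsum M (fun u => al u * (F u / mu u) `^ a) (e :: u)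
    + T M (e :: u) * (F (e :: u) / T M (e :: u)) `^ a) <= Y u.
  by apply: le_trans (YE u); apply: ler_sum => e _; exact: IH.
move: sumIH; rewrite big_split/= -mulr_sumr mulrDr => sumIH.
by lra.
Qed.

End carleson_embedding.
End tree.

(** * Stopping nodes and sparse domination *)

Section stopping.
Variables (R : realType) (E : finType) (mu X : seq E -> R).
Hypotheses (mu0 : forall s, 0 < mu s)
  (X0 : forall s, 0 <= X s) (XE : forall s, X s = \sum_e X (e :: s)).
Implicit Types s u : seq E.

Let mean s := X s / mu s.

(** The average of [X] at the nearest stopping ancestor; a node stops when its
average exceeds twice this value. *)
Fixpoint tau s : R :=
  if s is e :: s' then if 2 * tau s' < mean s then mean s else tau s'
  else mean s.

Definition stop s : bool := if s is e :: s' then 2 * tau s' < mean s else true.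

Let mean_ge0 s : 0 <= mean s. Proof. by rewrite divr_ge0// ltW. Qed.

Let tau_ge0 s : 0 <= tau s.
Proof. by elim: s => //= e s IH; case: ifP. Qed.

Let tau_stop s : stop s -> tau s = mean s.
Proof. by case: s => //= e s ->. Qed.

Let tau_cont e s : ~~ stop (e :: s) -> tau (e :: s) = tau s.
Proof. by move=> /= /negbTE ->. Qed.

Let mean_le_tau s : mean s <= 2 * tau s.
Proof.
have H x : 0 <= x -> x <= 2 * x :> R by move=> ?; lra.
case: s => [|e s] /=; first exact: H.
by case: ltP => // _; exact: H.
Qed.

Let XmeanE s : X s = mean s * mu s.
Proof. by rewrite /mean divfK// gt_eqF. Qed.

Let X_child e s : X (e :: s) <= X s.
Proof. by rewrite [leRHS]XE (bigD1 e)//= lerDl sumr_ge0. Qed.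

Definition stop_mass s : R := if stop s then mu s else 0.

Let stop_mass_ge0 s : 0 <= stop_mass s.
Proof. by rewrite /stop_mass; case: ifP => // _; exact: ltW. Qed.

(** Every stopping child [e :: s] has average above [2 * tau s], hence measure at
most half of its share of [X s / tau s]; the other half pays for the stopping nodes
below it. *)
Let stop_below N s : \sum_e tsum N stop_mass (e :: s) <= X s / tau s.
Proof.
elim: N s => [|N IH] s.
  by rewrite big1 ?divr_ge0// => e _; rewrite tsum0.
rewrite XE mulr_suml; apply: ler_sum => e _; rewrite tsumS /stop_mass.
have [se|se] := boolP (stop (e :: s)); last first.
  by rewrite add0r -(tau_cont se); exact: IH.
have /= lt2 := se.
have mpos : 0 < mean (e :: s) by apply: le_lt_trans lt2; rewrite mulr_ge0.
have tpos : 0 < tau s.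
  rewrite lt_neqAle tau_ge0 andbT; apply: contraTneq lt2 => /esym t0.
  rewrite -leNgt t0 mulr0 /mean ler_pdivrMr// mul0r (le_trans (X_child _ _))//.
  rewrite XmeanE; have := mean_le_tau s; rewrite t0 mulr0 => ?.
  by rewrite pmulr_lle0.
apply: (@le_trans _ _ (mu (e :: s) + mu (e :: s))).
  by rewrite lerD2l (le_trans (IH _))// tau_stop// XmeanE mulrC mulrA mulVf ?mul1r// gt_eqF.
rewrite ler_pdivlMr// XmeanE.
apply: le_trans (ler_wpM2r (ltW (mu0 _)) (ltW lt2)).
by rewrite le_eqVlt; apply/orP; left; apply/eqP; ring.
Qed.

(** The packing condition: each generation of stopping nodes has at most half the
measure of the previous one. *)
Lemma carleson_stop N s : tsum N stop_mass s <= 2 * mu s.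
Proof.
case: N => [|N]; first by rewrite tsum0 mulr_ge0// ltW.
rewrite tsumS; apply: (le_trans (lerD (lexx _) (stop_below _ _))).
rewrite XmeanE /stop_mass; have [ss|ss] := boolP (stop s).
  rewrite tau_stop//; have [m0|m0] := eqVneq (mean s) 0.
    by rewrite m0 !mul0r addr0 ler_peMl// ?ltW// ltrDl.
  by rewrite mulrAC divff// mul1r le_eqVlt; apply/orP; left; apply/eqP; ring.
rewrite add0r; have [->|t0] := eqVneq (tau s) 0.
  by rewrite invr0 mulr0 mulr_ge0// ltW.
have tp : 0 < tau s by rewrite lt_neqAle eq_sym t0 tau_ge0.
rewrite ler_pdivrMr// [leRHS]mulrAC ler_wpM2r//; exact: ltW.
Qed.

Section sparse.
Variables (len V : seq E -> R) (b : R).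
Hypotheses (b0 : 0 < b) (len0 : forall s, 0 < len s)
  (lenE : forall e s, len (e :: s) = len s / 2)
  (V0 : forall s, 0 <= V s) (VE : forall s, V s = \sum_e V (e :: s)).

Let psi s := (len s * mean s) `^ b * V s.
Let spsi s := if stop s then psi s else 0.
Let C := 4 `^ b / (2 `^ b - 1).

Let pow2_gt1 : 1 < 2 `^ b :> R. Proof. exact: powR2_gt1. Qed.

Let C0 : 0 <= C.
Proof. by rewrite divr_ge0 ?powR_ge0// subr_ge0 ltW. Qed.

Let spsi_ge0 s : 0 <= spsi s.
Proof. by rewrite /spsi; case: ifP => // _; rewrite mulr_ge0 ?powR_ge0. Qed.

(** Between two stopping nodes the average is at most [2 * tau] while [len]
halves at each level, so the terms [psi] form a geometric series of ratio
[2 ^ (- b)].  The first term on the right is the tail of that series below [s]; it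
reproduces itself because [C] is the solution of [C = 2 ^ b + C / 2 ^ b]. *)
Let sparse_below N s : tsum N psi s <=
  C * ((tau s * len s) `^ b * V s) + C * \sum_e tsum N spsi (e :: s).
Proof.
have tl0 u : 0 <= tau u * len u by rewrite mulr_ge0// ltW.
elim: N s => [|N IH] s.
  rewrite tsum0 big1 => [|e _]; last by rewrite tsum0.
  rewrite mulr0 addr0; apply: mulr_ge0 => //.
  by apply: mulr_ge0 => //; exact: powR_ge0.
rewrite tsumS.
have top : psi s <= 2 `^ b * ((tau s * len s) `^ b * V s).
  rewrite /psi mulrA ler_wpM2r// -powRM//; apply: ge0_ler_powR; rewrite ?nnegrE ?(ltW b0)//.
  - by rewrite mulr_ge0// ltW.
  - by rewrite mulr_ge0.
  by rewrite mulrA mulrC ler_wpM2r ?(ltW (len0 _)).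
have child e : tsum N psi (e :: s) <=
    C * ((tau s * len s) `^ b / 2 `^ b * V (e :: s)) + C * tsum N.+1 spsi (e :: s).
  apply: (le_trans (IH _)); rewrite tsumS [C * (spsi _ + _)]mulrDr addrA lerD2r.
  rewrite -mulrDr ler_wpM2l//.
  have half : (tau s * len s) `^ b / 2 `^ b = (tau s * len (e :: s)) `^ b.
    rewrite lenE mulrA [RHS]powRM//.
    by rewrite -[2^-1 in RHS]powR_inv1// -powRrM mulN1r powRN.
  rewrite half /spsi; case: ifPn => se.
    rewrite (tau_stop se) /psi [len _ * _]mulrC lerDr.
    by apply: mulr_ge0; rewrite ?powR_ge0.
  by rewrite (tau_cont se) addr0.
apply: (le_trans (lerD top (ler_sum _ (fun e _ => child e)))).
rewrite big_split/= -!mulr_sumr addrA lerD2r -VE.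
set t := (tau s * len s) `^ b.
have -> : C * (t * V s) = 2 `^ b * (t * V s) + C * (t / 2 `^ b * V s).
  have p0 : 2 `^ b != 0 :> R by rewrite gt_eqF// powR_gt0.
  have p1 : 2 `^ b - 1 != 0 :> R by rewrite gt_eqF// subr_gt0.
  rewrite /C (_ : 4 = 2 * 2) ?powRM//; last by rewrite -natrM.
  by field; rewrite p0 p1.
by [].
Qed.

(** At the root, which is a stopping node, [tau] is the average itself, and the tail
term is the root term of the sparse sum. *)
Lemma sparse_domination N :
  tsum N psi [::] <= C * tsum N.+1 spsi [::].
Proof.
apply: (le_trans (sparse_below _ _)).
by rewrite tsumS mulrDr lerD2r /spsi /= /psi [len _ * _]mulrC.
Qed.

End sparse.
End stopping.

(** [t ^ th = t * t ^ (th - 1)], and the second factor is nondecreasing. *)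
Lemma powR_superadd (R : realType) (th x y : R) : 1 <= th -> 0 <= x -> 0 <= y ->
  x `^ th + y `^ th <= (x + y) `^ th.
Proof.
move=> th1 x0 y0; have th0 : 0 < th by apply: lt_le_trans th1.
have s0 : 0 <= x + y by rewrite addr_ge0.
rewrite -(mulr_powRB1 x0 th0) -(mulr_powRB1 y0 th0) -(mulr_powRB1 s0 th0) mulrDl.
have p0 : 0 <= th - 1 by rewrite subr_ge0.
by apply: lerD; apply: ler_wpM2l => //; apply: ge0_ler_powR;
  rewrite ?nnegrE// (lerDl, lerDr).
Qed.

(** Hoelder's inequality with exponents of sum at least [1] rather than equal to
[1]: the sequence norms decrease with the exponent.  Each step of the induction is
the two-term inequality for the normalized exponents, raised to the power
[al + be]. *)
Lemma sum_hoelder (R : realType) (I : Type) (l : seq I) (x y : I -> R) (al be : R) :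
  0 < al -> 0 < be -> 1 <= al + be -> (forall i, 0 <= x i) -> (forall i, 0 <= y i) ->
  \sum_(i <- l) x i `^ al * y i `^ be <=
  (\sum_(i <- l) x i) `^ al * (\sum_(i <- l) y i) `^ be.
Proof.
move=> al0 be0 th1 x0 y0; elim: l => [|i l IH].
  by rewrite !big_nil !powR0 ?gt_eqF// mulr0.
rewrite !big_cons; apply: (le_trans (lerD (lexx _) IH)).
move: (x0 i) (y0 i); set x1 := x i; set y1 := y i => x10 y10.
set X := \sum_(_ <- _) _; set Y := \sum_(_ <- _) _.
have X0 : 0 <= X by exact: sumr_ge0.
have Y0 : 0 <= Y by exact: sumr_ge0.
pose th := al + be; have th0 : 0 < th by rewrite addr_gt0.
have thN : th != 0 by rewrite gt_eqF.
have e1 : al / th * th = al by rewrite divfK.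
have e2 : be / th * th = be by rewrite divfK.
have i1 : al / th * (th / al) = 1 by rewrite mulrA e1 divff// gt_eqF.
have i2 : be / th * (th / be) = 1 by rewrite mulrA e2 divff// gt_eqF.
have H := @hoelder2 R (x1 `^ (al / th)) (X `^ (al / th)) (y1 `^ (be / th)) (Y `^ (be / th))
  (th / al) (th / be) (powR_ge0 _ _) (powR_ge0 _ _) (powR_ge0 _ _) (powR_ge0 _ _)
  (divr_gt0 th0 al0) (divr_gt0 th0 be0).
rewrite -!powRrM i1 i2 !powRr1// !invf_div in H.
have {}H := H (ltac:(by rewrite -mulrDl divff)).
have {H} := @ge0_ler_powR R th (ltW th0) _ _ _ _ H.
rewrite !nnegrE => H.
have {}H := H (addr_ge0 (mulr_ge0 (powR_ge0 _ _) (powR_ge0 _ _)) (mulr_ge0 (powR_ge0 _ _) (powR_ge0 _ _)))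
  (mulr_ge0 (powR_ge0 _ _) (powR_ge0 _ _)).
rewrite [leRHS]powRM ?powR_ge0// -!powRrM e1 e2 in H.
apply: le_trans H.
apply: (le_trans _ (powR_superadd th1 _ _)); rewrite ?mulr_ge0 ?powR_ge0//.
by rewrite !powRM ?powR_ge0// -!powRrM e1 e2.
Qed.

(** * The tree of dyadic subcubes *)

Section uniq_nodes.
Variable E : finType.

Lemma mem_nodes N (s u : seq E) : u \in nodes N s -> suffix s u.
Proof.
elim: N s => // N IH s; rewrite /= inE => /predU1P[->|]; first exact: suffix_refl.
move=> /flattenP[l /mapP[e _ ->]] /IH; apply: suffix_trans.
by apply/suffixP; exists [:: e].
Qed.

Lemma nodes_uniq N (s : seq E) : uniq (nodes N s).
Proof.
elim: N s => // N IH s /=; apply/andP; split.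
  apply/negP => /flattenP[l /mapP[e _ ->]] /mem_nodes /size_suffix.
  by rewrite /= ltnn.
have : uniq (enum E) by exact: enum_uniq.
elim: (enum E) => //= e l IHl /andP[el ul]; rewrite cat_uniq IH IHl// andbT /=.
apply/hasPn => u /flattenP[_ /mapP[e' el' ->]] /mem_nodes; rewrite suffixE => /eqP h'.
apply/negP => /mem_nodes; rewrite suffixE /= => /eqP.
by move: h' => /= -> [ee']; move: el; rewrite -ee' el'.
Qed.

End uniq_nodes.

Section dyadic_tree.
Context (R : realType) (n : nat).
Local Notation E := {ffun 'I_n -> bool}.
Local Notation idx := (int * 'rV[int]_n)%type.
Local Notation mu := (lebesgue_rV R n).
Local Notation cube jm := (@dyadic_cube R n jm.1 jm.2).
Implicit Types (jm : idx) (e : E) (s u : seq E).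

(** The digit [e i] tells which half of the [i]-th side the child occupies. *)
Definition child e jm : idx := (jm.1 + 1, \row_i (2 * jm.2 ord0 i + (e i : nat)%:Z)).

Definition descendant jm s : idx := foldr child jm s.

(** The level determines the length of the word, and the parity of the coordinates
its first letter. *)
Lemma descendant_inj jm : injective (descendant jm).
Proof.
have lvl s : (descendant jm s).1 = jm.1 + (size s)%:Z.
  elim: s => [|e s IH] /=; first by rewrite addr0.
  by rewrite IH; lia.
move=> s u su; have : size s = size u.
  by move/(congr1 fst): su; rewrite !lvl => /addrI[].
elim: s u su => [|e s IH] [|e' u] //= su [ss].
have mE i : 2 * (descendant jm s).2 ord0 i + (e i : nat)%:Z =
    2 * (descendant jm u).2 ord0 i + (e' i : nat)%:Z.
  by have /(congr1 snd)/rowP/(_ i) := su; rewrite !mxE.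
have ee : e = e'.
  by apply/ffunP => i; move: (mE i); case: (e i); case: (e' i) => //= ?; lia.
rewrite ee; congr cons; apply: IH => //; apply/pair_eqP/andP; split; apply/eqP.
  by rewrite !lvl ss.
by apply/rowP => i; have := mE i; rewrite ee => /addIr/mulfI; apply.
Qed.

Lemma dyadic_side_gt0 j : 0 < dyadic_side R j.
Proof. by rewrite /dyadic_side exprz_gt0. Qed.

Lemma dyadic_side_succ j : dyadic_side R (j + 1) = dyadic_side R j / 2.
Proof. by rewrite /dyadic_side opprD expfzDr. Qed.

Lemma measurable_dyadic jm : measurable (cube jm).
Proof. exact: measurable_box. Qed.

Lemma mu_dyadic jm : mu (cube jm) = (dyadic_side R jm.1 ^+ n)%:E.
Proof.
rewrite lebesgue_rV_box => [|i]; last first.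
  by rewrite !mxE ler_pM2l ?dyadic_side_gt0// lerDl.
congr EFin; transitivity (\prod_(i < n) dyadic_side R jm.1).
  by apply: eq_bigr => i _; rewrite !mxE mulrDr mulr1 addrC addKr.
by rewrite prodr_const card_ord.
Qed.

(** Membership by integer parts, from which the nesting, the disjointness and the
covering of the children are read off. *)
Lemma dyadic_cubeP jm x : cube jm x <->
  forall i, Num.floor (x ord0 i / dyadic_side R jm.1) = jm.2 ord0 i.
Proof.
rewrite /dyadic_cube /box /=; split=> H i; have := H i; rewrite !mxE.
  move=> /andP[h1 h2]; apply: floor_def; rewrite ler_pdivlMr ?dyadic_side_gt0//.
  by rewrite ltr_pdivrMr ?dyadic_side_gt0// intrD mulrC h1 mulrC.
move=> <-; set d := dyadic_side _ _; have d0 : 0 < d by exact: dyadic_side_gt0.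
rewrite mulrC -ler_pdivlMr// floor_le/= mulrC -ltr_pdivrMr//.
by have := floorD1_gt (x ord0 i / d); rewrite intrD.
Qed.

Let child_cubeP e jm x : cube (child e jm) x <->
  forall i, Num.floor (2 * (x ord0 i / dyadic_side R jm.1)) = 2 * jm.2 ord0 i + (e i : nat)%:Z.
Proof.
rewrite dyadic_cubeP /=; split=> H i; have := H i; rewrite mxE dyadic_side_succ => <-.
  by rewrite invf_div mulrCA.
by rewrite invf_div mulrCA.
Qed.

Lemma dyadic_partition jm :
  cube jm = \big[setU/set0]_(e <- enum E) cube (child e jm).
Proof.
rewrite -bigcup_seq; apply/seteqP; split=> x.
  move=> /dyadic_cubeP H.
  exists [ffun i => (jm.2 ord0 i)%:~R + 2^-1 <= x ord0 i / dyadic_side R jm.1].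
    by rewrite /= mem_enum.
  apply/child_cubeP => i; rewrite ffunE; have := floor_itv (x ord0 i / dyadic_side R jm.1).
  rewrite H; set y := _ / _; set m := jm.2 _ _; rewrite intrD => /andP[h1 h2].
  by case: leP => h; apply: floor_def; rewrite !intrD intrM /=; apply/andP; split; lra.
move=> [e _ /child_cubeP H]; apply/dyadic_cubeP => i.
have := floor_itv (2 * (x ord0 i / dyadic_side R jm.1)); rewrite (H i).
set y := _ / _; set m := jm.2 _ _ => /andP[]; rewrite !intrD intrM => h1 h2.
by apply: floor_def; move: h1 h2; rewrite !intrD; case: (e i) => /= h1 h2;
  apply/andP; split; lra.
Qed.

Lemma dyadic_trivIset jm : trivIset setT (fun e => cube (child e jm)).
Proof.
move=> e e' _ _ [x [/child_cubeP H /child_cubeP H']]; apply/ffunP => i.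
by have := H i; rewrite (H' i) => /addrI; case: (e i); case: (e' i).
Qed.

Lemma integral_dyadic jm (f : 'rV[R]_n -> \bar R) : measurable_fun setT f ->
  (forall x, 0 <= f x)%E ->
  (\int[mu]_(x in cube jm) f x = \sum_e \int[mu]_(x in cube (child e jm)) f x)%E.
Proof.
move=> mf f0; rewrite dyadic_partition ge0_integral_bigsetU//=.
- by rewrite big_enum.
- by move=> e; exact: (measurable_dyadic (child e jm)).
- exact: enum_uniq.
- by apply: sub_trivIset (@dyadic_trivIset jm) => x _.
- exact: measurable_funTS.
Qed.

Lemma dyadic_child_sub e jm : cube (child e jm) `<=` cube jm.
Proof.
by move=> x ex; rewrite dyadic_partition -bigcup_seq; exists e => //=; rewrite mem_enum.
Qed.

Lemma descendant_sub jm s : cube (descendant jm s) `<=` cube jm.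
Proof. by elim: s => //= e s IH; apply: subset_trans IH; exact: dyadic_child_sub. Qed.

Lemma tsum_le_esum jm N (T : idx -> R) : (forall i, 0 <= T i) ->
  ((tsum N (fun u => T (descendant jm u)) [::])%:E <= \esum_(i in setT) (T i)%:E)%E.
Proof.
move=> T0; apply: esum_ge.
have ul : uniq (map (descendant jm) (nodes N [::])).
  by rewrite map_inj_uniq ?nodes_uniq//; exact: descendant_inj.
exists [set` map (descendant jm) (nodes N [::])]; first by split => //; exact: finite_seq.
by rewrite -fsbig_seq//= big_map sumEFin.
Qed.

End dyadic_tree.

(** * Averages over a cube and over its children *)

Section itv_average.
Context (R : realType).
Local Notation mu := (@lebesgue_measure R).
Local Open Scope ereal_scope.

Let avg (a b : R) (phi : R -> R) :=
  (b - a)^-1%:E * \int[mu]_(t in `[a, b[) (phi t)%:E.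

Let avg_cst a b (c : R) : (a < b)%R -> avg a b (cst c) = c%:E.
Proof.
move=> ab; rewrite /avg -[\int[mu]_(t in _) _]/(\int[mu]_(t in `[a, b[) cst c%:E t).
rewrite integral_cst//.
rewrite [X in _ * (_ * X)](_ : _ = (b - a)%:E); last first.
  by rewrite [LHS](lebesgue_measure_itv `[a, b[)/= lte_fin ab.
by rewrite -!EFinM mulrCA mulVf ?mulr1// subr_eq0 gt_eqF.
Qed.

Let avg_le a b (phi psi : R -> R) : (a < b)%R ->
  measurable_fun setT phi -> measurable_fun setT psi -> (forall t, (0 <= phi t)%R) ->
  {in `[a, b[, forall t, (phi t <= psi t)%R} -> avg a b phi <= avg a b psi.
Proof.
move=> ab mphi mpsi phi0 le; apply: lee_wpmul2l.
  by rewrite lee_fin invr_ge0 subr_ge0 ltW.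
apply: ge0_le_integral => //.
- by move=> t _; rewrite lee_fin.
- by apply/measurable_EFinP; exact: measurable_funTS.
- by apply/measurable_EFinP; exact: measurable_funTS.
Qed.

(** The pointwise bound is averaged over [s] first and over [t] next.  The gap [ga] is
an extended real because it will be an integral over a segment. *)
Lemma itv_average_le (phi : R -> R) (ga : \bar R) (a1 b1 a2 b2 : R) :
  (a1 < b1)%R -> (a2 < b2)%R -> measurable_fun setT phi -> (forall t, (0 <= phi t)%R) ->
  0 <= ga ->
  (forall s t, (a1 <= s < b1)%R -> (a2 <= t < b2)%R -> (phi s)%:E <= (phi t)%:E + ga) ->
  (b1 - a1)^-1%:E * \int[mu]_(t in `[a1, b1[) (phi t)%:E <=
  (b2 - a2)^-1%:E * \int[mu]_(t in `[a2, b2[) (phi t)%:E + ga.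
Proof.
move=> ab1 ab2 mphi phi0 ga0 H; rewrite -!/(avg _ _ _).
have avg0 a b : (a < b)%R -> 0 <= avg a b phi.
  move=> ab; apply: mule_ge0; first by rewrite lee_fin invr_ge0 subr_ge0 ltW.
  by apply: integral_ge0 => t _; rewrite lee_fin.
case: ga ga0 H => [ga| |//] ga0 H; last first.
  by rewrite addey ?leey// -ltNye (lt_le_trans _ (avg0 _ _ _)).
have A t : (a2 <= t < b2)%R -> avg a1 b1 phi <= (phi t + ga)%:E.
  move=> tI; rewrite -(avg_cst (phi t + ga) ab1); apply: avg_le => //.
  by move=> s; rewrite in_itv/= => sI; rewrite -lee_fin EFinD; exact: H.
have fA : avg a1 b1 phi \is a fin_num.
  rewrite ge0_fin_numE ?avg0//; apply: le_lt_trans (A a2 _) _; rewrite ?ltry//.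
  by rewrite lexx.
move: A; rewrite -(fineK fA); set r := fine _ => A.
have r0 : (0 <= r)%R by rewrite fine_ge0// avg0.
rewrite -(avg_cst r ab2) -[ga](addr0 ga).
have -> : avg a2 b2 phi + (ga + 0)%:E = avg a2 b2 (fun t => phi t + ga)%R.
  rewrite addr0 /avg; under [in RHS]eq_integral do rewrite EFinD.
  have P : 0 <= \int[mu]_(t in `[a2, b2[) (phi t)%:E.
    by apply: integral_ge0 => t _; rewrite lee_fin.
  have Q : 0 <= \int[mu]_(t in `[a2, b2[) ga%:E by exact: integral_ge0.
  rewrite ge0_integralD//.
  - rewrite (ge0_muleDr _ P Q); congr (_ + _).
    by rewrite -[RHS]/(avg a2 b2 (cst ga)) avg_cst.
  - by move=> t _; rewrite lee_fin.
  - by apply/measurable_EFinP; exact: measurable_funTS.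
apply: avg_le => //; first exact: measurable_funD.
Qed.

End itv_average.

Section box_average.
Context (R : realType) (n : nat) (f : 'rV[R]_n -> R) (L c : R) (i : 'I_n).
Hypotheses (L0 : 0 < L) (fL : lip1 L f) (F0 : forall x, 0 <= f x + c).
Local Notation mu := (lebesgue_rV R n).
Local Notation lam := (@lebesgue_measure R).
Let F x := f x + c.
Let g := partial f i.

Let off (a b x : 'rV[R]_n) := forall k, k != i -> a ord0 k <= x ord0 k < b ord0 k.

Let box_subst (a b x : 'rV[R]_n) a1 b1 t :
  box (subst_coord i a a1) (subst_coord i b b1) (subst_coord i x t) <->
  off a b x /\ a1 <= t < b1.
Proof.
split=> [H|[H1 H2] k].
  split=> [k ki|]; first by have := H k; rewrite !mxE (negbTE ki).
  by have := H i; rewrite !mxE eqxx.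
by rewrite !mxE; case: eqP => // /eqP; exact: H1.
Qed.

Let subst_coord_id (a : 'rV[R]_n) : subst_coord i a (a ord0 i) = a.
Proof. by apply/rowP => j; rewrite mxE; case: eqP => // ->. Qed.

Let measurable_line (x : 'rV[R]_n) :
  measurable_fun setT (subst_coord i x : measurableTypeR R -> 'rV[R]_n).
Proof.
apply: measurable_rVP => j.
have [->|ji] := eqVneq j i.
  by under eq_fun do rewrite mxE eqxx; exact: measurable_id.
by under eq_fun do rewrite mxE (negbTE ji); exact: measurable_cst.
Qed.

Let line_box (h : 'rV[R]_n -> R) a b x a1 b1 :
  (\int[lam]_t ((fun y => (h y)%:E) \_
      (box (subst_coord i a a1) (subst_coord i b b1))) (subst_coord i x t) =
  if `[< off a b x >] then \int[lam]_(t in `[a1, b1[) (h (subst_coord i x t))%:E else 0)%E.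
Proof.
case: asboolP => H.
  rewrite [RHS]integral_mkcond; apply: eq_integral => t _; rewrite !patchE.
  congr (if _ then _ else _); apply/idP/idP => /set_mem K; apply/mem_set.
    by move: K => /box_subst[_] /=; rewrite in_itv.
  by apply/box_subst; split => //; move: K; rewrite /= in_itv.
rewrite -[RHS](@integral0 _ _ R lam setT); apply: eq_integral => t _.
by rewrite patchE memNset// => /box_subst[].
Qed.

(** A Poincare inequality for two slabs [[a1, b1)] and [[a2, b2)] of a box in the
direction [i].  On each line of direction [i] two values of [f] differ by at most
the integral of the partial derivative over the box, and the averaged inequality is
integrated over the lines.  The shift by [c] makes [f]
nonnegative. *)
Lemma box_average_le (a b : 'rV[R]_n) a1 b1 a2 b2 :
  a1 < b1 -> a2 < b2 -> a ord0 i <= a1 -> b1 <= b ord0 i ->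
  a ord0 i <= a2 -> b2 <= b ord0 i ->
  ((b1 - a1)^-1%:E * \int[mu]_(x in box (subst_coord i a a1) (subst_coord i b b1)) (F x)%:E <=
   (b2 - a2)^-1%:E * \int[mu]_(x in box (subst_coord i a a2) (subst_coord i b b2)) (F x)%:E
   + \int[mu]_(x in box a b) `|g x|%:E)%E.
Proof.
move=> ab1 ab2 aa1 bb1 aa2 bb2.
set B1 := box _ _; set B2 := box _ _; set B := box _ _.
have mB1 : measurable B1 by exact: measurable_box.
have mB2 : measurable B2 by exact: measurable_box.
have mB : measurable B by exact: measurable_box.
have mf : measurable_fun setT f by exact: measurable_lip1 L0 fL.
have mF : measurable_fun setT (fun x => (F x)%:E).
  by apply/measurable_EFinP; apply: measurable_funD.
have mg : measurable_fun setT (fun x => `|g x|%:E).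
  by apply/measurable_EFinP; apply: measurableT_comp => //; exact: measurable_partial fL.
have patch0 (h : 'rV[R]_n -> R) D x : (forall y, 0 <= h y) ->
    (0 <= ((fun y => (h y)%:E) \_ D) x)%E.
  by move=> h0; apply: erestrict_ge0 => y _; rewrite lee_fin.
have mpatch (h : 'rV[R]_n -> \bar R) D : measurable D -> measurable_fun setT h ->
    measurable_fun setT (h \_ D).
  by move=> mD mh; apply/(measurable_restrictT _ mD); exact: measurable_funTS.
have h10 : (0 <= (b1 - a1)^-1%:E :> \bar R)%E by rewrite lee_fin invr_ge0 subr_ge0 ltW.
have h20 : (0 <= (b2 - a2)^-1%:E :> \bar R)%E by rewrite lee_fin invr_ge0 subr_ge0 ltW.
rewrite !(integral_mkcond B1) !(integral_mkcond B2) !(integral_mkcond B).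
rewrite -!ge0_integralZl//; first last.
- by move=> x _; apply: patch0.
- exact: mpatch.
- by move=> x _; apply: patch0.
- exact: mpatch.
rewrite -ge0_integralD//; first last.
- exact: mpatch.
- by move=> x _; apply: patch0.
- by apply: measurable_funeM; exact: mpatch.
- by move=> x _; apply: mule_ge0 => //; exact: patch0.
have lineM (h : 'rV[R]_n -> R) D x : measurable D -> measurable_fun setT (fun y => (h y)%:E) ->
    measurable_fun setT (fun t : measurableTypeR R => ((fun y => (h y)%:E) \_ D) (subst_coord i x t)).
  by move=> mD mh; apply: measurableT_comp (measurable_line x); exact: mpatch.
apply: (@integral_le_lines R n i).
- by apply: measurable_funeM; exact: mpatch.
- by apply: emeasurable_funD; [apply: measurable_funeM; exact: mpatch|exact: mpatch].
- by move=> x; apply: mule_ge0 => //; exact: patch0.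
- by move=> x; apply: adde_ge0; [apply: mule_ge0 => //; exact: patch0|exact: patch0].
move=> x.
rewrite ge0_integralZl//; first last.
- by move=> t _; apply: patch0.
- exact: lineM.
rewrite ge0_integralD//; first last.
- exact: lineM.
- by move=> t _; apply: patch0.
- by apply: measurable_funeM; exact: lineM.
- by move=> t _; apply: mule_ge0 => //; exact: patch0.
rewrite ge0_integralZl//; first last.
- by move=> t _; apply: patch0.
- exact: lineM.
rewrite !line_box.
have -> : B = box (subst_coord i a (a ord0 i)) (subst_coord i b (b ord0 i)).
  by rewrite !subst_coord_id.
rewrite line_box; case: asboolP => H; last by rewrite !mule0 adde0.
apply: itv_average_le => //.
- apply: measurableT_comp (measurable_line x).
  by apply: measurable_funD.
- by move=> t; exact: F0.
- by apply: integral_ge0 => t _; rewrite lee_fin.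
have K s t : a ord0 i <= s -> s <= t -> t < b ord0 i ->
    (`|f (subst_coord i x t) - f (subst_coord i x s)|%:E <=
     \int[lam]_(t in `[a ord0 i, b ord0 i[) `|g (subst_coord i x t)|%:E)%E.
  move=> as_ st tb; apply: le_trans (lip1_line_le_integral i L0 fL x st) _.
  apply: ge0_subset_integral => //.
  - apply/measurable_EFinP; apply: measurable_funTS; apply: measurableT_comp => //.
    by apply: measurableT_comp (measurable_line x); exact: measurable_partial fL.
  move=> u; rewrite /= !in_itv/= => /andP[su ut].
  by rewrite (le_trans as_ (ltW su)) (le_lt_trans ut tb).
move=> s t /andP[as1 sb1] /andP[at2 tb2].
have {}K : (`|f (subst_coord i x s) - f (subst_coord i x t)|%:E <=
     \int[lam]_(t in `[a ord0 i, b ord0 i[) `|g (subst_coord i x t)|%:E)%E.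
  have [st|/ltW ts] := leP s t.
    by rewrite distrC; apply: K => //; [apply: le_trans as1|apply: lt_le_trans bb2].
  by apply: K => //; [apply: le_trans at2|apply: lt_le_trans bb1].
apply: (le_trans _ (leeD (lexx _) K)); rewrite -EFinD lee_fin /F.
have := ler_norm (f (subst_coord i x s) - f (subst_coord i x t)); lra.
Qed.
End box_average.

(** In this lemma and the next, [d ^+ k * (d / 2) ^+ (n - k)] is the volume of a box
with [k] sides of length [d] and the others of length [d / 2]. *)
Lemma mixed_volume_succ (R : realType) (d : R) (n k : nat) : (k < n)%N ->
  d ^+ k * (d / 2) ^+ (n - k) = d ^+ k * (d / 2) ^+ (n - k.+1) * (d / 2).
Proof. by move=> kn; rewrite -mulrA -exprSr subnSK. Qed.

Lemma mixed_volume_inv (R : realType) (d : R) (n k : nat) : 0 < d -> (k < n)%N ->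
  (d ^+ k * (d / 2) ^+ (n - k.+1))^-1 <= 2 ^+ n * d / d ^+ n.
Proof.
move=> d0 kn; set m := (n - k.+1)%N; have nE : n = (m + k.+1)%N by rewrite /m subnK.
have -> : d ^+ n = d ^+ k * d ^+ m * d.
  by rewrite nE exprD exprSr mulrA [d ^+ m * _]mulrC.
have dk : 0 < d ^+ k by rewrite exprn_gt0.
have dm : 0 < d ^+ m by rewrite exprn_gt0.
have tm : 0 < 2 ^+ m :> R by rewrite exprn_gt0.
have -> : 2 ^+ n * d / (d ^+ k * d ^+ m * d) = 2 ^+ n / (d ^+ k * d ^+ m).
  by field; rewrite !gt_eqF.
have -> : (d ^+ k * (d / 2) ^+ m)^-1 = 2 ^+ m / (d ^+ k * d ^+ m).
  by rewrite expr_div_n; field; rewrite !gt_eqF.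
apply: ler_wpM2r; first by rewrite invr_ge0 mulr_ge0 ?ltW.
by apply: ler_weXn2l; [rewrite ler1n|rewrite nE leq_addr].
Qed.

Section cube_average.
Context (R : realType) (n : nat) (f : 'rV[R]_n -> R) (L c : R).
Hypotheses (L0 : 0 < L) (fL : lip1 L f) (fc : forall x, `|f x| <= c).
Local Notation mu := (lebesgue_rV R n).
Local Notation cube jm := (@dyadic_cube R n jm.1 jm.2).
Local Notation E := {ffun 'I_n -> bool}.
Implicit Types (jm : int * 'rV[int]_n) (e : E).
Let F x := f x + c.

Let F0 x : 0 <= F x.
Proof. by have := fc x; rewrite ler_norml /F => /andP[h _]; lra. Qed.

Let F2c x : F x <= c + c.
Proof. by have := fc x; rewrite ler_norml /F => /andP[_ h]; lra. Qed.

Let mF : measurable_fun setT (fun x => (F x)%:E).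
Proof.
by apply/measurable_EFinP; apply: measurable_funD => //; exact: measurable_lip1 L0 fL.
Qed.

(** The average of [f], computed through the nonnegative function [f + c]. *)
Definition cube_average jm : R :=
  fine (\int[mu]_(x in cube jm) (F x)%:E) / dyadic_side R jm.1 ^+ n - c.

Let int_fin (a b : 'rV[R]_n) : (forall i, a ord0 i <= b ord0 i) ->
  (\int[mu]_(x in box a b) (F x)%:E)%E \is a fin_num.
Proof.
move=> ab; rewrite ge0_fin_numE; last by apply: integral_ge0 => x _; rewrite lee_fin.
apply: (@le_lt_trans _ _ (\int[mu]_(x in box a b) (cst (c + c)%:E x))%E).
  apply: ge0_le_integral; first exact: measurable_box.
  - by move=> x _; rewrite lee_fin.
  - exact: measurable_funTS.
  - exact: measurable_cst.
  - by move=> x _; rewrite lee_fin.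
rewrite integral_cst; last exact: measurable_box.
by rewrite [X in (_ * X)%E](lebesgue_rV_box ab) -EFinM ltry.
Qed.

Let side_mid k jm e : let d := dyadic_side R jm.1 in
  [/\ d * (jm.2 ord0 k)%:~R <= dyadic_side R (child e jm).1 * ((child e jm).2 ord0 k)%:~R,
   dyadic_side R (child e jm).1 * ((child e jm).2 ord0 k)%:~R <
   dyadic_side R (child e jm).1 * (((child e jm).2 ord0 k)%:~R + 1) &
   dyadic_side R (child e jm).1 * (((child e jm).2 ord0 k)%:~R + 1) <=
   d * ((jm.2 ord0 k)%:~R + 1)].
Proof.
move=> d; have d0 : 0 < d by exact: dyadic_side_gt0.
rewrite /= dyadic_side_succ -/d mxE intrD intrM.
set m := (jm.2 ord0 k)%:~R : R.
by case: (e k) => /=; split; nra.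
Qed.

(** The child is enlarged to its parent one coordinate at a time: the box [lo k],
[up k] has the sides of the parent in the first [k] directions and those of the
child in the others, and consecutive boxes differ by two slabs in one direction. *)
Lemma child_average jm e (X : R) :
  (forall i, (\int[mu]_(x in cube jm) `|partial f i x|%:E <= X%:E)%E) ->
  `|cube_average (child e jm) - cube_average jm| <=
    n%:R * 2 ^+ n * (dyadic_side R jm.1 * (X / dyadic_side R jm.1 ^+ n)).
Proof.
move=> gX; set d := dyadic_side R jm.1; have d0 : 0 < d by exact: dyadic_side_gt0.
pose A i := d * (jm.2 ord0 i)%:~R; pose B i := d * ((jm.2 ord0 i)%:~R + 1).
pose a i := dyadic_side R (child e jm).1 * ((child e jm).2 ord0 i)%:~R.
pose b i := dyadic_side R (child e jm).1 * (((child e jm).2 ord0 i)%:~R + 1).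
have [Aa ab bB] : [/\ forall i, A i <= a i, forall i, a i < b i & forall i, b i <= B i].
  by split=> i; have [? ? ?] := side_mid i jm e.
pose lo k : 'rV[R]_n := \row_i (if (i < k)%N then A i else a i).
pose up k : 'rV[R]_n := \row_i (if (i < k)%N then B i else b i).
have bad i : b i - a i = d / 2.
  by rewrite /a /b /= dyadic_side_succ mulrDr mulr1 addrC addKr.
have BAd i : B i - A i = d by rewrite /A /B mulrDr mulr1 addrC addKr.
have AB i : A i < B i by rewrite -subr_gt0 BAd.
pose avg k := fine (\int[mu]_(x in box (lo k) (up k)) (F x)%:E) / (d ^+ k * (d / 2) ^+ (n - k)).
have lu k i : lo k ord0 i <= up k ord0 i.
  by rewrite !mxE; case: ifP => _; apply: ltW.
have avg0 : avg 0%N = cube_average (child e jm) + c.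
  rewrite /avg /cube_average subrK expr0 mul1r subn0 /= dyadic_side_succ -/d.
  by congr (fine (integral _ _ _) / _).
have avgn : avg n = cube_average jm + c.
  rewrite /avg /cube_average subrK subnn expr0 mulr1.
  congr (fine (integral _ _ _) / _); rewrite /dyadic_cube; congr box; apply/rowP => i.
    by rewrite !mxE ltn_ord.
  by rewrite !mxE ltn_ord.
pose K := 2 ^+ n * (d * (X / d ^+ n)).
have step k : (k < n)%N -> `|avg k - avg k.+1| <= K.
  move=> kn; pose i := Ordinal kn.
  have loS : lo k.+1 = subst_coord i (lo k) (A i).
    apply/rowP => j; rewrite !mxE ltnS [(j <= k)%N]leq_eqVlt -val_eqE /=.
    by case: eqP => //= jk; have -> : j = i by exact: val_inj.
  have upS : up k.+1 = subst_coord i (up k) (B i).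
    apply/rowP => j; rewrite !mxE ltnS [(j <= k)%N]leq_eqVlt -val_eqE /=.
    by case: eqP => //= jk; have -> : j = i by exact: val_inj.
  have loE : lo k = subst_coord i (lo k.+1) (a i).
    apply/rowP => j; rewrite !mxE ltnS [(j <= k)%N]leq_eqVlt -val_eqE /=.
    by case: eqP => //= jk; rewrite jk ltnn; have -> : j = i by exact: val_inj.
  have upE : up k = subst_coord i (up k.+1) (b i).
    apply/rowP => j; rewrite !mxE ltnS [(j <= k)%N]leq_eqVlt -val_eqE /=.
    by case: eqP => //= jk; rewrite jk ltnn; have -> : j = i by exact: val_inj.
  have loS' : lo k.+1 = subst_coord i (lo k.+1) (A i).
    apply/rowP => j; rewrite !mxE; case: eqP => // ->; by rewrite /= ltnS leqnn.
  have upS' : up k.+1 = subst_coord i (up k.+1) (B i).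
    apply/rowP => j; rewrite !mxE; case: eqP => // ->; by rewrite /= ltnS leqnn.
  have loi : lo k.+1 ord0 i = A i by rewrite mxE ltnS leqnn.
  have upi : up k.+1 ord0 i = B i by rewrite mxE ltnS leqnn.
  have gbox : (\int[mu]_(x in box (lo k.+1) (up k.+1)) `|partial f i x|%:E <= X%:E)%E.
    apply: le_trans (gX i); apply: ge0_subset_integral.
    - exact: measurable_box.
    - exact: measurable_dyadic.
    - apply/measurable_EFinP; apply: measurable_funTS; apply: measurableT_comp => //.
      exact: measurable_partial fL.
    - by move=> x _; rewrite lee_fin.
    move=> x Hx j; have := Hx j; rewrite !mxE -/d; case: ifP => // _ /andP[h1 h2].
    by rewrite (le_trans (Aa j) h1) (lt_le_trans h2 (bB j)).
  have up1 := int_fin (lu k); have up2 := int_fin (lu k.+1).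
  pose D := d ^+ k * (d / 2) ^+ (n - k.+1).
  have D0 : 0 < D by rewrite mulr_gt0 ?exprn_gt0 ?divr_gt0.
  have D1 : d ^+ k * (d / 2) ^+ (n - k) = D * (d / 2).
    exact: mixed_volume_succ.
  have D2 : d ^+ k.+1 * (d / 2) ^+ (n - k.+1) = D * d.
    by rewrite /D exprSr mulrAC.
  have Aai : lo k.+1 ord0 i <= a i by rewrite loi.
  have bBi : b i <= up k.+1 ord0 i by rewrite upi.
  have AAi : lo k.+1 ord0 i <= A i by rewrite loi.
  have BBi : B i <= up k.+1 ord0 i by rewrite upi.
  have P1 := @box_average_le R n f L c i L0 fL F0 (lo k.+1) (up k.+1) (a i) (b i) (A i) (B i)
    (ab i) (AB i) Aai bBi AAi BBi.
  have P2 := @box_average_le R n f L c i L0 fL F0 (lo k.+1) (up k.+1) (A i) (B i) (a i) (b i)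
    (AB i) (ab i) AAi BBi Aai bBi.
  rewrite -loE -upE -loS' -upS' bad BAd in P1 P2.
  have {}P1 := le_trans P1 (leeD (lexx _) gbox).
  have {}P2 := le_trans P2 (leeD (lexx _) gbox).
  rewrite -(fineK up1) -(fineK up2) -!EFinM -!EFinD !lee_fin in P1 P2.
  rewrite /avg D1 D2.
  move: P1 P2; set I1 := fine _; set I2 := fine _ => P1 P2.
  have X0 : 0 <= X.
    by rewrite -lee_fin; apply: le_trans (gX i); apply: integral_ge0 => x _; rewrite lee_fin.
  have -> : I1 / (D * (d / 2)) - I2 / (D * d) = ((d / 2)^-1 * I1 - d^-1 * I2) / D.
    by field; rewrite !gt_eqF.
  rewrite normrM (ger0_norm (_ : 0 <= D^-1)) ?invr_ge0 ?(ltW D0)//.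
  apply: (@le_trans _ _ (X / D)).
    by rewrite ler_pM2r ?invr_gt0// ler_norml; apply/andP; split; lra.
  rewrite /K.
  have -> : 2 ^+ n * (d * (X / d ^+ n)) = X * (2 ^+ n * d / d ^+ n) by ring.
  apply: ler_wpM2l => //.
  exact: mixed_volume_inv.
(* Telescoping over the [n] enlargements. *)
have H k : (k <= n)%N -> `|avg 0%N - avg k| <= k%:R * K.
  elim: k => [|k IH] kn; first by rewrite subrr normr0 mul0r.
  rewrite (_ : _ - _ = (avg 0%N - avg k) + (avg k - avg k.+1)); last by ring.
  apply: (le_trans (ler_normD _ _)); rewrite -natr1 mulrDl mul1r.
  by apply: lerD; [exact/IH/ltnW|exact: step].
have := H n (leqnn n); rewrite avg0 avgn /K mulrA.
by rewrite (_ : _ + c - _ = cube_average (child e jm) - cube_average jm)//; ring.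
Qed.
End cube_average.

(** * The chain of averages below a cube *)

(** The superadditivity of the power [b^-1], read backwards. *)
Lemma powR_subadd (R : realType) (b x y : R) : 0 < b -> b <= 1 -> 0 <= x -> 0 <= y ->
  (x + y) `^ b <= x `^ b + y `^ b.
Proof.
move=> b0 b1 x0 y0; have bi1 : 1 <= b^-1 by rewrite invf_ge1.
have bb : b * b^-1 = 1 by rewrite divff// gt_eqF.
have := powR_superadd bi1 (powR_ge0 x b) (powR_ge0 y b).
rewrite -!powRrM bb !powRr1// => h.
have := ge0_ler_powR (ltW b0) _ _ h; rewrite !nnegrE => {}h.
have {h} := h (addr_ge0 x0 y0) (powR_ge0 _ _).
by rewrite -[X in _ <= X -> _]powRrM mulVf ?gt_eqF// powRr1// addr_ge0 ?powR_ge0.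
Qed.

Section chain.
Context (R : realType) (n : nat) (f rho G : 'rV[R]_n -> R) (L c b : R)
  (jm : int * 'rV[int]_n).
Hypotheses (L0 : 0 < L) (fL : lip1 L f) (fc : forall x, `|f x| <= c).
Hypotheses (mrho : measurable_fun setT rho) (rho0 : forall x, 0 <= rho x).
Hypothesis (G0 : forall x, 0 <= G x).
Hypotheses (b0 : 0 < b) (b1 : b <= 1).
Local Notation mu := (lebesgue_rV R n).
Local Notation cube jm := (@dyadic_cube R n jm.1 jm.2).
Local Notation E := {ffun 'I_n -> bool}.
Implicit Types (e : E) (s : seq E).

Definition subcube s := cube (descendant jm s).
Definition side s := dyadic_side R (descendant jm s).1.
Definition mass h s : R := fine (\int[mu]_(x in subcube s) (h x)%:E).

Lemma mass_ge0 h s : (forall x, 0 <= h x) -> 0 <= mass h s.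
Proof. by move=> h0; rewrite fine_ge0// integral_ge0// => x _; rewrite lee_fin. Qed.

Lemma side_gt0 s : 0 < side s. Proof. exact: dyadic_side_gt0. Qed.

Lemma side_cons e s : side (e :: s) = side s / 2.
Proof. exact: dyadic_side_succ. Qed.

Lemma measurable_subcube s : measurable (subcube s).
Proof. exact: measurable_dyadic. Qed.

Lemma mass_fin (h : 'rV[R]_n -> R) s : measurable_fun setT h -> (forall x, 0 <= h x) ->
  (\int[mu]_(x in cube jm) (h x)%:E < +oo)%E ->
  (\int[mu]_(x in subcube s) (h x)%:E)%E \is a fin_num.
Proof.
move=> mh h0 hoo; have h0' x : (0 <= (h x)%:E)%E by rewrite lee_fin.
rewrite ge0_fin_numE ?integral_ge0//; apply: le_lt_trans hoo.
apply: ge0_subset_integral => //; [exact: measurable_subcube|exact: measurable_dyadic| |].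
  by apply/measurable_EFinP; exact: measurable_funTS.
exact: descendant_sub.
Qed.

Lemma mass_cons (h : 'rV[R]_n -> R) s : measurable_fun setT h -> (forall x, 0 <= h x) ->
  (\int[mu]_(x in cube jm) (h x)%:E < +oo)%E ->
  mass h s = \sum_e mass h (e :: s).
Proof.
move=> mh h0 hoo; rewrite /mass /subcube integral_dyadic//.
- by rewrite -sum_fine// => e _; exact: (mass_fin (e :: s)).
- by apply/measurable_EFinP.
Qed.

Hypothesis rhooo : (\int[mu]_(x in cube jm) (rho x)%:E < +oo)%E.
Hypothesis GX : forall s i,
  (\int[mu]_(x in subcube s) `|partial f i x|%:E <= (mass G s)%:E)%E.

Let A s := cube_average f c (descendant jm s).
Let K := n%:R * 2 ^+ n : R.
Let psi s := (side s * (mass G s / side s ^+ n)) `^ b * mass rho s.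
Let mf : measurable_fun setT f := measurable_lip1 L0 fL.

Let oscillation s x : subcube s x -> `|f x - A s| <= n%:R * L * side s.
Proof.
move=> sx; set d := side s; have d0 : 0 < d by exact: side_gt0.
have osc y : subcube s y -> `|f x - f y| <= n%:R * L * d.
  move=> sy; rewrite (le_trans (fL _ _))// -mulrA mulrCA ler_pM2l//.
  rewrite -[n%:R]/(1 *+ n) -[X in 1 *+ X](card_ord n) mulrnAl mul1r -sumr_const.
  apply: ler_sum => i _.
  have := sx i; have := sy i; rewrite !mxE mulrDr mulr1 -/(side s) -/d.
  move=> /andP[? ?] /andP[? ?]; rewrite ler_norml; apply/andP; split; lra.
set o := n%:R * L * d in osc *.
have F0 y : 0 <= f y + c by have := fc y; rewrite ler_norml => /andP[h _]; lra.
have o0 : 0 <= o by rewrite /o !mulr_ge0// ltW.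
have mQ := measurable_subcube s.
have muQ : mu (subcube s) = (d ^+ n)%:E by exact: mu_dyadic.
have mF : measurable_fun setT (fun y => (f y + c)%:E).
  by apply/measurable_EFinP; apply: measurable_funD.
have mFo : measurable_fun setT (fun y => (f y + c + o)%:E).
  by apply/measurable_EFinP; apply: measurable_funD => //; exact: measurable_funD.
have int_cst (a : R) : (\int[mu]_(y in subcube s) a%:E = (a * d ^+ n)%:E)%E.
  rewrite -[LHS]/(\int[mu]_(y in subcube s) cst a%:E y)%E integral_cst//.
  by rewrite [X in (_ * X)%E]muQ -EFinM.
have U : (\int[mu]_(y in subcube s) (f y + c)%:E <= ((f x + c + o) * d ^+ n)%:E)%E.
  rewrite -int_cst; apply: ge0_le_integral => //.
  - by move=> y _; rewrite lee_fin.
  - exact: measurable_funTS.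
  move=> y sy; rewrite lee_fin; have := osc y sy.
  by rewrite ler_norml => /andP[? ?]; lra.
have D : (((f x + c) * d ^+ n)%:E <= \int[mu]_(y in subcube s) (f y + c)%:E + (o * d ^+ n)%:E)%E.
  rewrite -!int_cst -ge0_integralD//; first last.
  - exact: measurable_funTS.
  - by move=> y _; rewrite lee_fin.
  apply: ge0_le_integral => //.
  - by move=> y _; rewrite lee_fin.
  - by rewrite -[X in measurable_fun _ X]/(fun y => (f y + c + o)%:E); exact: measurable_funTS.
  move=> y sy; rewrite -EFinD lee_fin; have := osc y sy.
  by rewrite ler_norml => /andP[? ?]; lra.
have fin : (\int[mu]_(y in subcube s) (f y + c)%:E)%E \is a fin_num.
  rewrite ge0_fin_numE ?(le_lt_trans U) ?ltry//.
  by apply: integral_ge0 => y _; rewrite lee_fin.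
rewrite /A /cube_average -/(subcube s) -/(side s) -/d.
move: U D; rewrite -(fineK fin) -EFinD !lee_fin; set I := fine _ => U D.
have dn0 : 0 < d ^+ n by rewrite exprn_gt0.
have U' : I / d ^+ n <= f x + c + o by rewrite ler_pdivrMr.
have D' : f x + c <= I / d ^+ n + o.
  by rewrite -(ler_pM2r dn0) [leRHS]mulrDl divfK// gt_eqF.
by rewrite /= ler_norml; apply/andP; split; lra.
Qed.

Let J s := (\int[mu]_(x in subcube s) (`|f x - A s| `^ b * rho x)%:E)%E.

Let mJ (a : R) : measurable_fun setT (fun x => (`|f x - a| `^ b * rho x)%:E).
Proof.
apply/measurable_EFinP; apply: measurable_funM => //.
apply: measurable_power.
by apply: measurableT_comp => //; exact: measurable_funB.
Qed.

Let J0 (a : R) x : (0 <= (`|f x - a| `^ b * rho x)%:E)%E.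
Proof. by rewrite lee_fin mulr_ge0 ?powR_ge0. Qed.

Let massE s : (\int[mu]_(x in subcube s) (rho x)%:E)%E = (mass rho s)%:E.
Proof. by rewrite fineK//; exact: mass_fin. Qed.

(** The triangle inequality for the [b]-th power of the distance, which is where
[b <= 1] is used. *)
Let shift_average s (a a' : R) :
  (\int[mu]_(x in subcube s) (`|f x - a| `^ b * rho x)%:E <=
   \int[mu]_(x in subcube s) (`|f x - a'| `^ b * rho x)%:E
   + (`|a' - a| `^ b * mass rho s)%:E)%E.
Proof.
have mQ := measurable_subcube s.
have mr : measurable_fun setT (fun x => (rho x)%:E) by exact/measurable_EFinP.
rewrite EFinM -massE -ge0_integralZl//; first last.
- by move=> x _; rewrite lee_fin.
- exact: measurable_funTS.
rewrite -ge0_integralD//; first last.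
- by apply: measurable_funTS; exact: measurable_funeM.
- by move=> x _; apply: mule_ge0; rewrite lee_fin ?powR_ge0.
- exact: measurable_funTS.
apply: ge0_le_integral => //.
- exact: measurable_funTS.
- by apply: measurable_funTS; apply: emeasurable_funD => //; exact: measurable_funeM.
move=> x _; rewrite -EFinM -EFinD lee_fin -mulrDl ler_wpM2r//.
apply: le_trans (powR_subadd b0 b1 (normr_ge0 _) (normr_ge0 _)).
apply: ge0_ler_powR; rewrite ?nnegrE ?(ltW b0) ?addr_ge0//.
by rewrite (_ : f x - a = (f x - a') + (a' - a)) ?ler_normD//; ring.
Qed.

Let child_shift e s : `|A (e :: s) - A s| <= K * (side s * (mass G s / side s ^+ n)).
Proof. by apply: (child_average L0 fL fc) => i; exact: GX. Qed.

Let child_shiftb e s : `|A (e :: s) - A s| `^ b * mass rho (e :: s) <=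
  K `^ b * ((side s * (mass G s / side s ^+ n)) `^ b * mass rho (e :: s)).
Proof.
have K0 : 0 <= K by rewrite mulr_ge0.
have t0 : 0 <= side s * (mass G s / side s ^+ n).
  by rewrite mulr_ge0 ?divr_ge0 ?mass_ge0 ?exprn_ge0 ?(ltW (side_gt0 s)).
rewrite mulrA ler_wpM2r ?mass_ge0// -powRM//.
by apply: ge0_ler_powR; rewrite ?nnegrE ?(ltW b0)// mulr_ge0.
Qed.

(** Induction on the depth [N]: the integral over a cube is split over its
children, the average [A s] is replaced by the average over each child, and the
masses of [rho] of the children add up.  At depth [0] the oscillation of the
Lipschitz function is the only contribution. *)
Let chain_rec N s : (J s <=
  (K `^ b * tsum N psi s + (n%:R * L * side s / 2 ^+ N) `^ b * mass rho s)%:E)%E.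
Proof.
elim: N s => [|N IH] s.
  rewrite tsum0 mulr0 add0r expr0 divr1.
  have mr : measurable_fun setT (fun x => (rho x)%:E) by exact/measurable_EFinP.
  rewrite EFinM -massE -ge0_integralZl//; first last.
  - by rewrite lee_fin powR_ge0.
  - by move=> x _; rewrite lee_fin.
  - exact: measurable_funTS.
  - exact: measurable_subcube.
  apply: ge0_le_integral => //.
  - exact: measurable_subcube.
  - exact: measurable_funTS.
  - by apply: measurable_funTS; exact: measurable_funeM.
  move=> x sx; rewrite -EFinM lee_fin ler_wpM2r//.
  apply: ge0_ler_powR; rewrite ?nnegrE ?(ltW b0)//; last exact: oscillation.
  by rewrite !mulr_ge0// ltW// side_gt0.
rewrite /J /subcube integral_dyadic//.
apply: (@le_trans _ _ (\sum_e (J (e :: s) + (`|A (e :: s) - A s| `^ b * mass rho (e :: s))%:E))%E).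
  by apply: lee_sum => e _; exact: (shift_average (e :: s)).
apply: (@le_trans _ _ (\sum_e ((K `^ b * tsum N psi (e :: s) +
    (n%:R * L * side (e :: s) / 2 ^+ N) `^ b * mass rho (e :: s)) +
    K `^ b * ((side s * (mass G s / side s ^+ n)) `^ b * mass rho (e :: s)))%:E)%E).
  by apply: lee_sum => e _; rewrite [X in (_ <= X)%E]EFinD; apply: leeD; rewrite ?lee_fin.
rewrite sumEFin lee_fin !big_split/= -!mulr_sumr tsumS /psi -/psi.
have cE : mass rho s = \sum_e mass rho (e :: s) by exact: mass_cons.
rewrite -cE [in leRHS]mulrDr.
have -> : \sum_e (n%:R * L * side (e :: s) / 2 ^+ N) `^ b * mass rho (e :: s) =
    (n%:R * L * side s / 2 ^+ N.+1) `^ b * mass rho s.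
  rewrite cE mulr_sumr; apply: eq_bigr => e _; congr (_ `^ _ * _).
  by rewrite side_cons exprS invfM; ring.
by rewrite le_eqVlt; apply/orP; left; apply/eqP; ring.
Qed.

(** Vanishing of [f] on a child makes one average zero, so [A [::]] is bounded by
the cost of a single step; this is where the factor [2] comes from. *)
Lemma chain_estimate (e0 : E) N : (0 < N)%N -> (forall x, subcube [:: e0] x -> f x = 0) ->
  (\int[mu]_(x in cube jm) (`|f x| `^ b * rho x)%:E <=
  (2 * K `^ b * tsum N psi [::]
   + (n%:R * L * side [::] / 2 ^+ N) `^ b * mass rho [::])%:E)%E.
Proof.
move=> N0 fe0.
have A0 : A [:: e0] = 0.
  rewrite /A /cube_average -/(subcube [:: e0]) -/(side [:: e0]); set d := side _.
  have dn0 : d ^+ n != 0 by rewrite expf_neq0// gt_eqF// side_gt0.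
  have -> : (\int[mu]_(x in subcube [:: e0]) (f x + c)%:E = (c * d ^+ n)%:E)%E.
    rewrite (eq_integral (cst c%:E)) => [|x]; last first.
      by rewrite inE => /fe0 ->; rewrite add0r.
    rewrite integral_cst; last exact: measurable_subcube.
    by rewrite [X in (_ * X)%E]mu_dyadic -EFinM.
  by rewrite /= mulfK// subrr.
have := shift_average [::] 0 (A [::]).
under eq_integral do rewrite subr0.
move=> /le_trans; apply; apply: (le_trans (leeD (chain_rec N [::]) (lexx _))).
rewrite -EFinD lee_fin subr0.
have Ab : `|A [::]| `^ b * mass rho [::] <= K `^ b * psi [::].
  have K0 : 0 <= K by rewrite mulr_ge0.
  have t0 : 0 <= side [::] * (mass G [::] / side [::] ^+ n).
    by rewrite mulr_ge0 ?divr_ge0 ?mass_ge0 ?exprn_ge0 ?(ltW (side_gt0 _)).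
  rewrite /psi mulrA ler_wpM2r ?mass_ge0// -powRM//.
  have Kt0 := mulr_ge0 K0 t0.
  apply: ge0_ler_powR; rewrite ?nnegrE ?(ltW b0)//.
  by have := child_shift e0 [::]; rewrite A0 sub0r normrN.
have psi_le : psi [::] <= tsum N psi [::].
  case: N N0 => // N _; rewrite tsumS lerDl; apply: sumr_ge0 => e _.
  by apply: tsum_ge0 => s; rewrite mulr_ge0 ?powR_ge0 ?mass_ge0.
have : K `^ b * psi [::] <= K `^ b * tsum N psi [::] by rewrite ler_wpM2l ?powR_ge0.
lra.
Qed.
End chain.

(** Hoelder's inequality on the whole space, for the functions set to zero outside
[D]. *)
Lemma integral_hoelder d (T : measurableType d) (R : realType)
    (mu : {measure set T -> \bar R}) (D : set T) (h k : T -> R) (a b : R) :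
  measurable D -> measurable_fun setT h -> measurable_fun setT k ->
  (forall x, 0 <= h x) -> (forall x, 0 <= k x) ->
  0 < a -> 0 < b -> a^-1 + b^-1 = 1 ->
  (\int[mu]_(x in D) (h x * k x)%:E <=
   (\int[mu]_(x in D) (h x `^ a)%:E) `^ a^-1 *
   (\int[mu]_(x in D) (k x `^ b)%:E) `^ b^-1)%E.
Proof.
move=> mD mh mk h0 k0 a0 b0 ab.
have mr (u : T -> R) : measurable_fun setT u -> measurable_fun setT (u \_ D).
  by move=> mu'; apply/(measurable_restrictT _ mD); exact: measurable_funTS.
have := hoelder mu (mr _ mh) (mr _ mk) a0 b0 ab.
have NE (u : T -> R) (e : R) : 0 < e -> (forall x, 0 <= u x) ->
    (\int[mu]_x `|(EFin \o (u \_ D)) x| `^ e = \int[mu]_(x in D) (u x `^ e)%:E)%E.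
  move=> e0 u0; rewrite [RHS]integral_mkcond; apply: eq_integral => x _.
  rewrite /= !patchE; case: ifPn => _ /=; first by rewrite ger0_norm.
  by rewrite normr0 powR0// gt_eqF.
rewrite [X in (X <= _)%E -> _]Lnorm1 unlock /Lnorm !NE//; apply: le_trans.
rewrite [leLHS]integral_mkcond le_eqVlt; apply/orP; left; apply/eqP.
apply: eq_integral => x _ /=; rewrite !patchE; case: ifPn => _ /=.
  by rewrite ger0_norm// mulr_ge0.
by rewrite mul0r normr0.
Qed.

Lemma geometric_error (R : realType) (c b V x y : R) : 0 <= c -> 0 < b -> 0 <= V ->
  (forall N, (0 < N)%N -> x <= y + (c / 2 ^+ N) `^ b * V) -> x <= y.
Proof.
move=> c0 b0 V0 H; apply/ler_addgt0Pr => e e0.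
have q0 : 0 < 2 `^ (- b) :> R by rewrite powR_gt0.
have q1 : 2 `^ (- b) < 1 :> R.
  by rewrite powRN invf_lt1 ?powR_gt0// powR2_gt1.
have cv : (c `^ b * V) * (2 `^ (- b)) ^+ N @[N --> \oo] --> (0 : R).
  rewrite -[X in _ --> X](mulr0 (c `^ b * V)).
  by apply: cvgMr; apply: cvg_expr; rewrite gtr0_norm.
have [N _ HN] : \forall N \near \oo, (c `^ b * V) * (2 `^ (- b)) ^+ N < e.
  exact: cvgr_lt cv _ e0.
apply: (le_trans (H N.+1 isT)); rewrite lerD2l.
apply: le_trans (ltW (HN N.+1 (leqnSn N))).
have dyadicE m : (c / 2 ^+ m) `^ b = c `^ b * (2 `^ (- b)) ^+ m.
  rewrite powRM ?invr_ge0 ?exprn_ge0//; congr (_ * _).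
  rewrite -(powR_mulrn m (ler0n R 2)) -powRN -powRrM -(powR_mulrn m (powR_ge0 2 (- b))).
  by rewrite -powRrM mulNr -mulrN mulrC.
rewrite (dyadicE N.+1).
by rewrite mulrAC.
Qed.

(** * Sparse sums of dyadic averages *)

Lemma conjugate_exponent (R : realType) (a : R) : 1 < a -> a^-1 + (a / (a - 1))^-1 = 1.
Proof.
move=> a1; have a0 : a != 0 by rewrite gt_eqF// (lt_trans ltr01).
by rewrite invf_div -[X in X + _]mul1r -mulrDl addrC subrK divff.
Qed.

Section dyadic_masses.
Context (R : realType) (n : nat) (jm : int * 'rV[int]_n).
Local Notation lam := (lebesgue_rV R n).
Local Notation cube jm := (@dyadic_cube R n jm.1 jm.2).
Local Notation E := {ffun 'I_n -> bool}.
Local Notation mass := (mass jm).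
Implicit Types (e : E) (s : seq E) (h k : 'rV[R]_n -> R).

Definition volume s : R := side R jm s ^+ n.

Lemma volume_gt0 s : 0 < volume s. Proof. by rewrite exprn_gt0// side_gt0. Qed.

Lemma volume_cons s : volume s = \sum_e volume (e :: s).
Proof.
transitivity (\sum_(e : E) volume s / 2 ^+ n).
  rewrite sumr_const card_ffun card_bool card_ord -[_ *+ (2 ^ n)%N]mulr_natr natrX divfK//.
by apply: eq_bigr => e _; rewrite /volume side_cons expr_div_n.
Qed.

Lemma mu_subcube s : lam (subcube jm s) = (volume s)%:E.
Proof. exact: mu_dyadic. Qed.

Definition integrable_on_top h := (\int[lam]_(x in cube jm) (h x)%:E < +oo)%E.

Lemma mass_hoelder h k (a b : R) s :
  measurable_fun setT h -> measurable_fun setT k ->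
  (forall x, 0 <= h x) -> (forall x, 0 <= k x) ->
  0 < a -> 0 < b -> a^-1 + b^-1 = 1 ->
  integrable_on_top (fun x => h x `^ a) -> integrable_on_top (fun x => k x `^ b) ->
  mass (fun x => h x * k x) s / volume s <=
  (mass (fun x => h x `^ a) s / volume s) `^ a^-1 *
  (mass (fun x => k x `^ b) s / volume s) `^ b^-1.
Proof.
move=> mh mk h0 k0 a0 b0 ab ih ik.
have fh := mass_fin s (measurable_power a mh) (fun x => powR_ge0 (h x) a) ih.
have fk := mass_fin s (measurable_power b mk) (fun x => powR_ge0 (k x) b) ik.
have := integral_hoelder lam (measurable_subcube jm s) mh mk h0 k0 a0 b0 ab.
rewrite -(fineK fh) -(fineK fk) !poweR_EFin -EFinM => H.
have fhk : (\int[lam]_(x in subcube jm s) (h x * k x)%:E)%E \is a fin_num.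
  rewrite ge0_fin_numE ?(le_lt_trans H) ?ltry//.
  by apply: integral_ge0 => x _; rewrite lee_fin mulr_ge0.
move: H; rewrite -(fineK fhk) lee_fin -/(mass (fun x => h x * k x) s).
rewrite -/(mass (fun x => h x `^ a) s) -/(mass (fun x => k x `^ b) s).
have v0 := volume_gt0 s; have vi0 : 0 <= (volume s)^-1 by rewrite invr_ge0 ltW.
rewrite !powRM ?mass_ge0// => [H||]; try by move=> x; exact: powR_ge0.
rewrite mulrACA -powRD; last by rewrite ab oner_eq0.
by rewrite ab powRr1// ler_wpM2r.
Qed.

(** Hoelder's inequality against the constant [1], on a cube of finite measure. *)
Lemma integrable_power h (e0 e1 : R) : measurable_fun setT h -> (forall x, 0 <= h x) ->
  0 < e0 -> e0 < e1 -> integrable_on_top (fun x => h x `^ e1) ->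
  integrable_on_top (fun x => h x `^ e0).
Proof.
move=> mh h0 e00 e01 ih; have e10 := lt_trans e00 e01.
have a1 : 1 < e1 / e0 by rewrite ltr_pdivlMr// mul1r.
have am : 0 < e1 / e0 - 1 by rewrite subr_gt0.
have a0 := lt_trans ltr01 a1.
have mp (th : R) : measurable_fun setT (fun x => h x `^ th).
  exact: measurable_power.
have mc1 : measurable_fun setT (cst 1 : 'rV[R]_n -> R) by exact: measurable_cst.
have := @integral_hoelder _ _ R lam (cube jm) _ (cst 1) (e1 / e0) (e1 / e0 / (e1 / e0 - 1))
  (measurable_dyadic jm) (mp e0) mc1 (fun x => powR_ge0 _ _)
  (fun=> ler01) a0 (divr_gt0 a0 am).
move=> /(_ (conjugate_exponent a1)).
under eq_integral do rewrite mulr1.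
under [X in (_ <= X `^ _ * _)%E -> _]eq_integral do rewrite -powRrM mulrC divfK ?gt_eqF//.
move=> /le_lt_trans; apply; apply: lte_mul_pinfty.
- exact: poweR_ge0.
- rewrite ge0_fin_numE ?poweR_ge0//; apply: poweR_lty => //.
apply: poweR_lty.
rewrite (eq_integral (cst 1%E)) => [|x _]; last by rewrite /= powR1.
by rewrite integral_cst ?mul1e; [rewrite [X in (X < _)%E]mu_dyadic ltry|exact: measurable_dyadic].
Qed.

(** The power means of a function over a cube increase with the exponent. *)
Lemma mass_power_mean h (e0 e1 : R) s : measurable_fun setT h -> (forall x, 0 <= h x) ->
  0 < e0 -> e0 < e1 -> integrable_on_top (fun x => h x `^ e1) ->
  volume s * (mass (fun x => h x `^ e0) s / volume s) `^ (e1 / e0) <=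
  mass (fun x => h x `^ e1) s.
Proof.
move=> mh h0 e00 e01 ih; have e10 := lt_trans e00 e01.
have a1 : 1 < e1 / e0 by rewrite ltr_pdivlMr// mul1r.
have am : 0 < e1 / e0 - 1 by rewrite subr_gt0.
have a0 := lt_trans ltr01 a1.
have mp (th : R) : measurable_fun setT (fun x => h x `^ th).
  exact: measurable_power.
have v0 := volume_gt0 s.
have E1 : (fun x => (h x `^ e0) `^ (e1 / e0)) = (fun x => h x `^ e1).
  by apply/funext => x; rewrite -powRrM mulrC divfK ?gt_eqF.
have E2 (b : R) : (fun x : 'rV[R]_n => cst (1 : R) x `^ b) = cst 1.
  by apply/funext => x; rewrite /= powR1.
have i1 : integrable_on_top (cst 1).
  rewrite /integrable_on_top -[X in (X < _)%E]/(\int[lam]_(x in cube jm) cst 1%:E x)%E.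
  rewrite integral_cst ?mul1e; [|exact: measurable_dyadic].
  by rewrite [X in (X < _)%E]mu_dyadic ltry.
have m1 : mass (cst 1) s = volume s.
  rewrite /mass -[X in fine X]/(\int[lam]_(x in subcube jm s) cst 1%:E x)%E.
  rewrite integral_cst; last exact: measurable_subcube.
  by rewrite mul1e [X in fine X]mu_subcube.
have mc1 : measurable_fun setT (cst 1 : 'rV[R]_n -> R) by exact: measurable_cst.
have := @mass_hoelder _ (cst 1) (e1 / e0) (e1 / e0 / (e1 / e0 - 1)) s
   (mp e0) mc1 (fun x => powR_ge0 _ _)
  (fun=> ler01) a0 (divr_gt0 a0 am).
move=> /(_ (conjugate_exponent a1)).
rewrite E1 E2 => /(_ ih i1); rewrite m1 divff ?gt_eqF// powR1 mulr1.
have -> : (fun x => h x `^ e0 * cst 1 x) = (fun x => h x `^ e0).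
  by apply/funext => x; rewrite mulr1.
have M0 (th : R) : 0 <= mass (fun x => h x `^ th) s / volume s.
  by rewrite divr_ge0 ?mass_ge0 ?(ltW v0)// => x; exact: powR_ge0.
move=> H; have := ge0_ler_powR (ltW a0) _ _ H; rewrite !nnegrE => /(_ (M0 _) (powR_ge0 _ _)).
rewrite -[X in _ <= X -> _]powRrM mulVf ?gt_eqF// powRr1// => {}H.
by rewrite mulrC -ler_pdivlMr.
Qed.

Section sparse_masses.
Variable G : 'rV[R]_n -> R.
Hypotheses (mG : measurable_fun setT G) (G0 : forall x, 0 <= G x) (iG : integrable_on_top G).
Local Notation stop := (stop volume (mass G)).
Local Notation stop_mass := (stop_mass volume (mass G)).

(** The Carleson embedding applied to the packing constant [2] of the stopping
cubes, with the mass of [h ^ e1] as supersolution. *)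
Lemma stop_mass_embedding h (e0 e1 : R) N : measurable_fun setT h -> (forall x, 0 <= h x) ->
  0 < e0 -> e0 < e1 -> integrable_on_top (fun x => h x `^ e1) ->
  tsum N (fun s => stop_mass s * (mass (fun x => h x `^ e0) s / volume s) `^ (e1 / e0)) [::]
  <= 3 `^ (e1 / e0) / (e1 / e0 - 1) * mass (fun x => h x `^ e1) [::].
Proof.
move=> mh h0 e00 e01 ih.
have a1 : 1 < e1 / e0 by rewrite ltr_pdivlMr// mul1r.
have mp (th : R) : measurable_fun setT (fun x => h x `^ th).
  exact: measurable_power.
rewrite (_ : 3 = 1 + 2); last by rewrite -natr1 addrC.
apply: (@carleson_embedding R _ volume) => //.
- exact: volume_gt0.
- exact: volume_cons.
- by move=> s; apply: mass_ge0 => x; exact: powR_ge0.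
- move=> s; apply: mass_cons => //; first by move=> x; exact: powR_ge0.
  exact: integrable_power ih.
- by move=> s; rewrite /stop_mass; case: ifP => // _; rewrite ltW// volume_gt0.
- move=> M s; apply: carleson_stop.
  + exact: volume_gt0.
  + by move=> u; exact: mass_ge0.
  + by move=> u; exact: mass_cons.
- by move=> s; exact: mass_power_mean.
- by move=> s; rewrite -mass_cons// => x; exact: powR_ge0.
Qed.

(** The chain estimate holds for every depth [N]; its sum is bounded by the sparse
sum uniformly in [N], and the oscillation term disappears in the limit. *)
Lemma chain_sparse (f rho : 'rV[R]_n -> R) (L c b B : R) (e0 : E) :
  0 < L -> lip1 L f -> (forall x, `|f x| <= c) ->
  measurable_fun setT rho -> (forall x, 0 <= rho x) -> 0 < b -> b <= 1 ->
  integrable_on_top rho ->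
  (forall s i, \int[lam]_(x in subcube jm s) `|partial f i x|%:E <= (mass G s)%:E)%E ->
  (forall x, subcube jm [:: e0] x -> f x = 0) ->
  (forall N, tsum N (fun s => if stop s then
     (side R jm s * (mass G s / volume s)) `^ b * mass rho s else 0) [::] <= B) ->
  (\int[lam]_(x in cube jm) (`|f x| `^ b * rho x)%:E <=
   (2 * (n%:R * 2 ^+ n) `^ b * (4 `^ b / (2 `^ b - 1)) * B)%:E)%E.
Proof.
move=> L0 fL fc mrho rho0 b0 b1 irho GX fe0 HB.
have key N (N0 : (0 < N)%N) := chain_estimate L0 fL fc mrho rho0 G0 b0 b1 irho GX N0 fe0.
have fin : (\int[lam]_(x in cube jm) (`|f x| `^ b * rho x)%:E)%E \is a fin_num.
  rewrite ge0_fin_numE ?(le_lt_trans (key 1%N isT)) ?ltry//.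
  by apply: integral_ge0 => x _; rewrite lee_fin mulr_ge0 ?powR_ge0.
move: key; rewrite -(fineK fin) => key; rewrite lee_fin.
apply: (@geometric_error R (n%:R * L * side R jm [::]) b (mass rho [::])) => //.
- by rewrite !mulr_ge0 ?(ltW L0)// ltW// side_gt0.
- exact: mass_ge0.
move=> N N0; have := key N N0; rewrite lee_fin => /le_trans; apply.
rewrite lerD2r -[leRHS]mulrA ler_wpM2l ?mulr_ge0 ?powR_ge0//.
have sp := @sparse_domination R E volume (mass G) volume_gt0 (fun s => mass_ge0 jm s G0)
   (side R jm) (mass rho) b b0 (side_gt0 R jm) (side_cons R jm)
   (fun s => mass_ge0 jm s rho0) (fun s => mass_cons s mrho rho0 irho) N.
apply: (le_trans sp); rewrite ler_wpM2l//.
by rewrite divr_ge0 ?powR_ge0// subr_ge0 ltW// powR2_gt1.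
Qed.

End sparse_masses.
End dyadic_masses.

(** * Estimates on one cube *)

Lemma conjugate_gt1 (R : realType) (a : R) : 1 < a -> 1 < a / (a - 1).
Proof. by move=> a1; rewrite ltr_pdivlMr ?subr_gt0// mul1r; lra. Qed.

Lemma conjugate_lt (R : realType) (a b : R) : 1 < a -> a < b ->
  b / (b - 1) < a / (a - 1).
Proof.
move=> a1 ab; rewrite ltr_pdivrMr; last by lra.
by rewrite mulrAC ltr_pdivlMr; [nra|lra].
Qed.

Lemma conjugateK (R : realType) (a : R) : 1 < a ->
  (a / (a - 1)) / (a / (a - 1) - 1) = a.
Proof.
move=> a1; have : a - 1 != 0 by rewrite subr_eq0 gt_eqF.
move=> h; field; rewrite h /=; apply/eqP => H; have := oner_neq0 R; apply/negP; rewrite negbK.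
by apply/eqP; rewrite -H; ring.
Qed.

(** The algebra of one summand for [q <= 1].  With [V] the volume, [S] the side
length, [Vp = V ^ (1/p)], [Vq = V ^ (1/q)], [Wk] and [Uk] the power means of the two
weights and [Fs] that of [w G], the powers of the volume cancel and what is left is
the term [wt] of the class constant times [a ^ (1/p)], to the power [q]. *)
Lemma weight_split_le1 (R : realType) (S g m wt a p q Vp Vq Fs Wk Uk : R) :
  0 < q -> 0 <= S -> 0 <= g -> 0 < Vp -> 0 < Vq -> 0 <= Wk -> 0 <= Uk -> 0 <= Fs ->
  g <= Fs * Wk -> m = (Vq * Uk) `^ q -> wt = S / (Vp / Vq) * Wk * Uk ->
  a `^ p^-1 = Vp * Fs ->
  (S * g) `^ q * m <= wt `^ q * a `^ (q / p).
Proof.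
move=> q0 S0 g0 Vp0 Vq0 Wk0 Uk0 Fs0 gF -> -> aE.
have Vp' := ltW Vp0; have Vq' := ltW Vq0.
have Sg0 : 0 <= S * g by exact: mulr_ge0.
have VU0 : 0 <= Vq * Uk by exact: mulr_ge0.
have VF0 : 0 <= Vp * Fs by exact: mulr_ge0.
have wt0 : 0 <= S / (Vp / Vq) * Wk * Uk by rewrite !mulr_ge0 ?invr_ge0 ?divr_ge0.
rewrite [q / p]mulrC powRrM aE -!powRM//.
apply: powR_le2r; [exact: ltW|exact: mulr_ge0|].
apply: (@le_trans _ _ (S * (Fs * Wk) * (Vq * Uk))).
  by rewrite ler_wpM2r ?mulr_ge0// ler_wpM2l.
by rewrite le_eqVlt; apply/orP; left; apply/eqP; field; rewrite !gt_eqF.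
Qed.

(** The same algebra for [1 < q], where the mass [m] is itself split by Hoelder's
inequality into [Uk] and the power mean [Ht] of a second function. *)
Lemma weight_split_gt1 (R : realType) (S g m wt a b V Vp Vq Fs Wk Uk Ht : R) :
  0 <= S -> 0 <= g -> 0 <= m -> 0 < Vp -> 0 < Vq ->
  g <= Fs * Wk -> m <= V * (Uk * Ht) -> wt = S / (Vp / Vq) * Wk * Uk ->
  a = Vp * Fs -> b = V / Vq * Ht ->
  S * g * m <= wt * (a * b).
Proof.
move=> S0 g0 m0 Vp0 Vq0 gF mH -> -> ->.
apply: (@le_trans _ _ (S * (Fs * Wk) * (V * (Uk * Ht)))).
  by apply: ler_pM => //; [exact: mulr_ge0|exact: ler_wpM2l].
by rewrite le_eqVlt; apply/orP; left; apply/eqP; field; rewrite !gt_eqF.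
Qed.

Section local_estimate.
Context (R : realType) (n : nat) (jm : int * 'rV[int]_n).
Context (w v f G : 'rV[R]_n -> R) (L c p q r rt : R) (e0 : {ffun 'I_n -> bool}).
Local Notation lam := (lebesgue_rV R n).
Local Notation cube jm := (@dyadic_cube R n jm.1 jm.2).
Local Notation E := {ffun 'I_n -> bool}.
Local Notation mass := (mass jm).
Local Notation vol := (volume R jm).
Implicit Types (s : seq E).
Hypotheses (mw : measurable_fun setT w) (mv : measurable_fun setT v)
  (mG : measurable_fun setT G).
Hypotheses (w0 : forall x, 0 < w x) (v0 : forall x, 0 < v x) (G0 : forall x, 0 <= G x).
Hypotheses (L0 : 0 < L) (fL : lip1 L f) (fc : forall x, `|f x| <= c).
Hypothesis GX : forall s i,
  (\int[lam]_(x in subcube jm s) `|partial f i x|%:E <= (mass G s)%:E)%E.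
Hypothesis fe0 : forall x, subcube jm [:: e0] x -> f x = 0.
Hypotheses (p1 : 1 < p) (q0 : 0 < q) (r1 : 1 < r) (rt0 : 0 < rt).
Hypothesis iG : integrable_on_top jm G.
Let kp := p / (p - 1) * r.
Hypothesis iW : integrable_on_top jm (fun x => w x `^ (- kp)).
Hypothesis iU : integrable_on_top jm (fun x => v x `^ (q * rt)).
Let h x := w x * G x.
Hypothesis iP : integrable_on_top jm (fun x => h x `^ p).

(** The real number that the extended real [A_term] of the class constant equals on
a subcube of [jm]; see [A_term_descendant]. *)
Definition weight_term s : R :=
  side R jm s / vol s `^ (p^-1 - q^-1)
  * (mass (fun x => w x `^ (- kp)) s / vol s) `^ kp^-1
  * (mass (fun x => v x `^ (q * rt)) s / vol s) `^ (q * rt)^-1.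

Let sg := kp / (kp - 1).

Let kp_gt : p / (p - 1) < kp.
Proof.
have : 1 < p / (p - 1) by exact: conjugate_gt1.
by rewrite /kp => h1; rewrite ltr_pMr//; lra.
Qed.

Let kp1 : 1 < kp. Proof. exact: lt_trans (conjugate_gt1 p1) kp_gt. Qed.

Let sg1 : 1 < sg. Proof. exact: conjugate_gt1. Qed.

Let sg_lt : sg < p.
Proof. by rewrite -[ltRHS](conjugateK p1); apply: conjugate_lt => //; exact: conjugate_gt1. Qed.

Let sgp0 : 0 < p. Proof. exact: lt_trans p1. Qed.
Let sg0 : 0 < sg. Proof. exact: lt_trans sg1. Qed.

Let h0 x : 0 <= h x. Proof. by rewrite mulr_ge0// ltW. Qed.

Let mh : measurable_fun setT h. Proof. exact: measurable_funM. Qed.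

Local Notation stop := (stop vol (mass G)).
Local Notation stop_mass := (stop_mass vol (mass G)).

Let avgF s := mass (fun x => h x `^ sg) s / vol s.
(** The summands of the Carleson embedding for [w G]. *)
Let aa s := stop_mass s * avgF s `^ (p / sg).

Let vol0 s : 0 < vol s. Proof. exact: volume_gt0. Qed.

Let avgF0 s : 0 <= avgF s.
Proof. by rewrite divr_ge0 ?(ltW (vol0 _)) ?mass_ge0// => x; exact: powR_ge0. Qed.

Let aa0 s : 0 <= aa s.
Proof. by rewrite mulr_ge0 ?powR_ge0// /stop_mass; case: ifP => // _; exact: ltW. Qed.

Let aa_stop s : stop s -> aa s `^ p^-1 = vol s `^ p^-1 * avgF s `^ sg^-1.
Proof.
move=> ss; rewrite /aa /stop_mass ss powRM ?powR_ge0 ?(ltW (vol0 _))//.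
by rewrite -powRrM; congr (_ * _ `^ _); rewrite mulrAC divff ?mul1r// gt_eqF.
Qed.

Let aa_sum N : tsum N aa [::] <=
  3 `^ (p / sg) / (p / sg - 1) * mass (fun x => h x `^ p) [::].
Proof. exact: (stop_mass_embedding mG G0 iG N mh h0 sg0 sg_lt iP). Qed.

(** Hoelder's inequality for [G = (w G) w ^ (-1)] with the conjugate exponents [sg]
and [kp]. *)
Let avgG s : mass G s / vol s <=
  avgF s `^ sg^-1 * (mass (fun x => w x `^ (- kp)) s / vol s) `^ kp^-1.
Proof.
have GE : G = (fun x => h x * (w x)^-1).
  by apply/funext => x; rewrite /h mulrC mulKf// gt_eqF.
have wE : (fun x => w x `^ (- kp)) = (fun x => (w x)^-1 `^ kp).
  by apply/funext => x; rewrite -[in RHS]powR_inv1 ?(ltW (w0 _))// -powRrM mulN1r.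
have mwi : measurable_fun setT (fun x => (w x)^-1).
  rewrite (_ : (fun x => (w x)^-1) = (fun x => w x `^ (-1))); first exact: measurable_power.
  by apply/funext => x; rewrite powR_inv1// ltW.
have wi0 x : 0 <= (w x)^-1 by rewrite invr_ge0 ltW.
have ihs : integrable_on_top jm (fun x => h x `^ sg) by exact: integrable_power iP.
have iwi : integrable_on_top jm (fun x => (w x)^-1 `^ kp) by rewrite -wE.
have sk : sg^-1 + kp^-1 = 1 by rewrite addrC conjugate_exponent.
have := @mass_hoelder R n jm h (fun x => (w x)^-1) sg kp s mh mwi h0 wi0 sg0
  (lt_trans ltr01 kp1) sk ihs iwi.
by rewrite -wE -GE.
Qed.

Let avgW0 s : 0 <= mass (fun x => w x `^ (- kp)) s / vol s.
Proof. by rewrite divr_ge0 ?(ltW (vol0 _)) ?mass_ge0// => x; exact: powR_ge0. Qed.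
Let avgU0 s : 0 <= mass (fun x => v x `^ (q * rt)) s / vol s.
Proof. by rewrite divr_ge0 ?(ltW (vol0 _)) ?mass_ge0// => x; exact: powR_ge0. Qed.

Let weight_termE s : weight_term s =
  side R jm s / (vol s `^ p^-1 / vol s `^ q^-1)
  * (mass (fun x => w x `^ (- kp)) s / vol s) `^ kp^-1
  * (mass (fun x => v x `^ (q * rt)) s / vol s) `^ (q * rt)^-1.
Proof. by rewrite /weight_term powRB ?(gt_eqF (vol0 s)) ?implybT. Qed.

Lemma weight_term_ge0 s : 0 <= weight_term s.
Proof. by rewrite /weight_term !mulr_ge0 ?invr_ge0 ?powR_ge0 ?(ltW (side_gt0 _ _ _)). Qed.

Let integrable_dom (u k : 'rV[R]_n -> R) (C : R) : measurable_fun setT u ->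
  measurable_fun setT k -> (forall x, 0 <= u x <= C * k x) -> 0 <= C ->
  (forall x, 0 <= k x) -> integrable_on_top jm k -> integrable_on_top jm u.
Proof.
move=> mu mk uk C0 k0 ik.
have mkE : measurable_fun setT (fun x => (k x)%:E) by exact/measurable_EFinP.
apply: (@le_lt_trans _ _ (\int[lam]_(x in cube jm) (C%:E * (k x)%:E))%E).
  apply: ge0_le_integral.
  - exact: measurable_dyadic.
  - by move=> x _; rewrite lee_fin; have /andP[] := uk x.
  - by apply: measurable_funTS; exact/measurable_EFinP.
  - by apply: measurable_funTS; exact: measurable_funeM.
  - by move=> x _; rewrite -EFinM lee_fin; have /andP[] := uk x.
rewrite ge0_integralZl//.
- by rewrite lte_mul_pinfty// ge0_fin_numE// lee_fin.
- exact: measurable_dyadic.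
- exact: measurable_funTS.
- by move=> x _; rewrite lee_fin.
Qed.

Let mabsf : measurable_fun setT (fun x => `|f x|).
Proof. by apply: measurableT_comp => //; exact: measurable_lip1 L0 fL. Qed.

(** The constant of the Carleson embedding for the packing constant [2]. *)
Definition embedding_const (a : R) : R := 3 `^ a / (a - 1).
Definition chain_const (b : R) : R := 2 * (n%:R * 2 ^+ n) `^ b * (4 `^ b / (2 `^ b - 1)).

Let sideG0 s : 0 <= side R jm s * (mass G s / vol s).
Proof. by rewrite mulr_ge0 ?divr_ge0 ?mass_ge0 ?(ltW (side_gt0 _ _ _)) ?(ltW (vol0 _)). Qed.

(** The hypothesis on [AA] is the Hoelder inequality for the terms of the class
constant; it is the only place where the exponent [rho] enters.  Here the power is
[b = q] and the density is [v ^ q]. *)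
Lemma local_estimate_le1 (AA : R) : rt = 1 -> q <= 1 -> 0 <= AA ->
  (forall N (x : seq E -> R), (forall s, 0 <= x s) ->
    tsum N (fun s => weight_term s `^ q * x s `^ (q / p)) [::] <=
    AA `^ q * tsum N x [::] `^ (q / p)) ->
  (\int[lam]_(x in cube jm) ((v x * `|f x|) `^ q)%:E <=
   (chain_const q * (AA `^ q * (embedding_const (p / sg) *
      mass (fun x => h x `^ p) [::]) `^ (q / p)))%:E)%E.
Proof.
move=> rtE q1 AA0 HA.
have iU' : integrable_on_top jm (fun x => v x `^ q) by move: iU; rewrite rtE mulr1.
have -> : (\int[lam]_(x in cube jm) ((v x * `|f x|) `^ q)%:E =
    \int[lam]_(x in cube jm) (`|f x| `^ q * v x `^ q)%:E)%E.
  by apply: eq_integral => x _; rewrite powRM// ?(ltW (v0 _))// mulrC.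
apply: (@chain_sparse R n jm G G0 f (fun x => v x `^ q) L c q _ e0 L0 fL fc
  (measurable_power q mv) (fun x => powR_ge0 _ _) q0 q1 iU' GX fe0).
move=> N; apply: (@le_trans _ _ (AA `^ q * tsum N aa [::] `^ (q / p))); last first.
  apply: ler_wpM2l; first exact: powR_ge0.
  apply: powR_le2r.
  - by rewrite divr_ge0 ?(ltW q0) ?(ltW sgp0).
  - exact: (tsum_ge0 N [::] aa0).
  - exact: (aa_sum N).
apply: le_trans (HA N aa aa0).
apply: ler_sum => s _; case: ifPn => ss; last by rewrite mulr_ge0 ?powR_ge0.
have m0 : 0 <= mass (fun x => v x `^ q) s / vol s by move: (avgU0 s); rewrite rtE mulr1.
apply: (weight_split_le1 q0 (ltW (side_gt0 R jm s)) _ (powR_gt0 p^-1 (vol0 s))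
  (powR_gt0 q^-1 (vol0 s)) (powR_ge0 _ _) (powR_ge0 _ _) (powR_ge0 _ _) (avgG s)
  _ (weight_termE s) (aa_stop ss)).
  exact: divr_ge0 (mass_ge0 jm s G0) (ltW (vol0 s)).
rewrite rtE mulr1 powRM; [|exact: powR_ge0|exact: powR_ge0].
rewrite -!powRrM mulVf; last by rewrite gt_eqF.
by rewrite powRr1 ?(ltW (vol0 s))// powRr1// mulrC divfK// gt_eqF.
Qed.

Let q' := q / (q - 1).
Let t := q * rt / (q * rt - 1).
Let u x := (v x * `|f x|) `^ (q - 1).

(** Here [b = 1] and the density is [v * u] with [u = (v |f|) ^ (q - 1)], so that the
product with [|f|] is [(v |f|) ^ q].  The second embedding is for [u], whose power
[q'] is again [(v |f|) ^ q]. *)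
Lemma local_estimate_gt1 (AA : R) : 1 < rt -> 1 < q -> 0 <= AA ->
  (forall N (x y : seq E -> R), (forall s, 0 <= x s) -> (forall s, 0 <= y s) ->
    tsum N (fun s => weight_term s * (x s `^ p^-1 * y s `^ q'^-1)) [::] <=
    AA * (tsum N x [::] `^ p^-1 * tsum N y [::] `^ q'^-1)) ->
  (\int[lam]_(x in cube jm) ((v x * `|f x|) `^ q)%:E <=
   (chain_const 1 * (AA * ((embedding_const (p / sg) *
      mass (fun x => h x `^ p) [::]) `^ p^-1 *
      (embedding_const (q' / t) * mass (fun x => (v x * `|f x|) `^ q) [::]) `^ q'^-1)))%:E)%E.
Proof.
move=> rt1 q1 AA0 HA.
have c0 : 0 <= c by apply: le_trans (fc 0).
have qrt1 : 1 < q * rt by rewrite -[ltLHS]mulr1 ltr_pM.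
have q_lt : q < q * rt by rewrite ltr_pMr.
have qm0 : 0 < q - 1 by rewrite subr_gt0.
have t1 : 1 < t by exact: conjugate_gt1.
have t0 : 0 < t by apply: lt_trans t1.
have tq' : t < q' by exact: conjugate_lt.
have q'0 : 0 < q' by apply: lt_trans tq'.
have a21 : 1 < q' / t by rewrite ltr_pdivlMr// mul1r.
have q'E : q'^-1 = 1 - q^-1.
  by rewrite /q' invf_div mulrBl divff ?gt_eqF// mul1r.
have iV : integrable_on_top jm (fun x => v x `^ q).
  by apply: (integrable_power mv _ q0 q_lt iU) => x; exact: ltW.
have vf0 x : 0 <= v x * `|f x| by rewrite mulr_ge0// ltW.
have u0 x : 0 <= u x by exact: powR_ge0.
have mvf : measurable_fun setT (fun x => v x * `|f x|) by exact: measurable_funM.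
have mu' : measurable_fun setT u by exact: measurable_power.
have uE : (fun x => u x `^ q') = (fun x => (v x * `|f x|) `^ q).
  by apply/funext => x; rewrite /u -powRrM /q' [(q - 1) * _]mulrC divfK// gt_eqF.
(* [f] is bounded and [v ^ q] is integrable on the cube. *)
have iK : integrable_on_top jm (fun x => (v x * `|f x|) `^ q).
  apply: (@integrable_dom _ (fun x => v x `^ q) (c `^ q)) => //; try exact: measurable_power.
  - move=> x; rewrite powR_ge0/= powRM ?(ltW (v0 _))// mulrC ler_wpM2r ?powR_ge0//.
    by apply: ge0_ler_powR; rewrite ?nnegrE ?(ltW q0).
  - exact: powR_ge0.
  - by move=> x; exact: powR_ge0.
have iu : integrable_on_top jm (fun x => u x `^ q') by rewrite uE.
have iut : integrable_on_top jm (fun x => u x `^ t) by exact: integrable_power iu.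
pose rho x := v x * u x.
have mrho : measurable_fun setT rho by exact: measurable_funM.
have rho0 x : 0 <= rho x by rewrite mulr_ge0// ltW.
have irho : integrable_on_top jm rho.
  apply: (@integrable_dom _ (fun x => v x `^ q) (c `^ (q - 1))) => //; try exact: measurable_power.
  - move=> x; rewrite rho0/= /rho /u powRM ?(ltW (v0 _))//.
    rewrite mulrA mulr_powRB1 ?(ltW (v0 _))// mulrC ler_wpM2r ?powR_ge0//.
    by apply: ge0_ler_powR; rewrite ?nnegrE ?(ltW qm0).
  - exact: powR_ge0.
  - by move=> x; exact: powR_ge0.
have -> : (\int[lam]_(x in cube jm) ((v x * `|f x|) `^ q)%:E =
    \int[lam]_(x in cube jm) (`|f x| `^ 1 * rho x)%:E)%E.
  apply: eq_integral => x _; rewrite powRr1// /rho /u -[in LHS](mulr_powRB1 (vf0 x) q0).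
  by congr EFin; ring.
apply: (@chain_sparse R n jm G G0 f rho L c 1 _ e0 L0 fL fc
  mrho rho0 ltr01 (lexx _) irho GX fe0).
pose avgH s := mass (fun x => u x `^ t) s / vol s.
pose bb s := stop_mass s * avgH s `^ (q' / t).
have sm0 s : 0 <= stop_mass s by rewrite /stop_mass; case: ifP => // _; exact: ltW.
have bb0 s : 0 <= bb s by rewrite mulr_ge0 ?powR_ge0.
move=> N.
apply: (@le_trans _ _ (AA * (tsum N aa [::] `^ p^-1 * tsum N bb [::] `^ q'^-1)));
  last first.
  apply: ler_wpM2l => //; apply: ler_pM; rewrite ?powR_ge0//.
    apply: powR_le2r; first by rewrite invr_ge0 ltW.
      exact: (tsum_ge0 N [::] aa0).
    exact: (aa_sum N).
  apply: powR_le2r; first by rewrite invr_ge0 ltW.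
    exact: (tsum_ge0 N [::] bb0).
  by rewrite -uE; exact: (stop_mass_embedding mG G0 iG N mu' u0 t0 tq' iu).
apply: le_trans (HA N aa bb aa0 bb0).
apply: ler_sum => s _; case: ifPn => ss; last first.
  by apply: mulr_ge0; [exact: weight_term_ge0|apply: mulr_ge0; exact: powR_ge0].
rewrite powRr1; last exact: sideG0.
have bbE : bb s `^ q'^-1 = vol s `^ q'^-1 * avgH s `^ t^-1.
  rewrite /bb /stop_mass ss powRM; [|exact: ltW (vol0 s)|exact: powR_ge0].
  by rewrite -powRrM; congr (_ * _ `^ _); rewrite mulrAC divff ?mul1r// gt_eqF.
have volE : vol s `^ q'^-1 = vol s / vol s `^ q^-1.
  rewrite q'E powRB; last by rewrite (gt_eqF (vol0 s)) implybT.
  by rewrite powRr1// (ltW (vol0 s)).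
rewrite volE in bbE.
have rhoH : mass rho s / vol s <=
    (mass (fun x => v x `^ (q * rt)) s / vol s) `^ (q * rt)^-1 * avgH s `^ t^-1.
  exact: (mass_hoelder s mv mu' (fun x => ltW (v0 x)) u0 (lt_trans ltr01 qrt1) t0
    (conjugate_exponent qrt1) iU iut).
have {}rhoH : mass rho s <=
    vol s * ((mass (fun x => v x `^ (q * rt)) s / vol s) `^ (q * rt)^-1 * avgH s `^ t^-1).
  by rewrite mulrC -ler_pdivrMr.
apply: (weight_split_gt1 (ltW (side_gt0 R jm s)) _ (mass_ge0 jm s rho0)
  (powR_gt0 p^-1 (vol0 s)) (powR_gt0 q^-1 (vol0 s)) (avgG s) rhoH (weight_termE s)
  (aa_stop ss) bbE).
exact: divr_ge0 (mass_ge0 jm s G0) (ltW (vol0 s)).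
Qed.

End local_estimate.

(** * Hoelder inequalities for sums with coefficients *)

Lemma le_powR_absorb (R : realType) (q D K : R) : 1 < q -> 0 <= D -> 0 <= K ->
  K <= D * K `^ (1 - q^-1) -> K <= D `^ q.
Proof.
move=> q1 D0 K0 H; have q0 := lt_trans ltr01 q1.
have [->|Kn] := eqVneq K 0; first exact: powR_ge0.
have Kp : 0 < K by rewrite lt_neqAle eq_sym Kn.
have : K `^ q^-1 <= D.
  rewrite -(ler_pM2r (powR_gt0 (1 - q^-1) Kp)) -powRD; last by rewrite (gt_eqF Kp) implybT.
  by rewrite addrC subrK powRr1.
move=> /(ge0_ler_powR (ltW q0)); rewrite !nnegrE => /(_ (powR_ge0 _ _) D0).
by rewrite -[X in X <= _ -> _]powRrM mulVf ?gt_eqF// powRr1.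
Qed.

Section weighted_sums.
Context (R : realType) (I : Type) (l : seq I) (a : I -> R) (AA : R).
Hypotheses (a0 : forall i, 0 <= a i) (AA0 : 0 <= AA).
Implicit Types x y : I -> R.

Lemma sum_hoelder_bounded x y (al be : R) :
  0 < al -> 0 < be -> 1 <= al + be -> (forall i, 0 <= x i) -> (forall i, 0 <= y i) ->
  (forall i, a i <= AA) ->
  \sum_(i <- l) a i * (x i `^ al * y i `^ be) <=
  AA * ((\sum_(i <- l) x i) `^ al * (\sum_(i <- l) y i) `^ be).
Proof.
move=> al0 be0 ab x0 y0 aA.
apply: le_trans (ler_wpM2l AA0 (sum_hoelder l al0 be0 ab x0 y0)).
rewrite mulr_sumr; apply: ler_sum => i _; apply: ler_wpM2r => //.
by rewrite mulr_ge0 ?powR_ge0.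
Qed.

Lemma sum_hoelder2 x (s q be : R) : 0 < s -> 0 < q -> 0 < be -> q / s + be = 1 ->
  (forall i, 0 <= x i) -> \sum_(i <- l) a i `^ s <= AA `^ s ->
  \sum_(i <- l) a i `^ q * x i `^ be <= AA `^ q * (\sum_(i <- l) x i) `^ be.
Proof.
move=> s0 q0 be0 sb x0 aA.
have qs0 : 0 < q / s by rewrite divr_gt0.
have pE (z : R) : z `^ q = (z `^ s) `^ (q / s).
  by rewrite -powRrM mulrC divfK// gt_eqF.
under eq_bigr do rewrite (pE (a _)).
apply: (le_trans (sum_hoelder l qs0 be0 _ _ x0)); first by rewrite sb.
  by move=> i; exact: powR_ge0.
apply: ler_wpM2r; first exact: powR_ge0.
rewrite (pE AA); apply: ge0_ler_powR; rewrite ?nnegrE ?(ltW qs0) ?powR_ge0//.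
by apply: sumr_ge0 => i _; exact: powR_ge0.
Qed.

(** The Hoelder inequality for [a] and the product [z], whose exponent [th] is
[1 - 1 / s], followed by the one for the two factors of [z]. *)
Lemma sum_hoelder3 x y (s al be : R) : 0 < s -> 0 < al -> 0 < be ->
  s^-1 + al + be = 1 ->
  (forall i, 0 <= x i) -> (forall i, 0 <= y i) -> \sum_(i <- l) a i `^ s <= AA `^ s ->
  \sum_(i <- l) a i * (x i `^ al * y i `^ be) <=
  AA * ((\sum_(i <- l) x i) `^ al * (\sum_(i <- l) y i) `^ be).
Proof.
move=> s0 al0 be0 sab x0 y0 aA; pose th := al + be.
have th0 : 0 < th by rewrite addr_gt0.
have thE : th * th^-1 = 1 by rewrite divff// gt_eqF.
pose z i := x i `^ (al / th) * y i `^ (be / th).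
have zE i : x i `^ al * y i `^ be = z i `^ th.
  by rewrite /z powRM ?powR_ge0// -!powRrM !divfK// gt_eqF.
under eq_bigr do rewrite zE -[X in X * _]powRr1//.
apply: (le_trans (sum_hoelder2 s0 ltr01 th0 _ _ aA)).
- by rewrite div1r /th addrA.
- by move=> i; rewrite mulr_ge0 ?powR_ge0.
rewrite powRr1//; apply: ler_wpM2l => //.
have H := @sum_hoelder R I l x y (al / th) (be / th) (divr_gt0 al0 th0) (divr_gt0 be0 th0).
have {}H := H (ltac:(by rewrite -mulrDl thE)) x0 y0.
have {H} := ge0_ler_powR (ltW th0) _ _ H; rewrite !nnegrE => H.
apply: (le_trans (H _ _)).
- by apply: sumr_ge0 => i _; rewrite mulr_ge0 ?powR_ge0.
- by rewrite mulr_ge0 ?powR_ge0.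
by rewrite powRM ?powR_ge0// -!powRrM !divfK// gt_eqF.
Qed.

End weighted_sums.

(** * Weights and the class constant *)

Section weights.
Context (R : realType) (n : nat).
Local Notation lam := (lebesgue_rV R n).
Local Notation cube jm := (@dyadic_cube R n jm.1 jm.2).
Implicit Types (w v : 'rV[R]_n -> R) (jm : int * 'rV[int]_n).

(** The Borel representative is modified on the null set where it is not positive. *)
Lemma weight_representative w : weight w ->
  exists w', [/\ measurable_fun setT w', forall x, 0 < w' x & {ae lam, forall x, w x = w' x}].
Proof.
move=> [[g mg wg] _ w0 _]; exists (fun x => if 0 < g x then g x else 1); split.
- apply: measurable_fun_ifT => //; exact: measurable_fun_ltr.
- by move=> x; case: ifP.
have H : {ae lam, forall x, w x = g x /\ 0 < w x} by exact: (filterI wg w0).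
by apply: (ae_imply H) => x [-> ->].
Qed.

Lemma eq_A_term (p q r rt : R) w w' v v' jm :
  {ae lam, forall x, w x = w' x} -> {ae lam, forall x, v x = v' x} ->
  A_term p q r rt w v jm = A_term p q r rt w' v' jm.
Proof.
move=> ww' vv'; rewrite /A_term /average; rewrite (@ae_eq_ge0_integral _ _ _ lam _ _
  (fun x => (w' x `^ (- (p / (p - 1) * r)))%:E)).
- rewrite (@ae_eq_ge0_integral _ _ _ lam _ (fun x => (v x `^ (q * rt))%:E)
    (fun x => (v' x `^ (q * rt))%:E)) //.
  - by move=> x _; rewrite lee_fin; exact: powR_ge0.
  - by move=> x _; rewrite lee_fin; exact: powR_ge0.
  by apply: (ae_imply vv') => x ->.
- by move=> x _; rewrite lee_fin; exact: powR_ge0.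
- by move=> x _; rewrite lee_fin; exact: powR_ge0.
by apply: (ae_imply ww') => x ->.
Qed.

Lemma integral_dyadic_gt0 jm (h : 'rV[R]_n -> R) : measurable_fun setT h ->
  (forall x, 0 < h x) -> (0 < \int[lam]_(x in cube jm) (h x)%:E)%E.
Proof.
move=> mh h0; rewrite lt0e integral_ge0 ?andbT => [|x _]; last by rewrite lee_fin ltW.
apply/negP => /eqP H.
have mQ : measurable (cube jm) by exact: measurable_dyadic.
have mhE : measurable_fun (cube jm) (fun x => (h x)%:E).
  by apply: measurable_funTS; exact/measurable_EFinP.
have := ae_eq_integral_abs lam mQ mhE; move=> [K _].
have {K} : ae_eq lam (cube jm) (fun x => (h x)%:E) (cst 0%E).
  apply: K; rewrite -[RHS]H; apply: eq_integral => x _.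
  by rewrite /= ger0_norm// ltW.
move=> [N [mN N0 sN]].
have : (lam (cube jm) <= lam N)%E.
  apply: le_measure; rewrite ?inE// => x Qx; apply: sN => /= /(_ Qx) [] /eqP.
  by rewrite gt_eqF.
by rewrite N0 mu_dyadic lee_fin leNgt exprn_gt0// dyadic_side_gt0.
Qed.

Section A_term.
Context (p q r rt : R) (w v : 'rV[R]_n -> R) (jm : int * 'rV[int]_n).
Hypotheses (mw : measurable_fun setT w) (mv : measurable_fun setT v)
  (w0 : forall x, 0 < w x) (v0 : forall x, 0 < v x).
Hypotheses (p1 : 1 < p) (q0 : 0 < q) (r0 : 0 < r) (rt0 : 0 < rt).
Let kp := p / (p - 1) * r.

Let kp0 : 0 < kp. Proof. by rewrite mulr_gt0// divr_gt0 ?subr_gt0// (lt_trans ltr01). Qed.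
Let qrt0 : 0 < q * rt. Proof. exact: mulr_gt0. Qed.

Let intW := (\int[lam]_(x in cube jm) (w x `^ (- kp))%:E)%E.
Let intU := (\int[lam]_(x in cube jm) (v x `^ (q * rt))%:E)%E.

Let intW0 : (0 < intW)%E.
Proof. by apply: integral_dyadic_gt0; [exact: measurable_power|move=> x; exact: powR_gt0]. Qed.
Let intU0 : (0 < intU)%E.
Proof. by apply: integral_dyadic_gt0; [exact: measurable_power|move=> x; exact: powR_gt0]. Qed.

Let muQ : fine (lam (cube jm)) = dyadic_side R jm.1 ^+ n.
Proof. by rewrite mu_dyadic. Qed.

Let dn0 : 0 < dyadic_side R jm.1 ^+ n.
Proof. by rewrite exprn_gt0// dyadic_side_gt0. Qed.

Let average_power_gt0 (X : \bar R) (th : R) : (0 < X)%E ->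
  (0 < (((fine (lam (cube jm)))^-1)%:E * X) `^ th)%E.
Proof.
move=> X0; apply: poweR_gt0.
by rewrite muQ mule_gt0// lte_fin invr_gt0.
Qed.

Lemma A_term_gt0 : (0 < A_term p q r rt w v jm)%E.
Proof.
rewrite /A_term /average; apply: mule_gt0; last exact: average_power_gt0.
apply: mule_gt0; last exact: average_power_gt0.
by rewrite lte_fin divr_gt0 ?dyadic_side_gt0// powR_gt0// muQ.
Qed.

(** The three factors of a term are positive, so an infinite average would make the
term infinite. *)
Lemma A_term_integrable : (A_term p q r rt w v jm < +oo)%E ->
  integrable_on_top jm (fun x => w x `^ (- kp)) /\
  integrable_on_top jm (fun x => v x `^ (q * rt)).
Proof.
have top (th : R) : 0 < th ->
    ((((fine (lam (cube jm)))^-1)%:E * +oo) `^ th = +oo :> \bar R)%E.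
  by move=> th0; rewrite gt0_muley ?lte_fin ?muQ ?invr_gt0// poweRyr// gt_eqF.
have side0 : (0 < (dyadic_side R jm.1 / fine (lam (cube jm)) `^ (p^-1 - q^-1))%:E)%E.
  by rewrite lte_fin divr_gt0 ?dyadic_side_gt0// powR_gt0// muQ.
move=> Aoo; split; rewrite /integrable_on_top ltey; apply/negP => /eqP H; move: Aoo.
  rewrite /A_term /average -/kp H top ?invr_gt0// gt0_muley// gt0_mulye ?ltxx//.
  exact: average_power_gt0.
rewrite /A_term /average H top ?invr_gt0// gt0_muley ?ltxx//.
by apply: mule_gt0 => //; exact: average_power_gt0.
Qed.

Lemma A_term_descendant s : integrable_on_top jm (fun x => w x `^ (- kp)) ->
  integrable_on_top jm (fun x => v x `^ (q * rt)) ->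
  A_term p q r rt w v (descendant jm s) = (weight_term jm w v p q r rt s)%:E.
Proof.
move=> iW iU.
have fW := mass_fin s (measurable_power (- kp) mw) (fun x => powR_ge0 _ _) iW.
have fU := mass_fin s (measurable_power (q * rt) mv) (fun x => powR_ge0 _ _) iU.
rewrite /A_term /average /weight_term -/kp -[dyadic_cube _ _]/(subcube jm s).
rewrite -(fineK fW) -(fineK fU) [fine (lam _)](_ : _ = volume R jm s); last first.
  by rewrite (mu_subcube R jm s).
have avgE (x th : R) : ((((volume R jm s)^-1)%:E * x%:E) `^ th =
    ((x / volume R jm s) `^ th)%:E)%E.
  by rewrite -EFinM poweR_EFin mulrC.
by rewrite !avgE !EFinM.
Qed.

End A_term.
End weights.

(** * Orthants, class constants and the gradient *)

Section orthants.
Context (R : realType) (n : nat).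
Local Notation lam := (lebesgue_rV R n).
Local Notation cube jm := (@dyadic_cube R n jm.1 jm.2).
Local Notation E := {ffun 'I_n -> bool}.
Implicit Types (e : E) (M : nat).

(** The cube of side [2 ^+ M.+1] with a vertex at the origin, in the orthant of sign
pattern [e]. *)
Definition orthant_cube M e : int * 'rV[int]_n :=
  (- M.+1%:Z, \row_i (if e i then 0 else -1)).

Let sideE M e : dyadic_side R (orthant_cube M e).1 = 2 ^+ M.+1.
Proof. by rewrite /dyadic_side opprK. Qed.

Lemma orthant_cover M (x : 'rV[R]_n) : (forall i, `|x ord0 i| < 2 ^+ M) ->
  cube (orthant_cube M [ffun i => 0 <= x ord0 i]) x.
Proof.
move=> xM i; rewrite !mxE sideE ffunE exprS; have := xM i.
rewrite ltr_norml => /andP[h1 h2]; have p0 : 0 < 2 ^+ M :> R by rewrite exprn_gt0.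
have m1 : (-1 : int)%:~R = -1 :> R by rewrite mulrNz mulr1z.
have m0 : (0 : int)%:~R = 0 :> R by rewrite mulr0z.
by case: (leP 0 (x ord0 i)) => h; rewrite ?m0 ?m1; apply/andP; split; lra.
Qed.

(** The child of digits [e] is the one opposite to the origin; a function supported
in the cube of radius [2 ^+ M] around the origin vanishes on it. *)
Lemma far_child M e (x : 'rV[R]_n) i : subcube (orthant_cube M e) [:: e] x ->
  2 ^+ M <= `|x ord0 i|.
Proof.
have dE : dyadic_side R (descendant (orthant_cube M e) [:: e]).1 = 2 ^+ M.
  by rewrite dyadic_side_succ sideE exprS mulrC mulKf.
move=> /(_ i); rewrite !mxE dE.
have p0 : 0 < 2 ^+ M :> R by rewrite exprn_gt0.
have m1 : (2 * 0 + 1%:Z)%:~R = 1 :> R by rewrite mulr0 add0r.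
have m2 : (2 * -1 + 0%:Z)%:~R = -2 :> R by rewrite addr0 mulrN1 mulrNz.
case: (e i); rewrite ?m1 ?m2 => /andP[h1 h2].
  by rewrite (le_trans _ (ler_norm _))//; move: h1; rewrite mulr1.
rewrite -normrN (le_trans _ (ler_norm _))// lerNr; apply/ltW/(lt_le_trans h2).
lra.
Qed.

Lemma integral_le_orthants M (g : 'rV[R]_n -> R) : measurable_fun setT g ->
  (forall x, 0 <= g x) -> (forall x, g x != 0 -> forall i, `|x ord0 i| < 2 ^+ M) ->
  (\int[lam]_x (g x)%:E <= \sum_e \int[lam]_(x in cube (orthant_cube M e)) (g x)%:E)%E.
Proof.
move=> mg g0 gM.
have mgE : measurable_fun setT (fun x => (g x)%:E) by exact/measurable_EFinP.
have mQ e : measurable (cube (orthant_cube M e)) by exact: measurable_dyadic.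
under eq_bigr do rewrite integral_mkcond.
rewrite -ge0_integral_sum//; first last.
- by move=> e x _; apply: erestrict_ge0 => y _; rewrite lee_fin.
- move=> e; apply/(measurable_restrictT _ (mQ e)); exact: measurable_funTS.
apply: ge0_le_integral => //.
- by move=> x _; rewrite lee_fin.
- apply: emeasurable_sum => e.
  apply/(measurable_restrictT _ (mQ e)); exact: measurable_funTS.
move=> x _; have [->|gx] := eqVneq (g x) 0.
  by apply: sume_ge0 => e _; apply: erestrict_ge0 => y _; rewrite lee_fin.
rewrite (bigD1 [ffun i => 0 <= x ord0 i])//= {1}patchE mem_set; last first.
  by apply: orthant_cover; exact: gM.
by rewrite leeDl// sume_ge0// => e _; apply: erestrict_ge0 => y _; rewrite lee_fin.
Qed.

End orthants.

Section A_const.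
Context (R : realType) (n : nat) (p q r rt : R) (w v : 'rV[R]_n -> R).
Local Notation A := (A_term p q r rt w v).
Hypothesis A0 : forall jm, (0 < A jm)%E.

Lemma A_const_fin_gt0 (s : R) : 0 < s -> (0 < A_const p q r rt s%:E w v)%E.
Proof.
move=> s0; rewrite /A_const; apply: poweR_gt0.
pose jm : int * 'rV[int]_n := (0, 0).
have h : (0 < A jm `^ s)%E by exact: poweR_gt0.
apply: (lt_le_trans h); apply: esum_ge; exists [set jm]; first by split.
by rewrite fsbig_set1.
Qed.

Lemma A_const_sup_gt0 : (0 < A_const p q r rt +oo w v)%E.
Proof. by apply: (lt_le_trans (A0 (0, 0))); apply: ereal_sup_ubound; exists (0, 0). Qed.

Lemma A_term_le_sup jm : (A jm <= A_const p q r rt +oo w v)%E.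
Proof. by apply: ereal_sup_ubound; exists jm. Qed.

Lemma esum_A_term_lty (s : R) : 0 < s -> (A_const p q r rt s%:E w v < +oo)%E ->
  (\esum_(jm in [set: int * 'rV[int]_n]) A jm `^ s < +oo)%E.
Proof.
move=> s0; rewrite /A_const !ltey; apply: contra => /eqP ->.
by rewrite poweRyr// invr_eq0 gt_eqF.
Qed.

Lemma A_term_lty (s : R) jm : 0 < s -> (A_const p q r rt s%:E w v < +oo)%E ->
  (A jm < +oo)%E.
Proof.
move=> s0 /(esum_A_term_lty s0) H; rewrite ltey; apply/negP => /eqP AE.
move: H; apply/negP; rewrite -leNgt -[leLHS](_ : A jm `^ s = +oo)%E.
  by apply: esum_ge; exists [set jm]; [split|rewrite fsbig_set1].
by rewrite AE poweRyr// gt_eqF.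
Qed.

Lemma tsum_A_term_le (s : R) jm N : 0 < s -> (A_const p q r rt s%:E w v < +oo)%E ->
  tsum N (fun u => fine (A (descendant jm u)) `^ s) [::] <=
  fine (A_const p q r rt s%:E w v) `^ s.
Proof.
move=> s0 Aoo; have sumoo := esum_A_term_lty s0 Aoo.
have fA j : A j \is a fin_num by rewrite ge0_fin_numE ?(A_term_lty _ s0)// ltW.
pose T j := fine (A j) `^ s.
have T0 j : 0 <= T j by exact: powR_ge0.
have TE : (\esum_(j in [set: int * 'rV[int]_n]) A j `^ s = \esum_(j in setT) (T j)%:E)%E.
  by apply: eq_esum => j _; rewrite /T -poweR_EFin fineK.
have := tsum_le_esum jm N T0; rewrite -TE.
have fS : (\esum_(j in [set: int * 'rV[int]_n]) A j `^ s)%E \is a fin_num.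
  by rewrite ge0_fin_numE//; apply: esum_ge0 => j _; exact: poweR_ge0.
rewrite -[X in (_ <= X)%E](fineK fS) lee_fin => /le_trans; apply.
rewrite /A_const fine_poweR -powRrM mulVf ?gt_eqF// powRr1//.
by apply: fine_ge0; apply: esum_ge0 => j _; exact: poweR_ge0.
Qed.

End A_const.

Section gradient_norm.
Context (R : realType) (n : nat) (f : 'rV[R]_n -> R) (L : R).
Hypotheses (L0 : 0 < L) (fL : lip1 L f).

(** A Borel minorant of the length of the gradient. *)
Definition partial_norm x := Num.sqrt (\sum_i partial f i x ^+ 2).

Lemma measurable_partial_norm : measurable_fun setT partial_norm.
Proof.
apply: measurableT_comp.
  by apply: continuous_measurable_fun; exact: sqrt_continuous.
apply: measurable_sum => i; apply: measurable_funX; exact: measurable_partial fL.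
Qed.

Lemma partial_norm_ge0 x : 0 <= partial_norm x. Proof. exact: sqrtr_ge0. Qed.

Lemma partial_le_norm i x : `|partial f i x| <= partial_norm x.
Proof.
rewrite -sqrtr_sqr ler_wsqrtr// (bigD1 i)//= lerDl sumr_ge0// => j _.
exact: sqr_ge0.
Qed.

Lemma partial_norm_le_gradient x : partial_norm x <= euclidean_norm (gradient f x).
Proof.
rewrite ler_wsqrtr//; apply: ler_sum => i _; rewrite mxE /partial indicE.
by case: (_ \in _); rewrite ?mul1r// mul0r expr0n/= sqr_ge0.
Qed.

End gradient_norm.

(** * From cubes to the whole space *)

Section local_to_global.
Context (R : realType) (n : nat) (p q r rt : R) (rho : \bar R).
Local Notation lam := (lebesgue_rV R n).
Local Notation cube jm := (@dyadic_cube R n jm.1 jm.2).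
Local Notation E := {ffun 'I_n -> bool}.
Hypotheses (n0 : (0 < n)%N) (p1 : 1 < p) (q0 : 0 < q) (r1 : 1 < r) (rt0 : 0 < rt).
Hypothesis rho_pos : rho = +oo%E \/ exists2 s : R, rho = s%:E & 0 < s.

(** The inequality on one cube [jm] for a function that vanishes on the child [e0],
with Borel weights; it separates the choice of the case from the passage to the
whole space. *)
Definition local_bound (C : R) := forall jm (w v f G : 'rV[R]_n -> R) (L c : R) (e0 : E),
  measurable_fun setT w -> measurable_fun setT v -> measurable_fun setT G ->
  (forall x, 0 < w x) -> (forall x, 0 < v x) -> (forall x, 0 <= G x) ->
  0 < L -> lip1 L f -> (forall x, `|f x| <= c) ->
  (forall s i, \int[lam]_(x in subcube jm s) `|partial f i x|%:E <= (mass jm G s)%:E)%E ->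
  (forall x, subcube jm [:: e0] x -> f x = 0) ->
  integrable_on_top jm G ->
  integrable_on_top jm (fun x => (w x * G x) `^ p) ->
  (A_const p q r rt rho w v < +oo)%E ->
  (\int[lam]_(x in cube jm) ((v x * `|f x|) `^ q)%:E <=
   ((C * fine (A_const p q r rt rho w v)) `^ q *
     mass jm (fun x => (w x * G x) `^ p) [::] `^ (q / p))%:E)%E.

Lemma A_const_gt0 (w v : 'rV[R]_n -> R) :
  measurable_fun setT w -> measurable_fun setT v ->
  (forall x, 0 < w x) -> (forall x, 0 < v x) -> (0 < A_const p q r rt rho w v)%E.
Proof.
move=> mw mv w0 v0.
have A0 jm : (0 < A_term p q r rt w v jm)%E.
  by apply: A_term_gt0 => //; apply: lt_trans r1.
case: rho_pos => [->|[s -> s0]]; first exact: A_const_sup_gt0.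
exact: A_const_fin_gt0.
Qed.

Lemma A_term_lt_pinfty (w v : 'rV[R]_n -> R) jm :
  measurable_fun setT w -> measurable_fun setT v ->
  (forall x, 0 < w x) -> (forall x, 0 < v x) ->
  (A_const p q r rt rho w v < +oo)%E -> (A_term p q r rt w v jm < +oo)%E.
Proof.
move=> mw mv w0 v0.
have A0 j : (0 < A_term p q r rt w v j)%E.
  by apply: A_term_gt0 => //; apply: lt_trans r1.
case: rho_pos => [->|[s -> s0]] Aoo; last exact: A_term_lty Aoo.
exact: le_lt_trans (A_term_le_sup _ _ _ _ _ _ jm) Aoo.
Qed.

Lemma top_integrable_weights (w v : 'rV[R]_n -> R) jm :
  measurable_fun setT w -> measurable_fun setT v ->
  (forall x, 0 < w x) -> (forall x, 0 < v x) ->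
  (A_const p q r rt rho w v < +oo)%E ->
  integrable_on_top jm (fun x => w x `^ (- (p / (p - 1) * r))) /\
  integrable_on_top jm (fun x => v x `^ (q * rt)).
Proof.
move=> mw mv w0 v0 Aoo; apply: A_term_integrable => //; first exact: lt_trans r1.
exact: A_term_lt_pinfty.
Qed.

(** Hoelder's inequality for [G = (w G) w ^ (-1)] as in the local estimate, now for
the finiteness of the integral. *)
Lemma integrable_unweighted jm (w G : 'rV[R]_n -> R) :
  measurable_fun setT w -> measurable_fun setT G ->
  (forall x, 0 < w x) -> (forall x, 0 <= G x) ->
  integrable_on_top jm (fun x => w x `^ (- (p / (p - 1) * r))) ->
  integrable_on_top jm (fun x => (w x * G x) `^ p) -> integrable_on_top jm G.
Proof.
move=> mw mG w0 G0 iW iP; set kp := p / (p - 1) * r in iW.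
have kp1 : 1 < kp by rewrite -[ltLHS]mulr1 ltr_pM// conjugate_gt1.
have kp_gt : p / (p - 1) < kp by rewrite ltr_pMr// (lt_trans ltr01)// conjugate_gt1.
pose sg := kp / (kp - 1).
have sg_lt : sg < p.
  by rewrite -[ltRHS](conjugateK p1); apply: conjugate_lt => //; exact: conjugate_gt1.
have sg0 : 0 < sg by rewrite (lt_trans ltr01)// conjugate_gt1.
have mh : measurable_fun setT (fun x => w x * G x) by exact: measurable_funM.
have h0 x : 0 <= w x * G x by rewrite mulr_ge0// ltW.
have ihs := integrable_power mh h0 sg0 sg_lt iP.
have wiE : (fun x => (w x)^-1) = (fun x => w x `^ (-1)).
  by apply/funext => x; rewrite powR_inv1// ltW.
have mwi : measurable_fun setT (fun x => (w x)^-1).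
  by rewrite wiE; exact: measurable_power.
have wi0 x : 0 <= (w x)^-1 by rewrite invr_ge0 ltW.
have sk : sg^-1 + kp^-1 = 1 by rewrite addrC conjugate_exponent.
have H := integral_hoelder lam (measurable_dyadic jm) mh mwi h0 wi0 sg0
  (lt_trans ltr01 kp1) sk.
rewrite /integrable_on_top; have -> : (\int[lam]_(x in cube jm) (G x)%:E =
    \int[lam]_(x in cube jm) (w x * G x * (w x)^-1)%:E)%E.
  by apply: eq_integral => x _; rewrite mulrC mulKf// gt_eqF.
apply: (le_lt_trans H).
have wE : (\int[lam]_(x in cube jm) ((w x)^-1 `^ kp)%:E =
    \int[lam]_(x in cube jm) (w x `^ (- kp))%:E)%E.
  by apply: eq_integral => x _; rewrite -powR_inv1 ?(ltW (w0 _))// -powRrM mulN1r.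
rewrite wE; apply: lte_mul_pinfty.
- exact: poweR_ge0.
- by rewrite ge0_fin_numE ?poweR_ge0//; exact: poweR_lty.
- exact: poweR_lty.
Qed.

End local_to_global.

Lemma Lip_c_bounds (R : realType) (n : nat) (f : 'rV[R]_n -> R) (L : R) :
  (0 < n)%N -> 0 < L -> lip1 L f -> compact (closure [set x | f x != 0]) ->
  exists M c, (forall x, f x != 0 -> forall i, `|x ord0 i| < 2 ^+ M) /\
    (forall x, `|f x| <= c).
Proof.
move=> n0 L0 fL /compact_bounded/pinfty_ex_gt0[M0 M00 HM].
have supp x : f x != 0 -> `|x| <= M0 by move=> fx; apply: HM; apply: subset_closure.
have coord (x : 'rV[R]_n) i : `|x ord0 i| <= `|x|.
  rewrite [leRHS]mx_normrE.
  exact: (le_bigmax_cond _ (fun ij : 'I_1 * 'I_n => `|x ij.1 ij.2|) (isT : xpredT (ord0, i))).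
pose M := (Num.truncn M0).+1.
have M0M : M0 < 2 ^+ M.
  by rewrite (lt_trans (truncnS_gt _))// -natrX ltr_nat ltn_expl.
have box x : f x != 0 -> forall i, `|x ord0 i| < 2 ^+ M.
  by move=> /supp xM i; rewrite (le_lt_trans (coord _ _))// (le_lt_trans xM).
exists M, (L * (n%:R * (2 ^+ M + 2 ^+ M))); split => // x.
have [->|fx] := eqVneq (f x) 0.
  by rewrite normr0 !mulr_ge0 ?addr_ge0 ?exprn_ge0// ltW.
pose y : 'rV[R]_n := \row__ 2 ^+ M.
have fy : f y = 0.
  apply/eqP; apply: contraT => /box /(_ (Ordinal n0)).
  by rewrite mxE ger0_norm ?exprn_ge0// ltxx.
rewrite -[f x]subr0 -fy (le_trans (fL _ _))// ler_pM2l//.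
rewrite [leRHS]mulr_natl -[n in leRHS]card_ord -sumr_const; apply: ler_sum => i _.
rewrite (le_trans (ler_normB _ _))//; apply: lerD; first exact/ltW/box.
by rewrite mxE ger0_norm// exprn_ge0.
Qed.

Lemma Lnorm_finE d (T : measurableType d) (R : realType) (mu : {measure set T -> \bar R})
    (q : R) (g : T -> R) :
  (Lnorm mu q%:E (fun x => (g x)%:E) = (\int[mu]_x (`|g x| `^ q)%:E) `^ q^-1)%E.
Proof. by rewrite unlock. Qed.

Section global.
Context (R : realType) (n : nat) (p q r rt : R) (rho : \bar R).
Local Notation lam := (lebesgue_rV R n).
Local Notation cube jm := (@dyadic_cube R n jm.1 jm.2).
Local Notation E := {ffun 'I_n -> bool}.
Hypotheses (n0 : (0 < n)%N) (p1 : 1 < p) (q0 : 0 < q) (r1 : 1 < r) (rt0 : 0 < rt).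
Hypothesis rho_pos : rho = +oo%E \/ exists2 s : R, rho = s%:E & 0 < s.

(** The [q]-th root of the sum of the [2 ^ n] equal bounds of the orthants. *)
Lemma orthant_total (a pp C : R) : 0 <= C -> 0 <= a -> 0 <= pp ->
  (2 ^+ n * ((C * a) `^ q * pp `^ (q / p))) `^ q^-1 =
  (2 ^+ n) `^ q^-1 * C * a * pp `^ p^-1.
Proof.
move=> C0 a0 pp0; have p0 : 0 < p by apply: lt_trans p1.
rewrite !powRM ?mulr_ge0 ?powR_ge0 ?exprn_ge0// -!powRrM.
have -> : q / p * q^-1 = p^-1 by rewrite mulrAC divff ?mul1r// gt_eqF.
by rewrite divff ?gt_eqF// !powRr1 ?mulr_ge0// !mulrA.
Qed.

(** The summand [1] in the constant makes it positive, so that the right-hand side is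
infinite when the integral on the right is. *)
Lemma global_bound_borel (C : R) : 0 <= C -> @local_bound R n p q r rt rho C ->
  forall (w v f G : 'rV[R]_n -> R) (L c : R) (M : nat),
  measurable_fun setT w -> measurable_fun setT v -> measurable_fun setT G ->
  (forall x, 0 < w x) -> (forall x, 0 < v x) -> (forall x, 0 <= G x) ->
  0 < L -> lip1 L f -> (forall x, `|f x| <= c) ->
  (forall x, f x != 0 -> forall i, `|x ord0 i| < 2 ^+ M) ->
  (forall i x, `|partial f i x| <= G x) ->
  (A_const p q r rt rho w v < +oo)%E ->
  ((\int[lam]_x ((v x * `|f x|) `^ q)%:E) `^ q^-1 <=
   ((2 ^+ n) `^ q^-1 * C + 1)%:E * A_const p q r rt rho w v *
   (\int[lam]_x ((w x * G x) `^ p)%:E) `^ p^-1)%E.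
Proof.
move=> C0 loc w v f G L c M mw mv mG w0 v0 G0 L0 fL fc fM fG Aoo.
have p0 : 0 < p by exact: lt_trans p1.
have A0 : (0 < A_const p q r rt rho w v)%E by exact: A_const_gt0.
have tw := top_integrable_weights p1 q0 r1 rt0 rho_pos _ mw mv w0 v0 Aoo.
have {}loc := loc _ w v f G L c _ mw mv mG w0 v0 G0 L0 fL fc _ _ _ _ Aoo.
move: A0 Aoo loc; move: (A_const p q r rt rho w v) => A A0 Aoo loc.
have fA : A \is a fin_num by rewrite (ge0_fin_numE (ltW A0)); exact: Aoo.
have mf : measurable_fun setT f by exact: measurable_lip1 L0 fL.
have mwG : measurable_fun setT (fun x => (w x * G x) `^ p).
  by apply: measurable_power; exact: measurable_funM.
have mvf : measurable_fun setT (fun x => (v x * `|f x|) `^ q).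
  apply: measurable_power; apply: measurable_funM; first exact: mv.
  by apply: measurableT_comp; [exact: normr_measurable|exact: mf].
have C'1 : (0 < ((2 ^+ n) `^ q^-1 * C + 1)%:E)%E.
  by rewrite lte_fin ltr_wpDl// mulr_ge0// powR_ge0.
have [P PE] : exists P, (\int[lam]_x ((w x * G x) `^ p)%:E)%E = P.
  by eexists; exact: erefl.
have P0 : (0 <= P)%E.
  by rewrite -PE; apply: integral_ge0 => x _; rewrite lee_fin; exact: powR_ge0.
rewrite PE; have [Poo|Pfin] := eqVneq P +oo%E.
  rewrite Poo poweRyr; last by rewrite invr_eq0 gt_eqF.
  by rewrite gt0_muley ?leey//; exact: mule_gt0.
have Ply : (P < +oo)%E by rewrite ltey.
have fP : P \is a fin_num by rewrite (ge0_fin_numE P0).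
have a0 : 0 <= fine A by apply: fine_ge0; exact: ltW.
have pp0 : 0 <= fine P by exact: fine_ge0.
have local e : (\int[lam]_(x in cube (orthant_cube M e)) ((v x * `|f x|) `^ q)%:E <=
    ((C * fine A) `^ q * fine P `^ (q / p))%:E)%E.
  have [iW _] := tw (orthant_cube M e).
  have topP : (\int[lam]_(x in cube (orthant_cube M e)) ((w x * G x) `^ p)%:E <= P)%E.
    rewrite -PE; apply: ge0_subset_integral.
    - exact: measurable_dyadic.
    - exact: measurableT.
    - exact/measurable_EFinP.
    - by move=> x _; rewrite lee_fin; exact: powR_ge0.
    - exact: subsetT.
  have iP : integrable_on_top (orthant_cube M e) (fun x => (w x * G x) `^ p).
    exact: le_lt_trans topP Ply.
  have iG := integrable_unweighted p1 r1 mw mG w0 G0 iW iP.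
  apply: le_trans (loc _ e _ _ iG iP) _.
  - move=> s i; rewrite fineK; last exact: (mass_fin s mG G0 iG).
    apply: ge0_le_integral.
    + exact: measurable_subcube.
    + by move=> x _; rewrite lee_fin; exact: normr_ge0.
    + apply: measurable_funTS; apply/measurable_EFinP.
      apply: measurableT_comp; first exact: normr_measurable.
      exact: measurable_partial fL.
    + by apply: measurable_funTS; exact/measurable_EFinP.
    + by move=> x _; rewrite lee_fin; exact: fG.
  - move=> x xe; apply/eqP; apply: contraT => /fM /(_ (Ordinal n0)).
    by rewrite ltNge (far_child _ xe).
  rewrite lee_fin; apply: ler_wpM2l; first exact: powR_ge0.
  apply: powR_le2r; first by rewrite divr_ge0 ?ltW.
    by apply: mass_ge0 => x; exact: powR_ge0.
  apply: fine_le; [|exact: fP|exact: topP].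
  exact: (mass_fin [::] mwG (fun x => powR_ge0 _ _) iP).
have total : (\int[lam]_x ((v x * `|f x|) `^ q)%:E <=
    (2 ^+ n * ((C * fine A) `^ q * fine P `^ (q / p)))%:E)%E.
  apply: (le_trans (integral_le_orthants (M := M) mvf _ _)).
  - by move=> x; exact: powR_ge0.
  - move=> x vfx; apply: fM; apply: contraNneq vfx => ->.
    by rewrite normr0 mulr0 powR0// gt_eqF.
  apply: (le_trans (lee_sum _ (fun e _ => local e))).
  rewrite sumEFin lee_fin sumr_const card_ffun card_bool card_ord.
  by rewrite -[_ *+ (2 ^ n)%N]mulr_natl natrX.
apply: (@le_trans _ _
    ((2 ^+ n * ((C * fine A) `^ q * fine P `^ (q / p)))%:E `^ q^-1)%E).
  apply: le_poweR2r; [by rewrite invr_ge0 (ltW q0)| |exact: total].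
  by apply: integral_ge0 => x _; rewrite lee_fin; exact: powR_ge0.
rewrite -[in leRHS](fineK fA) -[in leRHS](fineK fP) !poweR_EFin -!EFinM lee_fin.
rewrite orthant_total//; apply: ler_wpM2r; first exact: powR_ge0.
by apply: ler_wpM2r => //; rewrite lerDl.
Qed.

(** Passage from Borel to almost everywhere defined weights, and from the Borel
minorant of the gradient to the gradient. *)
Lemma global_bound (C : R) : 0 <= C -> @local_bound R n p q r rt rho C ->
  forall (w v f : 'rV[R]_n -> R),
      A_class p q r rt rho w v -> Lip_c f ->
      (Lnorm lam q%:E (fun x => (v x * f x)%:E)
       <= (((2 ^+ n) `^ q^-1 * C + 1)%:E * A_const p q r rt rho w v
          * Lnorm lam p%:E (fun x => (w x * euclidean_norm (gradient f x))%:E)))%E.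
Proof.
move=> C0 loc w v f [ww wv Aoo] [lipf csupp].
have p0 : 0 < p by exact: lt_trans p1.
have [w' [mw w0 ww']] := weight_representative ww.
have [v' [mv v0 vv']] := weight_representative wv.
have AE : A_const p q r rt rho w v = A_const p q r rt rho w' v'.
  rewrite /A_const; have -> // : A_term p q r rt w v = A_term p q r rt w' v'.
  by apply/funext => jm; exact: eq_A_term.
rewrite AE in Aoo *.
have [L L0 fL] := lipschitz_lip1 lipf.
have [M [c [fM fc]]] := Lip_c_bounds n0 L0 fL csupp.
have mG := measurable_partial_norm L0 fL.
have A0 : (0 < A_const p q r rt rho w' v')%E by exact: A_const_gt0.
have := global_bound_borel C0 loc mw mv mG w0 v0 (partial_norm_ge0 f) L0 fL fc fM
  (partial_le_norm f) Aoo.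
have -> : ((\int[lam]_x ((v' x * `|f x|) `^ q)%:E) `^ q^-1 =
    Lnorm lam q%:E (fun x => (v x * f x)%:E))%E.
  rewrite Lnorm_finE; congr (_ `^ _)%E; apply: ae_eq_ge0_integral => [x _|x _|].
  - by rewrite lee_fin; exact: powR_ge0.
  - by rewrite lee_fin; exact: powR_ge0.
  by apply: (ae_imply vv') => x ->; rewrite normrM (gtr0_norm (v0 x)).
move=> /le_trans; apply; apply: lee_wpmul2l.
  apply: mule_ge0; last exact: ltW A0.
  by rewrite lee_fin; exact: (addr_ge0 (mulr_ge0 (powR_ge0 _ _) C0) ler01).
rewrite Lnorm_finE; apply: le_poweR2r; first by rewrite invr_ge0 (ltW p0).
  by apply: integral_ge0 => x _; rewrite lee_fin; exact: powR_ge0.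
apply: ae_le_ge0_integral => [x _|x _|].
- by rewrite lee_fin; exact: powR_ge0.
- by rewrite lee_fin; exact: powR_ge0.
apply: (ae_imply ww') => x -> _; rewrite lee_fin.
have e0 : 0 <= euclidean_norm (gradient f x) by exact: sqrtr_ge0.
rewrite normrM (ger0_norm e0) (gtr0_norm (w0 x)).
apply: powR_le2r; first exact: ltW p0.
  by apply: mulr_ge0; [exact: ltW (w0 x)|exact: partial_norm_ge0].
by apply: ler_wpM2l; [exact: ltW (w0 x)|exact: partial_norm_le_gradient].
Qed.
End global.

(** [K] is bounded by a multiple of [K ^ (1 - 1 / q)], hence by the [q]-th power of the
factor. *)
Lemma absorb_local (R : realType) (p q cc e1 e2 AA P K : R) : 1 < q -> 0 < p ->
  0 <= cc -> 0 <= e1 -> 0 <= e2 -> 0 <= AA -> 0 <= P -> 0 <= K ->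
  K <= cc * (AA * ((e1 * P) `^ p^-1 * (e2 * K) `^ (1 - q^-1))) ->
  K <= (cc * (e1 `^ p^-1 * e2 `^ (1 - q^-1)) * AA) `^ q * P `^ (q / p).
Proof.
move=> q1 p0 cc0 e10 e20 AA0 P0 K0 H; set D := cc * _ * AA.
have D0 : 0 <= D by rewrite !mulr_ge0 ?powR_ge0.
have -> : D `^ q * P `^ (q / p) = (D * P `^ p^-1) `^ q.
  by rewrite powRM ?powR_ge0// -powRrM [p^-1 * q]mulrC.
apply: le_powR_absorb => //; first by rewrite mulr_ge0 ?powR_ge0.
apply: le_trans H _; rewrite (powRM _ e10 P0) (powRM _ e20 K0) /D.
by rewrite le_eqVlt; apply/orP; left; apply/eqP; ring.
Qed.

Lemma collect_local (R : realType) (p q cc e AA P : R) : 0 < q -> 0 < p ->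
  0 <= cc -> 0 <= e -> 0 <= AA -> 0 <= P ->
  (cc `^ q^-1 * e `^ p^-1 * AA) `^ q * P `^ (q / p) =
  cc * (AA `^ q * (e * P) `^ (q / p)).
Proof.
move=> q0 p0 cc0 e0 AA0 P0; rewrite [(e * P) `^ _]powRM//.
rewrite !powRM ?mulr_ge0 ?powR_ge0// -!powRrM mulVf ?gt_eqF//.
by rewrite powRr1// [p^-1 * q]mulrC; ring.
Qed.

Section local_cases.
Context (R : realType) (n : nat) (p q r rt : R).
Local Notation E := {ffun 'I_n -> bool}.
Hypotheses (p1 : 1 < p) (r1 : 1 < r).
Let kp := p / (p - 1) * r.
Let sg := kp / (kp - 1).
Let ec1 := embedding_const (p / sg).
Let ec2 := embedding_const (q / (q - 1) / (q * rt / (q * rt - 1))).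

Lemma embedding_const_ge0 (a : R) : 1 < a -> 0 <= embedding_const a.
Proof. by move=> a1; rewrite divr_ge0 ?powR_ge0// subr_ge0 ltW. Qed.

Lemma chain_const_ge0 (b : R) : 0 < b -> 0 <= chain_const n b.
Proof.
move=> b0; rewrite /chain_const !mulr_ge0 ?powR_ge0// invr_ge0 subr_ge0 ltW//.
exact: powR2_gt1.
Qed.

Let sg_bounds : 1 < sg /\ sg < p.
Proof.
have kp1 : 1 < kp by rewrite -[ltLHS]mulr1 ltr_pM// conjugate_gt1.
split; first exact: conjugate_gt1.
rewrite -[ltRHS](conjugateK p1); apply: conjugate_lt; first exact: conjugate_gt1.
by rewrite ltr_pMr// (lt_trans ltr01)// conjugate_gt1.
Qed.

Let ec1_ge0 : 0 <= ec1.
Proof.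
have [s1 sp] := sg_bounds.
by apply: embedding_const_ge0; rewrite ltr_pdivlMr ?mul1r// (lt_trans ltr01).
Qed.

(** Hoelder's inequality for sums with the exponents [s / q] and [p / q], which are
conjugate by the relation between [p], [q] and [s]. *)
Lemma local_bound_le1 (s : R) : rt = 1 -> 0 < q -> q <= 1 -> 0 < s -> q^-1 = p^-1 + s^-1 ->
  @local_bound R n p q r rt s%:E ((chain_const n q) `^ q^-1 * ec1 `^ p^-1).
Proof.
move=> rtE q0 q1 s0 qps jm w v f G L c e0 mw mv mG w0 v0 G0 L0 fL fc GX fe0 iG iP Aoo.
have rt0 : 0 < rt by rewrite rtE.
have p0 : 0 < p by apply: lt_trans p1.
have rho_pos : s%:E = +oo%E \/ exists2 t : R, s%:E = t%:E & 0 < t by right; exists s.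
have [iW iU] := top_integrable_weights p1 q0 r1 rt0 rho_pos jm mw mv w0 v0 Aoo.
set AA := fine _; have AA0 : 0 <= AA.
  by apply: fine_ge0; apply: ltW; exact: A_const_gt0.
have A0 j : (0 < A_term p q r rt w v j)%E.
  by apply: A_term_gt0 => //; apply: lt_trans r1.
have HA N (x : seq E -> R) : (forall s, 0 <= x s) ->
    tsum N (fun u => weight_term jm w v p q r rt u `^ q * x u `^ (q / p)) [::] <=
    AA `^ q * tsum N x [::] `^ (q / p).
  move=> x0; apply: (sum_hoelder2 (s := s)).
  - exact: s0.
  - exact: q0.
  - exact: divr_gt0.
  - by rewrite -mulrDr addrC -qps divff// gt_eqF.
  - exact: x0.
  have := tsum_A_term_le A0 jm N s0 Aoo; apply: le_trans.
  rewrite le_eqVlt; apply/orP; left; apply/eqP; apply: eq_bigr => u _.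
  by rewrite A_term_descendant.
have := local_estimate_le1 mw mv mG w0 v0 G0 L0 fL fc GX fe0 p1 q0 r1 iG iW iU iP
  rtE q1 AA0 HA.
move=> /le_trans; apply; rewrite lee_fin -/kp -/sg -/ec1.
have m0 : 0 <= mass jm (fun x => (w x * G x) `^ p) [::].
  by apply: mass_ge0 => x; exact: powR_ge0.
have cc0 := chain_const_ge0 q0.
by rewrite (collect_local q0 p0 cc0 ec1_ge0 AA0 m0).
Qed.

(** The exponents of the two embeddings are [1 / p] and [1 / q'].  If [p <= q] their
sum is at least [1] and a supremum of the coefficients suffices; otherwise
[1 / s] is exactly what is missing. *)
Lemma local_bound_gt1 (rho : \bar R) : 1 < rt -> 1 < q ->
  (p <= q /\ rho = +oo%E \/ exists2 s : R, rho = s%:E & 0 < s /\ q^-1 = p^-1 + s^-1) ->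
  @local_bound R n p q r rt rho
    (chain_const n 1 * (ec1 `^ p^-1 * ec2 `^ (1 - q^-1))).
Proof.
move=> rt1 q1 cases jm w v f G L c e0 mw mv mG w0 v0 G0 L0 fL fc GX fe0 iG iP Aoo.
have rt0 : 0 < rt by apply: lt_trans rt1.
have q0 : 0 < q by apply: lt_trans q1.
have p0 : 0 < p by apply: lt_trans p1.
have rho_pos : rho = +oo%E \/ exists2 t : R, rho = t%:E & 0 < t.
  by case: cases => [[_ ->]|[s -> []]]; [left|right; exists s].
have [iW iU] := top_integrable_weights p1 q0 r1 rt0 rho_pos jm mw mv w0 v0 Aoo.
set AA := fine _; have AA0 : 0 <= AA.
  by apply: fine_ge0; apply: ltW; exact: A_const_gt0.
have fA : A_const p q r rt rho w v \is a fin_num.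
  rewrite ge0_fin_numE; first exact: Aoo.
  by apply: ltW; exact: A_const_gt0.
have A0 j : (0 < A_term p q r rt w v j)%E.
  by apply: A_term_gt0 => //; apply: lt_trans r1.
have q'E : (q / (q - 1))^-1 = 1 - q^-1.
  by rewrite invf_div mulrBl divff ?gt_eqF// mul1r.
have q'0 : 0 < 1 - q^-1 by rewrite subr_gt0 invf_lt1.
have HA N (x y : seq E -> R) : (forall s, 0 <= x s) -> (forall s, 0 <= y s) ->
    tsum N (fun u => weight_term jm w v p q r rt u *
      (x u `^ p^-1 * y u `^ (q / (q - 1))^-1)) [::] <=
    AA * (tsum N x [::] `^ p^-1 * tsum N y [::] `^ (q / (q - 1))^-1).
  move=> x0 y0; rewrite q'E.
  case: cases => [[pq rhoE]|[s rhoE [s0 qps]]].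
    apply: sum_hoelder_bounded.
    - exact: AA0.
    - by rewrite invr_gt0.
    - exact: q'0.
    - have pq' : q^-1 <= p^-1 by rewrite lef_pV2.
      by rewrite addrCA lerDl subr_ge0.
    - exact: x0.
    - exact: y0.
    move=> u; rewrite -lee_fin /AA fineK// -A_term_descendant// rhoE.
    exact: A_term_le_sup.
  apply: (@sum_hoelder3 _ _ _ _ _ _ _ _ _ s).
  - by move=> u; exact: weight_term_ge0.
  - exact: AA0.
  - exact: s0.
  - by rewrite invr_gt0.
  - exact: q'0.
  - by rewrite qps; ring.
  - exact: x0.
  - exact: y0.
  have Aoo' : (A_const p q r rt s%:E w v < +oo)%E by rewrite -rhoE.
  have := tsum_A_term_le A0 jm N s0 Aoo'; rewrite -rhoE; apply: le_trans.
  rewrite le_eqVlt; apply/orP; left; apply/eqP; apply: eq_bigr => u _.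
  by rewrite A_term_descendant.
have LE := local_estimate_gt1 mw mv mG w0 v0 G0 L0 fL fc GX fe0 p1 q0 r1 iG iW iU iP
  rt1 q1 AA0 HA.
have q'1 : 1 < q / (q - 1) by exact: conjugate_gt1.
have qrt : 1 < q * rt by rewrite -[ltLHS]mulr1 ltr_pM.
have t1 : 1 < q * rt / (q * rt - 1) by exact: conjugate_gt1.
have ec2_ge0 : 0 <= ec2.
  apply: embedding_const_ge0; rewrite ltr_pdivlMr ?mul1r; last exact: lt_trans t1.
  by apply: conjugate_lt => //; rewrite ltr_pMr.
have m0 h : (forall x, 0 <= h x) -> 0 <= mass jm h [::] by exact: mass_ge0.
have vf0 x : 0 <= (v x * `|f x|) `^ q by exact: powR_ge0.
have wG0 x : 0 <= (w x * G x) `^ p by exact: powR_ge0.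
move: LE; set I := (\int[_]_(x in _) _)%E => LE.
have I0 : (0 <= I)%E by apply: integral_ge0 => x _; rewrite lee_fin; exact: vf0.
have fI : I \is a fin_num by rewrite (ge0_fin_numE I0); exact: le_lt_trans LE (ltey _).
have IE : I = (mass jm (fun x => (v x * `|f x|) `^ q) [::])%:E.
  by rewrite -[LHS](fineK fI).
move: LE; rewrite IE !lee_fin q'E; apply: absorb_local.
- exact: q1.
- exact: p0.
- exact: chain_const_ge0.
- exact: ec1_ge0.
- exact: ec2_ge0.
- exact: AA0.
- exact: m0.
- exact: m0.
Qed.
End local_cases.

(** * The two-weight inequality *)

Theorem corollary7p1 (R : realType) (n : nat) (p q r rt : R) (rho : \bar R) :
  (0 < n)%N ->
  [\/ [/\ 1 < p, p <= q, 1 < r, 1 < rt & rho = +oo%E],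
      exists s : R, [/\ [/\ 1 < q, q < p, 1 < r & 1 < rt],
        rho = s%:E, 0 < s & q^-1 = p^-1 + s^-1]
    | exists s : R, [/\ [/\ 0 < q, q <= 1, 1 < p, 1 < r & rt = 1],
        rho = s%:E, 0 < s & q^-1 = p^-1 + s^-1]] ->
  exists2 C : R, 0 < C &
    forall (w v f : 'rV[R]_n -> R),
      A_class p q r rt rho w v -> Lip_c f ->
      (Lnorm (lebesgue_rV R n) q%:E (fun x => (v x * f x)%:E)
       <= C%:E * A_const p q r rt rho w v
          * Lnorm (lebesgue_rV R n) p%:E
              (fun x => (w x * euclidean_norm (gradient f x))%:E))%E.
Proof.
move=> n0 cases.
suff [C C0 [p1 [q0 [r1 [rt0 [rho_pos loc]]]]]] : exists2 C : R, 0 <= C &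
    1 < p /\ 0 < q /\ 1 < r /\ 0 < rt /\
    (rho = +oo%E \/ exists2 s : R, rho = s%:E & 0 < s) /\
    @local_bound R n p q r rt rho C.
  exists ((2 ^+ n) `^ q^-1 * C + 1); last exact: global_bound.
  by rewrite ltr_wpDl// mulr_ge0// powR_ge0.
case: cases => [[p1 pq r1 rt1 rhoE]|[s [[q1 qp r1 rt1] rhoE s0 qps]]
    |[s [[q0 q1 p1 r1 rtE] rhoE s0 qps]]].
- have q1 : 1 < q by exact: lt_le_trans pq.
  have loc := local_bound_gt1 (n := n) p1 r1 rt1 q1 (or_introl (conj pq rhoE)).
  eexists; last first.
    do !split; [exact: p1|exact: lt_trans q1|exact: r1|exact: lt_trans rt1|by left|].
    exact: loc.
  by rewrite mulr_ge0 ?chain_const_ge0// mulr_ge0 ?powR_ge0.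
- have p1 : 1 < p by exact: lt_trans qp.
  have loc := local_bound_gt1 (n := n) p1 r1 rt1 q1
    (or_intror (ex_intro2 _ _ s rhoE (conj s0 qps))).
  eexists; last first.
    do !split; [exact: p1|exact: lt_trans q1|exact: r1|exact: lt_trans rt1|by right; exists s|].
    exact: loc.
  by rewrite mulr_ge0 ?chain_const_ge0// mulr_ge0 ?powR_ge0.
- have loc := local_bound_le1 (n := n) p1 r1 rtE q0 q1 s0 qps.
  rewrite rhoE; eexists; last first.
    do !split; [exact: p1|exact: q0|exact: r1|by rewrite rtE|by right; exists s|].
    exact: loc.
  by rewrite mulr_ge0 ?powR_ge0.
Qed.
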